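(* Let $D_i\subset\mathbb{C}^{n_i}$, $n_i\ge1$, $i=1,2$, be domains with dense $C^1$ boundary, i.e. for all $p\in\partial D_i$ and all $\delta>0$ there exists $q\in\partial D_i\cap B^{n_i}(p,\delta)$ such that $\partial D_i$ is $C^1$ smooth near $q$. Let $n\ge n_1+n_2$ and let $D=D_1\times D_2$, regarded as a subset of $\mathbb{C}^n$ (as $D_1\times D_2\times\{0\}$ when $n_1+n_2<n$). If $D$ is relatively compact in the unit ball $B^n$ and $D':=B^n\setminus\overline{D}$ is connected, then for every $z\in D'$, $$s_{D'}(z)=\tilde e_{D'}(z)=d_{c_{B^n}}^{\partial D}(z).$$
   Context: $B^n$ is the open Euclidean unit ball in $\mathbb{C}^n$, $B^n(p,\delta)$ the open Euclidean ball with centre $p$ and radius $\delta$, $\mathbb{D}$ the unit disk in $\mathbb{C}$, and $O(X,Y)$ the set of holomorphic maps from $X$ into $Y$. ''$\partial D_i$ is $C^1$ smooth near $q$'' means that there are a neighbourhood $U$ of $q$ and a real $C^1$ function $\rho$ on $U$ with nowhere vanishing differential such that $D_i\cap U=\{\rho<0\}$. $\partial D$ is the boundary of $D$ in $\mathbb{C}^n$. Carathéodory pseudodistance on a domain $X$: $c_X(z,w)=\sup\{\tanh^{-1}|\lambda| : f\in O(X,\mathbb{D}),\ f(z)=0,\ f(w)=\lambda\}$, with balls $B^c_X(z,r)=\{w\in X: c_X(z,w)<r\}$. For a nonempty compact $S\subset B^n$ and $z\in B^n\setminus S$, $d_{c_{B^n}}^{S}(z)=\min_{w\in S}\tanh[c_{B^n}(z,w)]$.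 For a bounded domain $X\subset\mathbb{C}^n$ and $z\in X$: squeezing function $s_X(z)=\sup\{r>0:\ rB^n\subset f(X)$ for some injective $f\in O(X,B^n)$ with $f(z)=0\}$; Fridman invariant $\tilde e_X(z)=\sup\{\tanh(r):\ B^c_X(z,r)\subset f(B^n)$ for some injective $f\in O(B^n,X)\}$. *)

(* Defs.v *)
From HB Require Import structures.
From mathcomp Require Import all_boot all_order all_algebra.
From mathcomp Require Import all_classical all_reals all_analysis.
From mathcomp Require Import complex.

Set Implicit Arguments.
Unset Strict Implicit.
Unset Printing Implicit Defensive.

Import Order.TTheory GRing.Theory Num.Theory.
Import numFieldNormedType.Exports.

Local Open Scope classical_set_scope.
Local Open Scope ring_scope.
Local Open Scope complex_scope.

(* The regular alias [R[i]^o] is what carries the topology and the R[i]-normed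
   module structure; the induced (sup-norm) topology on row vectors is the
   Euclidean one. *)
Notation Cvec R n := ('rV[R[i]^o]_n).

Section Hyperbolic.
Variable R : realType.
Implicit Type x : R.

Definition tanh x : R := (expR x - expR (- x)) / (expR x + expR (- x)).

Definition artanh x : R := ln ((1 + x) / (1 - x)) / 2.

End Hyperbolic.

Section Euclidean.
Variables (R : realType) (n : nat).

Definition cabs (w : R[i]^o) : R := ComplexField.Normc.normc w.

Definition enorm (z : Cvec R n) : R := Num.sqrt (\sum_(i < n) cabs (z 0 i) ^+ 2).

Definition eball (p : Cvec R n) (r : R) : set (Cvec R n) :=
  [set z | enorm (z - p) < r].

Definition unit_ball : set (Cvec R n) := eball 0 1.

Definition unit_disk : set R[i]^o := [set w | cabs w < 1].

End Euclidean.
Arguments unit_ball : clear implicits.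
Arguments unit_disk : clear implicits.

Definition boundary (T : topologicalType) (A : set T) : set T :=
  closure A `\` A°.

Definition is_domain (T : topologicalType) (A : set T) : Prop :=
  [/\ A !=set0, open A & connected A].

(* Scalars are complex, so [differentiable] is complex Frechet
   differentiability: for open X this is the set of holomorphic maps X -> Y,
   represented by total functions whose values outside X are irrelevant. *)
Definition hol (C : numClosedFieldType) (V W : normedModType C)
    (X : set V) (Y : set W) : set (V -> W) :=
  [set f | (forall z, X z -> differentiable f z) /\ f @` X `<=` Y].

Section C1Boundary.
Variables (R : realType) (n : nat).
Implicit Types (U D : set (Cvec R n)) (rho : Cvec R n -> R).

Definition of_real_coord (p : 'rV[R]_n * 'rV[R]_n) : Cvec R n :=
  \row_j (p.1 0 j +i* p.2 0 j).

(* rho is read in the real coordinates (x, y), z = x + iy, so that ['d] below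
   is the real differential. *)
Definition real_diff rho (p : 'rV[R]_n * 'rV[R]_n) :
    'rV[R]_n * 'rV[R]_n -> R := 'd (rho \o of_real_coord) p.

(* In finite dimension, continuity of p |-> real_diff rho p v for each v
   is continuity of the differential. *)
Definition C1_on U rho : Prop :=
  forall p, U (of_real_coord p) ->
    differentiable (rho \o of_real_coord) p /\
    forall v, {for p, continuous (fun p' => real_diff rho p' v)}.

Definition C1_smooth_near D (q : Cvec R n) : Prop :=
  exists U rho,
    [/\ open U, U q, C1_on U rho,
        (forall p, U (of_real_coord p) -> exists v, real_diff rho p v != 0)
      & D `&` U = [set z | U z /\ rho z < 0]].

Definition dense_C1_boundary D : Prop :=
  forall p (delta : R), boundary D p -> 0 < delta ->
    exists q, [/\ boundary D q, eball p delta q & C1_smooth_near D q].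

End C1Boundary.

Section Product.
Variable R : realType.

Definition pad m n (z : Cvec R m) : Cvec R n :=
  \row_(j < n) oapp (z 0) 0 (insub (val j) : option 'I_m).

(* D1 x D2 x {0} as a subset of C^n, for n1 + n2 <= n. *)
Definition prod_in n n1 n2 (D1 : set (Cvec R n1)) (D2 : set (Cvec R n2)) :
    set (Cvec R n) :=
  [set pad n (row_mx z1 z2) | z1 in D1 & z2 in D2].

Definition relatively_compact_in n (D X : set (Cvec R n)) : Prop :=
  compact (closure D) /\ closure D `<=` X.

End Product.

Arguments pad {R m} n z.
Arguments prod_in {R} n {n1 n2} D1 D2.

Section Invariants.
Variables (R : realType) (n : nat).
Implicit Types (X S : set (Cvec R n)) (z w : Cvec R n).

Definition caratheodory X z w : R :=
  sup [set artanh (cabs (f w)) | f in hol X (unit_disk R) `&` [set f | f z = 0]].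

Definition caratheodory_ball X z (r : R) : set (Cvec R n) :=
  [set w | X w /\ caratheodory X z w < r].

Definition minimums (A : set R) : set R := A `&` lbound A.

(* The minimum over w in S of tanh (c_{B^n}(z, w)), with the dummy value 0 when
   no minimum exists; for S nonempty and compact in the ball it always does. *)
Definition caratheodory_dist S z : R :=
  xget 0 (minimums [set tanh (caratheodory (unit_ball R n) z w) | w in S]).

Definition squeezing X z : R :=
  sup [set r : R | 0 < r /\
    exists f : Cvec R n -> Cvec R n,
      [/\ hol X (unit_ball R n) f, set_inj X f, f z = 0
        & eball 0 r `<=` f @` X]].

Definition fridman X z : R :=
  sup [set tanh r | r in [set r : R | 0 < r /\
    exists f : Cvec R n -> Cvec R n,
      [/\ hol (unit_ball R n) X f, set_inj (unit_ball R n) f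
        & caratheodory_ball X z r `<=` f @` unit_ball R n]]].

End Invariants.

(* Main.v *)
(* Let [K] be the closure of [D], [phi] the automorphism of the ball [B]
   exchanging [0] and [z], and [d] the minimum of [|phi|] on [K]. Bounded
   holomorphic functions on [B \ K] extend to [B] (Hartogs), so [B \ K] has the
   Caratheodory distance of [B], and [phi] and [u |-> phi (d u)] show that both
   invariants are at least [d].

   If [f] realised a squeezing radius [r > d], its extension [F] would satisfy
   [|F (phi u)| <= |u|], and the identity theorem would give
   [f^-1 (F (phi u)) = phi u] for [|u| < r], sending a point of [K] into [B \ K].

   If [f] realised a Fridman radius larger than [d], then [g = f^-1] would be
   holomorphic and injective on [N \ K] for a neighbourhood [N] of a boundary
   point of [D], with [|g| -> 1] at [K]. When [n1 + n2 < n], [K] lies in a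
   hyperplane and a transverse punctured disc contradicts the maximum principle.
   Otherwise consider a boundary point [(a, b)] of [D1 x D2] with [a] in the
   boundary of [D1], say. For close [y] and [y'] in [D2],
   [<g (x, y) - g (x, y'), e>] tends to [0] as [x] approaches [K] by
   Schwarz-Pick; extended by [0] it is continuous in [x], holomorphic off its
   zeros, and zero on [D1], hence identically zero near [a] (Rado). As the [C^1]
   boundary leaves room outside the closure of [D1], this contradicts the
   injectivity of [g].

   Integrals are avoided: Goursat's argument is run on trapezoid sums, Cauchy's
   formula on means over roots of unity, and holomorphy of [f^-1] (Osgood) is
   derived from the maximum principle. *)

(* Two obstacles shape the proof. The comparison function near the boundary of [D1] is seen to be
   continuous there, but not to be holomorphic across it. Instead of proving Rado's theorem, the
   class [rado] itself (continuous, holomorphic off the zeros) is carried along, because it already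
   obeys the maximum principle and the identity theorem. The same class serves for the Jacobian of
   an injective map transported to the image, at a stage where nothing is known about the inverse.

   Trapezoid sums yield only a mean value inequality with a lossy factor 2. It disappears on passing
   to high powers, a device which also controls quotients at singularities:
   [c * x ^+ m <= d * A ^+ m] for every [m] forces [x <= A].

   Hartogs extension works without cutoff functions since a shell near the unit sphere avoids [K]: a
   Cauchy integral in one coordinate, over a circle in the shell whose radius depends on the point,
   is defined on the whole ball. A second coordinate provides points where it equals [f], and
   connectedness of the complement propagates the equality. *)
Require Import Defs.
From HB Require Import structures.
From mathcomp Require Import all_boot all_order all_algebra.
From mathcomp Require Import all_classical all_reals all_analysis.
From mathcomp Require Import perm complex ring lra.
Set Implicit Arguments. Unset Strict Implicit. Unset Printing Implicit Defensive.
Import Order.TTheory GRing.Theory Num.Theory.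
Import numFieldNormedType.Exports.
Local Open Scope classical_set_scope.
Local Open Scope ring_scope.
Local Open Scope complex_scope.
Local Notation Re := complex.Re.
Local Notation Im := complex.Im.

(** * Norms and complex differentiability *)

Section Norm.
Variable R : realType.
Local Notation C := (R[i]^o).

Lemma cabs0 : cabs (0 : C) = 0.
Proof. exact: ComplexField.Normc.normc0. Qed.

Lemma cabs1 : cabs (1 : C) = 1.
Proof. exact: ComplexField.Normc.normc1. Qed.

Lemma cabsM (a b : C) : cabs (a * b) = cabs a * cabs b.
Proof. exact: ComplexField.Normc.normcM. Qed.

Lemma cabsV (a : C) : cabs a^-1 = (cabs a)^-1.
Proof. exact: ComplexField.Normc.normcV. Qed.

Lemma cabsX (a : C) n : cabs (a ^+ n) = cabs a ^+ n.
Proof. by elim: n => [|n IH]; rewrite ?expr0 ?cabs1// !exprS cabsM IH. Qed.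

Lemma cabs_real (x : R) : cabs (x%:C : C) = `|x|.
Proof. by rewrite /cabs/= expr0n/= addr0 sqrtr_sqr. Qed.

Lemma cabs_nat k : cabs (k%:R : C) = k%:R.
Proof. by rewrite -(rmorph_nat (real_complex R)) cabs_real ger0_norm. Qed.

Lemma cabs_i : cabs ('i%C : C) = 1.
Proof. by rewrite /cabs/= expr0n/= add0r expr1n sqrtr1. Qed.

Lemma cabs_ge0 (a : C) : 0 <= cabs a.
Proof. by case: a => a b; rewrite /cabs/= sqrtr_ge0. Qed.

Lemma cabs_sqr (a : C) : cabs a ^+ 2 = Re a ^+ 2 + Im a ^+ 2.
Proof. by case: a => a b; rewrite /cabs/= sqr_sqrtr// addr_ge0// sqr_ge0. Qed.

Lemma cabs_eq0 (a : C) : (cabs a == 0) = (a == 0).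
Proof.
apply/eqP/eqP => [|->]; last exact: cabs0.
exact: ComplexField.Normc.eq0_normc.
Qed.

Lemma cabs_gt0 (a : C) : (0 < cabs a) = (a != 0).
Proof. by rewrite lt_def cabs_eq0 cabs_ge0 andbT. Qed.

Lemma Re_le_cabs (a : C) : `|Re a| <= cabs a.
Proof.
case: a => a b; rewrite /cabs/= -sqrtr_sqr ler_wsqrtr// lerDl sqr_ge0 //.
Qed.

Lemma Im_le_cabs (a : C) : `|Im a| <= cabs a.
Proof.
case: a => a b; rewrite /cabs/= -[`|b|]sqrtr_sqr ler_wsqrtr// lerDr sqr_ge0 //.
Qed.

Section NormedModule.
Variable V : normedModType R[i].

(** Norms over [R[i]] are complex numbers; their real parts live in [R], where the order is total
    and [lra] applies. *)
Definition nm (x : V) : R := Re `|x|.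

Lemma normE (x : V) : `|x| = (nm x)%:C.
Proof. by rewrite /nm RRe_real// normr_real. Qed.

Lemma nm_ge0 x : 0 <= nm x.
Proof. by rewrite -ler0c -normE. Qed.

Lemma nm0 : nm 0 = 0.
Proof. by rewrite /nm normr0. Qed.

Lemma nm_eq0 x : (nm x == 0) = (x == 0).
Proof.
apply/eqP/eqP => [h|->]; last exact: nm0.
by apply/normr0_eq0; rewrite normE h.
Qed.

Lemma nm_gt0 x : (0 < nm x) = (x != 0).
Proof. by rewrite lt_def nm_eq0 nm_ge0 andbT. Qed.

Lemma nmN x : nm (- x) = nm x.
Proof. by rewrite /nm normrN. Qed.

Lemma nmBC x y : nm (x - y) = nm (y - x).
Proof. by rewrite -nmN opprB. Qed.

Lemma nmD x y : nm (x + y) <= nm x + nm y.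
Proof. by rewrite -lecR rmorphD/= -!normE ler_normD. Qed.

Lemma nmB x y : nm (x - y) <= nm x + nm y.
Proof. by rewrite -(nmN y) nmD. Qed.

Lemma nm_tri x y z : nm (x - z) <= nm (x - y) + nm (y - z).
Proof. by apply: le_trans (nmD _ _); rewrite addrA subrK. Qed.

Lemma nm_leD x y : nm x <= nm y + nm (x - y).
Proof. by apply: le_trans (nmD _ _); rewrite addrC subrK. Qed.

Lemma nmZ (a : C) x : nm (a *: x) = cabs a * nm x.
Proof.
apply: (@complexI R); rewrite -normE normrZ normE rmorphM/=.
by congr (_ * _); rewrite normE.
Qed.

Lemma nbhs_nm (x : V) (A : set V) :
  nbhs x A <-> exists2 e : R, 0 < e & forall y, nm (y - x) < e -> A y.
Proof.
split.
  move=> /nbhs_ballP[e/= e0 xA]; exists (Re e).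
    by move: e0; rewrite ltcE/= => /andP[].
  move=> y ye; apply: xA; rewrite -ball_normE/= distrC normE.
  by move: e0 ye; rewrite !ltcE/= => /andP[-> _] ->.
move=> [e e0 xA]; apply/nbhs_ballP; exists e%:C => /=; first by rewrite ltcR.
by move=> y; rewrite -ball_normE/= distrC normE ltcR; exact: xA.
Qed.

End NormedModule.

Lemma nmE (a : C) : nm a = cabs a.
Proof. by []. Qed.

Lemma cabsN (a : C) : cabs (- a) = cabs a.
Proof. by rewrite -!nmE nmN. Qed.

Lemma cabsD (a b : C) : cabs (a + b) <= cabs a + cabs b.
Proof. by rewrite -!nmE nmD. Qed.

Lemma cabsB (a b : C) : cabs (a - b) <= cabs a + cabs b.
Proof. by rewrite -!nmE nmB. Qed.

Lemma cabsBC (a b : C) : cabs (a - b) = cabs (b - a).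
Proof. by rewrite -!nmE nmBC. Qed.

Lemma cabs_leD (a b : C) : cabs a <= cabs b + cabs (a - b).
Proof. by rewrite -!nmE nm_leD. Qed.

Lemma diff_affine (V : normedModType R[i]) (p q : V) (t : C) :
  differentiable (fun t : C => p + t *: q) t.
Proof. by []. Qed.

Lemma diff_affine1 (p c t : C) : differentiable (fun t : C => p + c * t) t.
Proof.
have -> : (fun t : C => p + c * t) = (fun t : C => p + t *: c).
  by apply/funext => v; rewrite mulrC.
exact: diff_affine.
Qed.

Section Maps.
Variables V W : normedModType R[i].
Implicit Types (f : V -> W) (x : V).

Lemma cont_nm f x : {for x, continuous f} <->
  forall e : R, 0 < e -> exists2 d : R, 0 < d &
    forall y, nm (y - x) < d -> nm (f y - f x) < e.
Proof.
split=> [cf e e0|H A].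
  have : nbhs (f x) [set y | nm (y - f x) < e] by apply/nbhs_nm; exists e.
  by move=> /cf /nbhs_nm[d d0 H]; exists d.
move=> /nbhs_nm[e e0 fA]; have [d d0 dH] := H e e0.
by apply/nbhs_nm; exists d => // y /dH; exact: fA.
Qed.

Lemma diff_eps f x : differentiable f x -> forall e : R, 0 < e ->
  exists2 d : R, 0 < d &
    forall h, nm h < d -> nm (f (x + h) - f x - 'd f x h) <= e * nm h.
Proof.
move=> /diff_locally fE e e0.
have e0' : 0 < e%:C by rewrite ltcR.
have /eqadd_some_oP /(_ _ e0') /nbhs_nm[d d0 dH] := fE.
exists d => // h hd; have := dH h; rewrite subr0 => /(_ hd) /=.
rewrite !normE -rmorphM lecR/=; congr (nm _ <= _).
by rewrite !fctE/= opprD addrA [h + x]addrC.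
Qed.

(** [L] is linear in the algebraic sense only; the bound by [k] supplies the continuity that a
    differential must have. *)
Lemma eps_diff f x (L : {linear V -> W}) (k : R) :
  (forall h, nm (L h) <= k * nm h) ->
  (forall e : R, 0 < e -> exists2 d : R, 0 < d &
    forall h, nm h < d -> nm (f (x + h) - f x - L h) <= e * nm h) ->
  differentiable f x /\ 'd f x = L :> (V -> W).
Proof.
move=> Lk fL.
have Lc : continuous L.
  move=> y; apply/cont_nm => e e0; exists (e / (`|k| + 1)).
    by rewrite divr_gt0// ltr_wpDl.
  move=> z; rewrite ltr_pdivlMr ?ltr_wpDl// => zy; rewrite -linearB.
  apply: le_lt_trans (Lk _) _; apply: le_lt_trans zy; rewrite mulrC.
  by apply: ler_wpM2l; rewrite ?nm_ge0// ler_wpDr// ler_norm.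
have fE : f \o shift x = cst (f x) + L +o_ (0 : V) id.
  apply/eqaddoP => e e0; apply/nbhs_nm.
  have e0' : 0 < Re e by move: e0; rewrite ltcE/= => /andP[].
  have [d d0 dH] := fL _ e0'; exists d => // h; rewrite subr0 => /dH.
  have -> : e = (Re e)%:C by rewrite RRe_real// gtr0_real.
  rewrite !normE -rmorphM lecR/=; congr (nm _ <= _).
  by rewrite !fctE/= opprD addrA [h + x]addrC.
have dfE := diff_unique Lc fE; split=> //.
by apply/diff_locallyP; rewrite dfE.
Qed.

End Maps.

Section Rules.
Variables V W : normedModType R[i].
Implicit Types (f g : V -> C) (x : V).

Lemma dif_cst (W' : normedModType R[i]) (c : W') x : differentiable (fun _ : V => c) x.
Proof. exact: differentiable_cst. Qed.

Lemma dif_mul f g x : differentiable f x -> differentiable g x ->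
  differentiable (fun y => f y * g y) x.
Proof. exact: differentiableM. Qed.

Lemma dif_add f g x : differentiable f x -> differentiable g x ->
  differentiable (fun y => f y + g y) x.
Proof. exact: differentiableD. Qed.

Lemma dif_sub f g x : differentiable f x -> differentiable g x ->
  differentiable (fun y => f y - g y) x.
Proof. exact: differentiableB. Qed.

Lemma dif_inv f x : differentiable f x -> f x != 0 ->
  differentiable (fun y => (f y)^-1) x.
Proof. exact: differentiableV. Qed.

Lemma dif_id x : differentiable (fun y : V => y) x.
Proof. by []. Qed.

Lemma dif_exp f x n : differentiable f x -> differentiable (fun y => f y ^+ n) x.
Proof.
move=> hf; elim: n => [|n IH]; first exact: dif_cst.
have -> : (fun y => f y ^+ n.+1) = (fun y => f y * f y ^+ n).
  by apply/funext => y; rewrite exprS.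
exact: dif_mul.
Qed.

Lemma dif_line (f : V -> W) (x v : V) (t : C) :
  differentiable f (x + t *: v) -> differentiable (fun t : C => f (x + t *: v)) t.
Proof.
move=> df; apply: (@differentiable_comp _ C V W (fun t => x + t *: v) f).
  exact: diff_affine.
exact: df.
Qed.

Lemma dif_shift (f : V -> W) (x v : V) :
  differentiable f (x + v) -> differentiable (fun y => f (y + v)) x.
Proof.
move=> df; apply: (@differentiable_comp _ V V W (fun y => y + v) f).
  by apply: differentiableD; [exact: dif_id|exact: dif_cst].
exact: df.
Qed.

End Rules.

End Norm.

(** * Goursat's theorem *)

Section Goursat.
Variable R : realType.
Local Notation C := (R[i]^o).
Implicit Types (f g : C -> C) (a v w l z : C) (N : nat).
Local Notation i := ('i%C : C).

(* Trapezoid sum of [f] over the segment from [a] to [a + v] cut into [2 ^ N]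
   equal parts. *)
Fixpoint trap f N a v : C :=
  if N is N'.+1 then trap f N' a (v / 2) + trap f N' (a + v / 2) (v / 2)
  else (f a + f (a + v)) / 2 * v.

Lemma trap_lin f g (c : C) N a v :
  trap (fun w => c * f w + g w) N a v = c * trap f N a v + trap g N a v.
Proof.
elim: N a v => [|N IH] a v /=; last by rewrite !IH; ring.
by field.
Qed.

Lemma trap_aff (c d : C) N a v :
  trap (fun w => c + d * w) N a v = c * v + d * (a * v + v ^+ 2 / 2).
Proof.
elim: N a v => [|N IH] a v /=; first by field.
by rewrite !IH; field.
Qed.

Lemma trap_le f N a v (M : R) :
  (forall t : R, 0 <= t <= 1 -> cabs (f (a + t%:C * v)) <= M) ->
  cabs (trap f N a v) <= M * cabs v.
Proof.
elim: N a v => [|N IH] a v fM /=.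
  have h0 : cabs (f a) <= M.
    by have := fM 0; rewrite lexx ler01 mul0r addr0; exact.
  have h1 : cabs (f (a + v)) <= M.
    by have := fM 1; rewrite lexx ler01 mul1r; exact.
  rewrite !cabsM cabsV cabs_nat ler_wpM2r ?cabs_ge0// ler_pdivrMr//.
  by apply: le_trans (cabsD _ _) _; lra.
have E : cabs (v / 2) = cabs v / 2 by rewrite cabsM cabsV cabs_nat.
have -> : M * cabs v = M * cabs (v / 2) + M * cabs (v / 2) by rewrite E; field.
apply: le_trans (cabsD _ _) _; apply: lerD; apply: IH => t t01.
  have -> : a + t%:C * (v / 2) = a + (t / 2)%:C * v.
    by rewrite rmorphM/= fmorphV/= rmorph_nat; ring.
  by apply: fM; lra.
have -> : a + v / 2 + t%:C * (v / 2) = a + ((1 + t) / 2)%:C * v.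
  by rewrite rmorphM rmorphD/= fmorphV/= rmorph_nat; ring.
by apply: fM; lra.
Qed.

(** Meant for [1 / w] around a square: a lower bound on the imaginary part takes the place of the
    contour integral [2 pi i]. *)
Lemma trap_Im f N a v (c : R) :
  (forall t : R, 0 <= t <= 1 -> c <= Im (f (a + t%:C * v) * v)) ->
  c <= Im (trap f N a v).
Proof.
have half (z : C) : Im (z / 2) = Im z / 2.
  have -> : z / 2 = z * (2^-1 : R)%:C by rewrite fmorphV/= rmorph_nat.
  by case: z => x y /=; rewrite mulr0 add0r.
have ImD (z w : C) : Im (z + w) = Im z + Im w by case: z w => [? ?] [? ?].
elim: N a v c => [|N IH] a v c fc /=.
  have h0 : c <= Im (f a * v).
    by have := fc 0; rewrite lexx ler01 mul0r addr0; exact.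
  have h1 : c <= Im (f (a + v) * v).
    by have := fc 1; rewrite lexx ler01 mul1r; exact.
  have -> : (f a + f (a + v)) / 2 * v = (f a * v + f (a + v) * v) / 2 by ring.
  by rewrite half ImD; lra.
have -> : c = c / 2 + c / 2 by field.
rewrite ImD; apply: lerD; apply: IH => t t01.
  have -> : a + t%:C * (v / 2) = a + (t / 2)%:C * v.
    by rewrite rmorphM/= fmorphV/= rmorph_nat; ring.
  by rewrite mulrA half ler_pM2r ?invr_gt0//; apply: fc; lra.
have -> : a + v / 2 + t%:C * (v / 2) = a + ((1 + t) / 2)%:C * v.
  by rewrite rmorphM rmorphD/= fmorphV/= rmorph_nat; ring.
by rewrite mulrA half ler_pM2r ?invr_gt0//; apply: fc; lra.
Qed.

(** A complex side [l] allows rotated squares, so that the four quadrants around a point are squares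
    sharing that corner. *)
Definition square f N a l : C :=
  trap f N a l + trap f N (a + l) (i * l) - trap f N (a + i * l) l -
  trap f N a (i * l).

(** Exact at every level: a side cut into [2 ^ N.+1] parts is two half sides cut into [2 ^ N] parts,
    and the inner edges cancel in pairs. *)
Lemma square_split f N a l : square f N.+1 a l =
  square f N a (l / 2) + square f N (a + l / 2) (l / 2) +
  square f N (a + i * (l / 2)) (l / 2) +
  square f N (a + (1 + i) * (l / 2)) (l / 2).
Proof.
rewrite /square /=.
have -> : i * l / 2 = i * (l / 2) by ring.
have -> : a + l = a + l / 2 + l / 2 by field.
have -> : a + i * l = a + i * (l / 2) + i * (l / 2) by field.
have -> : a + (1 + i) * (l / 2) = a + l / 2 + i * (l / 2) by ring.
have -> : a + i * (l / 2) + l / 2 = a + l / 2 + i * (l / 2) by ring.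
have -> : a + l / 2 + i * (l / 2) + l / 2 =
  a + l / 2 + l / 2 + i * (l / 2) by ring.
have -> : a + l / 2 + i * (l / 2) + i * (l / 2) =
  a + i * (l / 2) + i * (l / 2) + l / 2 by ring.
ring.
Qed.

Lemma square_lin f g (c : C) N a l :
  square (fun w => c * f w + g w) N a l = c * square f N a l + square g N a l.
Proof. by rewrite /square !trap_lin; ring. Qed.

(** The trapezoid rule integrates affine functions exactly, hence only the error of the first-order
    expansion survives in Goursat's estimate. *)
Lemma square_aff (c d : C) N a l : square (fun w => c + d * w) N a l = 0.
Proof.
rewrite /square !trap_aff.
have -> : (i * l) ^+ 2 = - l ^+ 2 by rewrite exprMn sqr_i mulN1r.
have -> : (a + l) * (i * l) = a * i * l + i * l ^+ 2 by ring.
have -> : (a + i * l) * l = a * l + i * l ^+ 2 by ring.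
by ring.
Qed.

Definition in_square a l : set C :=
  [set w | exists z : C,
    [/\ 0 <= Re z <= 1, 0 <= Im z <= 1 & w = a + z * l]].

Lemma square_le f N a l (M : R) :
  (forall w, in_square a l w -> cabs (f w) <= M) ->
  cabs (square f N a l) <= 4 * (M * cabs l).
Proof.
move=> fM; rewrite /square.
have E : cabs (i * l) = cabs l by rewrite cabsM cabs_i mul1r.
have h1 : cabs (trap f N a l) <= M * cabs l.
  apply: trap_le => t t01; apply: fM; exists t%:C; split=> //=.
  by rewrite lexx ler01.
have h2 : cabs (trap f N (a + l) (i * l)) <= M * cabs l.
  rewrite -E; apply: trap_le => t t01; apply: fM; exists (1 +i* t); split=> //=.
    by rewrite lexx ler01.
  by rewrite [1 +i* t]complexE/=; ring.
have h3 : cabs (trap f N (a + i * l) l) <= M * cabs l.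
  apply: trap_le => t t01; apply: fM; exists (t +i* 1); split=> //=.
    by rewrite lexx ler01.
  by rewrite [t +i* 1]complexE/=; ring.
have h4 : cabs (trap f N a (i * l)) <= M * cabs l.
  rewrite -E; apply: trap_le => t t01; apply: fM; exists (0 +i* t); split=> //=.
    by rewrite lexx ler01.
  by rewrite [0 +i* t]complexE/= add0r; ring.
have := cabsB (trap f N a l + trap f N (a + l) (i * l) -
  trap f N (a + i * l) l) (trap f N a (i * l)).
have := cabsB (trap f N a l + trap f N (a + l) (i * l))
  (trap f N (a + i * l) l).
have := cabsD (trap f N a l) (trap f N (a + l) (i * l)).
move: h1 h2 h3 h4; lra.
Qed.

Lemma half_pow_lt (e c : R) : 0 < e -> exists k : nat, c / 2 ^+ k < e.
Proof.
move=> e0.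
have /cvgrPdist_lt /(_ _ e0) [k _ /(_ k (leqnn k))] :
    (fun k : nat => c / 2 ^+ k) @ \oo --> (0 : R).
  have -> : (fun k : nat => c / 2 ^+ k) = geometric c (2^-1).
    by apply/funext => k; rewrite /geometric /= exprVn.
  by apply: cvg_geometric; rewrite ger0_norm//; lra.
rewrite sub0r normrN /= => h; exists k; apply: le_lt_trans h.
exact: ler_norm.
Qed.

Lemma nested_point (x : nat -> R) :
  (forall k, x k <= x k.+1 /\ x k.+1 + (2^-1) ^+ k.+1 <= x k + (2^-1) ^+ k) ->
  exists c, forall k, x k <= c <= x k + (2^-1) ^+ k.
Proof.
move=> H.
have xle k j : x k <= x (k + j)%N.
  by elim: j => [|j IH]; rewrite ?addn0// addnS (le_trans IH)//; case: (H (k + j)%N).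
have xge k j : x (k + j)%N + (2^-1) ^+ (k + j)%N <= x k + (2^-1) ^+ k.
  by elim: j => [|j IH]; rewrite ?addn0// addnS (le_trans _ IH)//; case: (H (k + j)%N).
have p0 k : 0 <= (2^-1 : R) ^+ k by rewrite exprn_ge0.
have xub k j : x j <= x k + (2^-1) ^+ k.
  have [kj|jk] := leqP k j.
    by have := xge k (j - k)%N; rewrite subnKC// => /(le_trans _); apply; rewrite lerDl.
  have := xle j (k - j)%N; rewrite subnKC 1?ltnW// => /le_trans; apply.
  by rewrite lerDl.
exists (sup (range x)) => k; apply/andP; split.
  apply: ub_le_sup; last by exists k.
  by exists (x k + (2^-1) ^+ k) => _ [j _ <-].
apply: ge_sup; first by exists (x k); exists k.
by move=> _ [j _ <-].
Qed.

Lemma goursat f a l : (forall w, in_square a l w -> differentiable f w) ->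
  forall e : R, 0 < e ->
  exists N0, forall N, (N0 <= N)%N -> cabs (square f N a l) <= e.
Proof.
move=> df.
(* The bound is quadratic in [cabs m] so that it adds up over the four quarters, and it is asked
   only for large [N], the sums being small only in the limit. Its failure therefore passes to some
   quarter. *)
pose G e b m := exists N0, forall N, (N0 <= N)%N ->
  cabs (square f N b m) <= e * cabs m ^+ 2.
suff H e : 0 < e -> G e a l.
  move=> e e0; have c0 : 0 < cabs l ^+ 2 + 1 by rewrite ltr_wpDl// sqr_ge0.
  have [|N0 HN] := H (e / (cabs l ^+ 2 + 1)); first by rewrite divr_gt0.
  exists N0 => N /HN /le_trans; apply.
  by rewrite mulrAC ler_pdivrMr// ler_pM2l// lerDl.
move=> e0; apply: contrapT => nG.
pose Q := [:: 0; 1; i; 1 + i].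
have step b m : ~ G e b m -> exists2 c, c \in Q & ~ G e (b + c * (m / 2)) (m / 2).
  move=> nGb; apply: contrapT => h; apply: nGb.
  have h' c : c \in Q -> G e (b + c * (m / 2)) (m / 2).
    by move=> cQ; apply: contrapT => ?; apply: h; exists c.
  have [N1 H1] := h' 0 (mem_head _ _).
  have [|N2 H2] := h' 1; first by rewrite !inE eqxx orbT.
  have [|N3 H3] := h' i; first by rewrite !inE eqxx !orbT.
  have [|N4 H4] := h' (1 + i); first by rewrite !inE eqxx !orbT.
  exists (maxn (maxn N1 N2) (maxn N3 N4)).+1 => -[//|N].
  rewrite ltnS !geq_max => /andP[/andP[/H1 g1 /H2 g2] /andP[/H3 g3 /H4 g4]].
  move: g1 g2; rewrite square_split mul0r addr0 mul1r => g1 g2.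
  have E : cabs (m / 2) ^+ 2 = cabs m ^+ 2 / 4.
    by rewrite cabsM cabsV cabs_nat; field.
  rewrite E in g1 g2 g3 g4.
  apply: le_trans (cabsD _ _) _.
  set s3 := _ + square f N (b + i * _) _.
  have : cabs s3 <= _ := cabsD _ _.
  have := cabsD (square f N b (m / 2)) (square f N (b + m / 2) (m / 2)).
  move: g1 g2 g3 g4; lra.
(* Corners are recorded by the coordinate [z] in [a + z * l]: the real and imaginary parts of [zz k]
   then bound nested dyadic intervals, whatever the direction of [l]. *)
pose nx k (z : C) : C :=
  xget 0 [set z' | (exists2 c, c \in Q & z' = z + c * (2^-1) ^+ k.+1) /\
    ~ G e (a + z' * l) (l * (2^-1) ^+ k.+1)].
pose fix zz k : C := if k is k'.+1 then nx k' (zz k') else 0.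
have zzG k : ~ G e (a + zz k * l) (l * (2^-1) ^+ k) /\
    exists2 c, c \in Q & zz k.+1 = zz k + c * (2^-1) ^+ k.+1.
  have nxP j : ~ G e (a + zz j * l) (l * (2^-1) ^+ j) ->
    (exists2 c, c \in Q & zz j.+1 = zz j + c * (2^-1) ^+ j.+1) /\
    ~ G e (a + zz j.+1 * l) (l * (2^-1) ^+ j.+1).
    move=> /step[c cQ nGc] /=; rewrite /nx; case: xgetP => [y _ //|].
    move=> /(_ (zz j + c * (2^-1) ^+ j.+1)) [].
    split; first by exists c.
    suff -> : a + (zz j + c * 2^-1 ^+ j.+1) * l =
      a + zz j * l + c * (l * 2^-1 ^+ j / 2).
      by have -> : l * 2^-1 ^+ j.+1 = l * 2^-1 ^+ j / 2 by rewrite exprS; ring.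
    by rewrite exprS; ring.
  elim: k => [|k [/nxP[_ h2] _]].
    have h0 : ~ G e (a + zz 0%N * l) (l * (2^-1) ^+ 0) by rewrite /= mul0r addr0 mulr1.
    by split=> //; case: (nxP _ h0).
  by split=> //; case: (nxP _ h2).
have pC k : ((2^-1 : C) ^+ k) = (((2^-1 : R) ^+ k)%:C : C).
  by rewrite rmorphXn/= fmorphV/= rmorph_nat.
have QP k : exists b c : bool,
    Re (zz k.+1) = Re (zz k) + b%:R * (2^-1) ^+ k.+1 /\
    Im (zz k.+1) = Im (zz k) + c%:R * (2^-1) ^+ k.+1.
  have [_ [c cQ ->]] := zzG k.
  have P (x y : R) : Re (zz k + (x +i* y : C) * 2^-1 ^+ k.+1) =
      Re (zz k) + x * 2^-1 ^+ k.+1 /\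
      Im (zz k + (x +i* y : C) * 2^-1 ^+ k.+1) =
      Im (zz k) + y * 2^-1 ^+ k.+1.
    rewrite pC; case: (zz k) => r s.
    by split=> //=; rewrite ?mulr0 ?subr0 ?add0r.
  move: cQ; rewrite !inE => /orP[|/orP[|/orP[|]]] /eqP ->.
  - by exists false, false; exact: P.
  - by exists true, false; exact: P.
  - by exists false, true; exact: P.
  - exists true, true; have -> : 1 + i = 1 +i* 1 :> C.
      by apply/eqP; rewrite eq_complex/= addr0 add0r !eqxx.
    exact: P.
have ph k : (2^-1 : R) ^+ k = 2 * (2^-1) ^+ k.+1 by rewrite exprS; field.
have p0 k : 0 < (2^-1 : R) ^+ k by rewrite exprn_gt0// invr_gt0.
have [x xP] : exists c, forall k, Re (zz k) <= c <= Re (zz k) + (2^-1) ^+ k.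
  apply: nested_point => k; have [b [c [-> _]]] := QP k.
  by have := p0 k.+1; have := ph k; case: b => /=; lra.
have [y yP] : exists c, forall k, Im (zz k) <= c <= Im (zz k) + (2^-1) ^+ k.
  apply: nested_point => k; have [b [c [_ ->]]] := QP k.
  by have := p0 k.+1; have := ph k; case: c => /=; lra.
pose w : C := a + (x +i* y) * l.
have dw : differentiable f w.
  apply: df; exists (x +i* y) => /=; split=> //.
    by have := xP 0%N; rewrite /= expr0 add0r.
  by have := yP 0%N; rewrite /= expr0 add0r.
(* Points of the [k]-th square are within [2 * cabs m] of [w], and [square_le] counts four edges: [4
   * (e / 8 * (2 * cabs m) * cabs m) = e * cabs m ^+ 2]. *)
have [|d d0 dH] := diff_eps dw (e := e / 8); first by rewrite divr_gt0.
have [k kd] := half_pow_lt (2 * cabs l) d0.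
have [nGk _] := zzG k; apply: nGk.
set m := l * _; exists 0%N => N _.
have mE : cabs m = cabs l / 2 ^+ k.
  by rewrite /m cabsM cabsX cabsV cabs_nat exprVn.
have near u : in_square (a + zz k * l) m u -> cabs (u - w) <= 2 * cabs m.
  move=> [z [/andP[z1 z2] /andP[z3 z4] ->]].
  pose t : C := z + ((Re (zz k) - x) +i* (Im (zz k) - y)) * 2 ^+ k.
  have -> : a + zz k * l + z * m - w = t * m.
    rewrite /t mulrDl -[_ * _ * m]mulrA.
    have -> : (2 ^+ k * m : C) = l.
      by rewrite /m mulrC -mulrA -exprMn mulVf ?expr1n ?mulr1// pnatr_eq0.
    rewrite [_ +i* _]complexE [zz k in LHS]complexE /w [x +i* y]complexE /=.
    by rewrite !rmorphB /=; ring.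
  rewrite cabsM ler_wpM2r ?cabs_ge0//.
  have E2 : (2 ^+ k : C) = ((2 ^+ k : R)%:C : C) by rewrite rmorphXn/= rmorph_nat.
  have p2 : 0 < (2 : R) ^+ k by rewrite exprn_gt0.
  have pp : (2^-1 : R) ^+ k * 2 ^+ k = 1.
    by rewrite -exprMn mulVf ?expr1n// pnatr_eq0.
  have bnd (r s c : R) : 0 <= r <= 1 -> s <= c <= s + 2^-1 ^+ k ->
      `|r + (s - c) * 2 ^+ k| <= 1.
    move=> r01 /andP[sc cs]; rewrite ler_norml.
    have : (s - c) * 2 ^+ k <= 0 by rewrite pmulr_lle0// subr_le0.
    have : -1 <= (s - c) * 2 ^+ k.
      have : (c - s) * 2 ^+ k <= 2^-1 ^+ k * 2 ^+ k by rewrite ler_pM2r//; lra.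
      by rewrite pp; lra.
    lra.
  have tR : `|Re t| <= 1.
    rewrite /t E2; case: z z1 z2 {z3 z4 t} => z z' /= z1 z2.
    by rewrite mulr0 subr0; apply: bnd => //; apply/andP.
  have tI : `|Im t| <= 1.
    rewrite /t E2; case: z z3 z4 {z1 z2 t tR} => z z' /= z1 z2.
    by rewrite mulr0 add0r; apply: bnd => //; apply/andP.
  rewrite -(@ler_pXn2r _ 2)// ?nnegrE ?cabs_ge0// cabs_sqr.
  rewrite -(real_normK (num_real (Re t))) -(real_normK (num_real (Im t))).
  have := normr_ge0 (Re t); have := normr_ge0 (Im t); nra.
pose D := 'd f w (1 : C).
pose err u := f u - f w - D * (u - w).
have fE : f = (fun u => 1 * err u + ((f w - D * w) + D * u)).
  by apply/funext => u; rewrite /err; ring.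
rewrite fE square_lin square_aff addr0 mul1r.
have -> : e * cabs m ^+ 2 = 4 * (e / 8 * (2 * cabs m) * cabs m) by field.
apply: square_le => u /near um.
have -> : err u = f (w + (u - w)) - f w - 'd f w (u - w).
  have -> : w + (u - w) = u by ring.
  rewrite /err; congr (_ - _).
  have -> : u - w = (u - w) *: (1 : C) by rewrite /GRing.scale/= mulr1.
  by rewrite linearZ/= /D mulrC /GRing.scale/= mulr1.
apply: le_trans (dH _ _) _.
  rewrite nmE; apply: le_lt_trans um _; rewrite mE mulrA //.
by rewrite nmE ler_pM2l// divr_gt0.
Qed.

End Goursat.

(** * Exceptional corners and the value at the centre of a square *)

Section MaximumModulus.
Variable R : realType.
Local Notation C := (R[i]^o).
Implicit Types (f : C -> C) (a l w z : C).
Local Notation i := ('i%C : C).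

(** Of the four quarters, three avoid [a] and fall under [goursat]; the one at [a] is subdivided
    again. After [j] subdivisions it is left with the trivial bound, whose perimeter factor has been
    halved [j] times. *)
Lemma goursat_corner f a l (M : R) :
  (forall w, in_square a l w -> w != a -> differentiable f w) ->
  (forall w, in_square a l w -> cabs (f w) <= M) ->
  forall e : R, 0 < e ->
  exists N0, forall N, (N0 <= N)%N -> cabs (square f N a l) <= e.
Proof.
move=> df fM; have [l0|l0] := eqVneq l 0.
  move=> e e0; exists 0%N => N _; apply: le_trans (ltW e0).
  by apply: le_trans (square_le _ fM) _; rewrite l0 cabs0 !mulr0.
have M0 : 0 <= M.
  apply: le_trans (fM a _); first exact: cabs_ge0.
  by exists 0; rewrite /= lexx ler01 mul0r addr0.
suff H j : forall m : C, m != 0 ->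
    (forall w, in_square a m w -> w != a -> differentiable f w) ->
    (forall w, in_square a m w -> cabs (f w) <= M) ->
    forall e : R, 0 < e -> exists N0, forall N, (N0 <= N)%N ->
    cabs (square f N a m) <= e + 4 * (M * cabs m) / 2 ^+ j.
  move=> e e0; have e20 : 0 < e / 2 by rewrite divr_gt0.
  have [j hj] := half_pow_lt (4 * (M * cabs l)) e20.
  have [N0 HN] := H j l l0 df fM _ e20.
  by exists N0 => N /HN; lra.
elim: j => [|j IH] m m0 dm mM e e0.
  exists 0%N => N _; rewrite expr0 divr1; apply: le_trans (square_le _ mM) _.
  by rewrite lerDr ltW.
have sub (c : C) w : 0 <= Re c <= 1 -> 0 <= Im c <= 1 ->
    in_square (a + c * (m / 2)) (m / 2) w -> in_square a m w.
  move=> cR cI [z [zR zI ->]]; exists (((Re c + Re z) / 2) +i* ((Im c + Im z) / 2)).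
  split; rewrite /=; [lra|lra|].
  rewrite [_ +i* _]complexE [c]complexE [z]complexE/=.
  by rewrite !rmorphM !rmorphD/= !fmorphV/= !rmorph_nat; field.
have e20 : 0 < e / 2 by rewrite divr_gt0.
have e60 : 0 < e / 6 by rewrite divr_gt0.
have [||w wi|N1 H1] := IH (m / 2) _ _ _ _ e20.
- by rewrite mulf_neq0// invr_eq0 pnatr_eq0.
- move=> w wi wa; apply: dm => //; apply: (sub 0); rewrite /= ?lexx ?ler01//.
  by rewrite mul0r addr0.
- apply: mM => //; apply: (sub 0); rewrite /= ?lexx ?ler01//.
  by rewrite mul0r addr0.
have good (c : C) : 0 <= Re c <= 1 -> 0 <= Im c <= 1 ->
    (Re c == 1) || (Im c == 1) -> exists N0, forall N, (N0 <= N)%N ->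
    cabs (square f N (a + c * (m / 2)) (m / 2)) <= e / 6.
  move=> cR cI c1; apply: goursat => // w wi; apply: dm; first exact: sub wi.
  case: wi => z [zR zI ->]; apply/eqP => h.
  have h' : (c + z) * (m / 2) = 0 by rewrite mulrDl -[RHS](subrr a) -{1}h; ring.
  have : c + z == 0.
    move/eqP: h'; rewrite mulf_eq0 => /orP[//|].
    by rewrite mulf_eq0 (negbTE m0) invr_eq0 pnatr_eq0.
  move: c1 cR cI zR zI; case: c {h h'} => x y; case: z => x' y' /=.
  rewrite eq_complex/= => /orP[|] /eqP -> cR cI zR zI /andP[/eqP h1 /eqP h2];
  move: h1 h2; lra.
have [||//|N2 H2] := good 1; rewrite /= ?lexx ?ler01 ?eqxx//.
have [||//|N3 H3] := good i; rewrite /= ?lexx ?ler01 ?eqxx ?orbT//.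
have [||//|N4 H4] := good (1 + i); rewrite /= ?addr0 ?add0r ?lexx ?ler01 ?eqxx//.
exists (maxn (maxn N1 N2) (maxn N3 N4)).+1 => -[//|N].
rewrite ltnS !geq_max => /andP[/andP[/H1 g1 /H2 g2] /andP[/H3 g3 /H4 g4]].
move: g1 g2; rewrite square_split mul1r => g1 g2.
have E : cabs (m / 2) = cabs m / 2 by rewrite cabsM cabsV cabs_nat.
have E2 : 4 * (M * cabs m) / 2 ^+ j.+1 = 4 * (M * (cabs m / 2)) / 2 ^+ j.
  by rewrite exprS invfM; ring.
rewrite E in g1; rewrite E2.
apply: le_trans (cabsD _ _) _.
set s3 := _ + square f N (a + i * _) _.
have : cabs s3 <= _ := cabsD _ _.
have := cabsD (square f N a (m / 2)) (square f N (a + m / 2) (m / 2)).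
by move: g1 g2 g3 g4; lra.
Qed.

(* The four quadrants of the square of half-side [s] centred at [0]; the inner
   edges cancel. *)
Let outer f N (l : C) : C := trap f N l (i * l) - trap f N (i * l) l.

Let perimeter f N (s : C) : C :=
  outer f N s + outer f N (i * s) + outer f N (- s) + outer f N (- (i * s)).

Lemma quadrants f N (s : C) : square f N 0 s + square f N 0 (i * s) +
  square f N 0 (- s) + square f N 0 (- (i * s)) = perimeter f N s.
Proof.
rewrite /perimeter /outer /square !add0r.
have -> : i * (i * s) = - s by rewrite mulrA -expr2 sqr_i mulN1r.
have -> : i * - (i * s) = s by rewrite mulrN mulrA -expr2 sqr_i mulN1r opprK.
by rewrite mulrN; ring.
Qed.

(** The contour sums of [f w / w] and [f 0 / w] differ by that of the bounded quotient [k], which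
    tends to [0]. The first is at most [8 * A], from eight segments of length [s] at distance at
    least [s] from [0]; the second is at least [4 * cabs (f 0)]. The lossy factor 2 is removed later
    by taking powers. *)
Lemma center_le f (s A M : R) : 0 < s ->
  (forall w, `|Re w| <= s -> `|Im w| <= s -> differentiable f w) ->
  (forall w, `|Re w| <= s -> `|Im w| <= s -> cabs (f w) <= M) ->
  (forall w, `|Re w| <= s -> `|Im w| <= s -> s <= cabs w -> cabs (f w) <= A) ->
  cabs (f 0) <= 2 * A.
Proof.
move=> s0 df fM fA.
(* Here [k 0 = 0] by the convention on inverses, not the derivative; [goursat_corner] asks only for
   boundedness at the corner. *)
pose k w := (f w - f 0) / w.
have s00 : (s%:C : C) != 0 by rewrite (fmorph_eq0 (real_complex R)) gt_eqF.
have M0 : 0 <= M by apply: le_trans (cabs_ge0 (f 0)) (fM _ _ _); rewrite /= normr0 ltW.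
have boxP (l : C) w : l \in [:: s%:C; i * s%:C; - s%:C; - (i * s%:C)] ->
    in_square 0 l w -> `|Re w| <= s /\ `|Im w| <= s.
  rewrite !inE => lE [[x y] /= [x01 y01 ->]].
  have xs : 0 <= x * s <= s by case/andP: x01 => h1 h2; apply/andP; split; nra.
  have ys : 0 <= y * s <= s by case/andP: y01 => h1 h2; apply/andP; split; nra.
  by case/or4P: lE => /eqP -> /=; rewrite !ler_norml; split; lra.
have [c kc] : exists c, forall w, `|Re w| <= s -> `|Im w| <= s -> cabs (k w) <= c.
  have d0 : differentiable f 0 by apply: df; rewrite /= normr0 ltW.
  have [d dp dH] := diff_eps d0 (@ltr01 R).
  exists (Num.max (cabs ('d f 0 (1 : C)) + 1) (2 * M / d)) => w wR wI.
  rewrite le_max; have [wd|dw] := ltP (cabs w) d.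
    apply/orP; left; have [->|w0] := eqVneq w 0.
      by rewrite /k invr0 mulr0 cabs0 addr_ge0 ?cabs_ge0.
    rewrite /k cabsM cabsV ler_pdivrMr ?cabs_gt0// mulrDl mul1r.
    have := dH w; rewrite !nmE add0r => /(_ wd).
    have -> : 'd f 0 w = 'd f 0 (1 : C) * w.
      by rewrite -{1}[w]mulr1 -[w * 1]/(w *: (1 : C)) linearZ/= mulrC.
    have := cabs_leD (f w - f 0) ('d f 0 (1 : C) * w).
    by rewrite cabsM; lra.
  apply/orP; right; rewrite /k cabsM cabsV.
  have w0 : 0 < cabs w by apply: lt_le_trans dw.
  apply: ler_pM; rewrite ?invr_ge0 ?cabs_ge0//; last by rewrite lef_pV2.
  have := fM w wR wI; have := cabsB (f w) (f 0).
  have : cabs (f 0) <= M by apply: fM; rewrite /= normr0 ltW.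
  by lra.
have small (l : C) : l \in [:: s%:C; i * s%:C; - s%:C; - (i * s%:C)] ->
    forall e : R, 0 < e -> exists N0, forall N, (N0 <= N)%N ->
    cabs (square k N 0 l) <= e.
  move=> lE; apply: (@goursat_corner _ _ _ c) => w /(boxP _ _ lE)[wR wI].
    move=> w0; apply: differentiableM.
      by apply: differentiableB => //; exact: df.
    by apply: differentiableV.
  exact: kc.
have pf N : cabs (perimeter (fun w => f w / w) N s%:C) <= 8 * A.
  have seg (b v : C) : cabs v = s ->
      (forall t : R, 0 <= t <= 1 -> [/\ `|Re (b + t%:C * v)| <= s,
         `|Im (b + t%:C * v)| <= s & s <= cabs (b + t%:C * v)]) ->
      cabs (trap (fun w => f w / w) N b v) <= A.
    move=> vs bv; have -> : A = A / s * cabs v by rewrite vs mulfVK// gt_eqF.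
    apply: trap_le => t /bv[h1 h2 h3]; rewrite cabsM cabsV.
    by apply: ler_pM; rewrite ?cabs_ge0 ?invr_ge0 ?cabs_ge0 ?fA// lef_pV2 ?posrE// (lt_le_trans s0).
  have seg' (b v : C) : cabs v = s ->
      (forall t : R, 0 <= t <= 1 -> (`|Re (b + t%:C * v)| = s /\ `|Im (b + t%:C * v)| <= s) \/
         (`|Im (b + t%:C * v)| = s /\ `|Re (b + t%:C * v)| <= s)) ->
      cabs (trap (fun w => f w / w) N b v) <= A.
    move=> vs bv; apply: seg => // t /bv[] [h1 h2]; split; rewrite ?h1 ?h2 ?lexx//.
      by rewrite -h1 Re_le_cabs.
    by rewrite -h1 Im_le_cabs.
  have cs : cabs (s%:C : C) = s by rewrite cabs_real gtr0_norm.
  have out (l : C) : l \in [:: s%:C; i * s%:C; - s%:C; - (i * s%:C)] ->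
      cabs (outer (fun w => f w / w) N l) <= 2 * A.
    move=> lE; have cl : cabs l = s.
      by move: lE; rewrite !inE => /or4P[] /eqP ->; rewrite ?cabsN ?cabsM ?cabs_i ?mul1r cs.
    rewrite mulr2n mulrDl mul1r; apply: le_trans (cabsB _ _) _.
    apply: lerD; apply: seg'; rewrite ?cabsM ?cabs_i ?mul1r ?cl// => t /andP[t0 t1].
      have ts : `|t * s| <= s by rewrite ler_norml; apply/andP; split; nra.
      move: lE; rewrite !inE => /or4P[] /eqP ->; simpc;
        rewrite ?normrN ?(gtr0_norm s0); tauto.
    have ts : `|t * s| <= s by rewrite ler_norml; apply/andP; split; nra.
    move: lE; rewrite !inE => /or4P[] /eqP ->; simpc;
      rewrite ?normrN ?(gtr0_norm s0); tauto.
  have h1 : cabs (outer (fun w => f w / w) N s%:C) <= 2 * A.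
    by apply: out; rewrite !inE eqxx ?orbT.
  have h2 : cabs (outer (fun w => f w / w) N (i * s%:C)) <= 2 * A.
    by apply: out; rewrite !inE eqxx ?orbT.
  have h3 : cabs (outer (fun w => f w / w) N (- s%:C)) <= 2 * A.
    by apply: out; rewrite !inE eqxx ?orbT.
  have h4 : cabs (outer (fun w => f w / w) N (- (i * s%:C))) <= 2 * A.
    by apply: out; rewrite !inE eqxx ?orbT.
  move: h1 h2 h3 h4.
  rewrite /perimeter.
  have := cabsD (outer (fun w => f w / w) N s%:C) (outer (fun w => f w / w) N (i * s%:C)).
  have := cabsD (outer (fun w => f w / w) N s%:C + outer (fun w => f w / w) N (i * s%:C)) (outer (fun w => f w / w) N (- s%:C)).
  have := cabsD (outer (fun w => f w / w) N s%:C + outer (fun w => f w / w) N (i * s%:C) + outer (fun w => f w / w) N (- s%:C)) (outer (fun w => f w / w) N (- (i * s%:C))).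
  by lra.
(* On each of the eight half edges the relevant imaginary part is [1 / (1 + t ^+ 2)], at least one
   half. *)
have pi4 N : 4 <= Im (perimeter (fun w => w^-1) N s%:C).
  have out (l : C) : l != 0 -> 1 <= Im (outer (fun w => w^-1) N l).
    move=> l0.
    have h1 : 2^-1 <= Im (trap (fun w => w^-1) N l (i * l)).
      apply: trap_Im => t t01.
      have -> : (l + t%:C * (i * l))^-1 * (i * l) = (1 +i* t : C)^-1 * i.
        have -> : l + t%:C * (i * l) = (1 +i* t) * l.
          by rewrite [1 +i* t]complexE/=; ring.
        by rewrite invfM [i * l]mulrC -mulrA mulKf.
      have -> : Im ((1 +i* t : C)^-1 * i) = (1 + t ^+ 2)^-1.
        by rewrite ImiRe /= expr1n mul1r.
      by rewrite lef_pV2 ?posrE; nra.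
    have h2 : 2^-1 <= Im (- trap (fun w => w^-1) N (i * l) l).
      have -> : - trap (fun w => w^-1) N (i * l) l =
          (-1) * trap (fun w => w^-1) N (i * l) l + trap (fun w => 0) N (i * l) l.
        have -> : trap (fun w => 0) N (i * l) l = 0.
          have := trap_aff 0 0 N (i * l) l; rewrite !mul0r addr0 => {2}<-.
          by congr (trap _ _ _ _); apply/funext => w; rewrite mul0r addr0.
        by rewrite addr0 mulN1r.
      rewrite -trap_lin; apply: trap_Im => t t01.
      have -> : (-1 * (i * l + t%:C * l)^-1 + 0) * l = - (t +i* 1 : C)^-1.
        have -> : i * l + t%:C * l = (t +i* 1) * l.
          by rewrite [t +i* 1]complexE/=; ring.
        by rewrite addr0 mulN1r mulNr invfM mulfVK.
      have -> : Im (- (t +i* 1 : C)^-1) = (1 + t ^+ 2)^-1.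
        by rewrite /= expr1n opprK mul1r addrC.
      by rewrite lef_pV2 ?posrE; nra.
    by move: h1 h2; rewrite /outer raddfD/=; lra.
  have ImD (a b u v : C) : Im (a + b + u + v) = Im a + Im b + Im u + Im v.
    by case: a b u v => [? ?] [? ?] [? ?] [? ?].
  rewrite /perimeter ImD.
  have is0 : i * s%:C != 0 by rewrite mulf_neq0// eq_complex/= oner_eq0 andbF.
  have -> : 4 = 1 + 1 + 1 + 1 :> R by ring.
  by rewrite !lerD// out ?oppr_eq0.
apply/ler_addgt0Pr => e e0.
have [||N1 H1] := small s%:C _ e; rewrite ?inE ?eqxx//.
have [||N2 H2] := small (i * s%:C) _ e; rewrite ?inE ?eqxx ?orbT//.
have [||N3 H3] := small (- s%:C) _ e; rewrite ?inE ?eqxx ?orbT//.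
have [||N4 H4] := small (- (i * s%:C)) _ e; rewrite ?inE ?eqxx ?orbT//.
pose N := maxn (maxn N1 N2) (maxn N3 N4).
have kp : cabs (perimeter k N s%:C) <= 4 * e.
  have := leqnn N; rewrite {1}/N !geq_max => /andP[/andP[/H1 g1 /H2 g2] /andP[/H3 g3 /H4 g4]].
  rewrite -quadrants.
  apply: le_trans (cabsD _ _) _.
  set s3 := _ + square _ _ _ (- s%:C).
  have : cabs s3 <= _ := cabsD _ _.
  have := cabsD (square k N 0 s%:C) (square k N 0 (i * s%:C)).
  by move: g1 g2 g3 g4; lra.
have kE : perimeter k N s%:C = (- f 0) * perimeter (fun w => w^-1) N s%:C +
    perimeter (fun w => f w / w) N s%:C.
  have -> : k = fun w => (- f 0) * w^-1 + f w / w.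
    by apply/funext => w; rewrite /k; ring.
  by rewrite /perimeter /outer !trap_lin; ring.
have P4 : 4 <= cabs (perimeter (fun w => w^-1) N s%:C).
  exact: le_trans (pi4 N) (le_trans (ler_norm _) (Im_le_cabs _)).
have : cabs (f 0 * perimeter (fun w => w^-1) N s%:C) <= 8 * A + 4 * e.
  have -> : f 0 * perimeter (fun w => w^-1) N s%:C =
      perimeter (fun w => f w / w) N s%:C - perimeter k N s%:C.
    by rewrite kE; ring.
  by apply: le_trans (cabsB _ _) _; have := pf N; lra.
rewrite cabsM; have := cabs_ge0 (f 0); nra.
Qed.

End MaximumModulus.

(** * The maximum principle *)

Arguments cabs : simpl never.
Section Compactness.
Variable R : realType.
Local Notation C := (R[i]^o).

Lemma nm_continuous (V : normedModType R[i]) : continuous (@nm R V).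
Proof.
move=> x; apply/cvgrPdist_lt => e e0; apply/nbhs_nm; exists e => // y yx.
apply: le_lt_trans yx; rewrite ler_norml.
by have := nm_leD x y; have := nm_leD y x; rewrite nmBC; lra.
Qed.

Lemma cabs_continuous : continuous (@cabs R).
Proof. exact: (@nm_continuous C). Qed.

Lemma closed_sublevel (T : topologicalType) (u : T -> R) (r : R) :
  continuous u -> closed [set x | u x <= r].
Proof.
move=> cu; have := @preimage_closed T R u [set x | x <= r].
by move=> H; apply: H; [move=> x _; exact: cu|exact: closed_le].
Qed.

Lemma open_sublevel (T : topologicalType) (u : T -> R) (r : R) :
  continuous u -> open [set x | u x < r].
Proof.
move=> cu; have := @open_comp T R u [set x | x < r].
by move=> H; apply: H; [move=> x _; exact: cu|exact: open_lt].
Qed.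

Lemma open_nm_ball (V : normedModType R[i]) (u : V) (r : R) : open [set y : V | nm (y - u) < r].
Proof.
rewrite openE => y /= yr; apply/nbhs_nm; exists (r - nm (y - u)); first by rewrite subr_gt0.
by move=> x xy; apply: le_lt_trans (nm_tri x y u) _; rewrite -ltrBrDr.
Qed.

Lemma compact_sphere (V : normedModType R[i]) (u : V) (r : R) :
  compact [set y : V | nm (y - u) <= r] -> compact [set y : V | nm (y - u) = r].
Proof.
move=> cB; have -> : [set y : V | nm (y - u) = r] =
    [set y | nm (y - u) <= r] `&` ~` [set y | nm (y - u) < r].
  apply/seteqP; split=> y /=; first by move=> ->; rewrite lexx ltxx.
  by move=> [yr /negP]; rewrite -leNgt => ry; apply/eqP; rewrite eq_le yr.
by apply: compact_closedI => //; apply: open_closedC; exact: open_nm_ball.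
Qed.

Lemma compact_disc (r : R) : compact [set z : C | cabs z <= r].
Proof.
pose F (p : R * R) : C := p.1 +i* p.2.
have cF : continuous F.
  move=> p A /nbhs_nm[e e0 pA].
  have e20 : 0 < e / 2 by rewrite divr_gt0.
  have := nbhsx_ballx p (e / 2) e20; apply: filterS => q [q1 q2]; apply: pA; rewrite nmE.
  have -> : F q - F p = (q.1 - p.1)%:C + 'i%C * (q.2 - p.2)%:C.
    by rewrite [LHS]complexE.
  apply: le_lt_trans (cabsD _ _) _.
  rewrite cabsM cabs_i mul1r !cabs_real distrC [`|q.2 - _|]distrC.
  by move: q1 q2; rewrite -!ball_normE/=; lra.
have cb : compact (F @` (`[- r, r] `*` `[- r, r])).
  apply: continuous_compact; first by apply: continuous_subspaceT.
  by apply: compact_setX; apply: segment_compact.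
have cl := @closed_sublevel C (@cabs R) r cabs_continuous.
apply: (subclosed_compact cl cb).
move=> z /= zr; exists (Re z, Im z); last by case: z {zr}.
split; rewrite /= in_itv/= -ler_norml.
  exact: le_trans (Re_le_cabs _) zr.
exact: le_trans (Im_le_cabs _) zr.
Qed.

Lemma disc_max (u : C -> R) (r : R) : 0 <= r ->
  (forall z, cabs z <= r -> {for z, continuous u}) ->
  exists2 p, cabs p <= r & forall z, cabs z <= r -> u z <= u p.
Proof.
move=> r0 cu.
have [|||p /set_mem pr pmax] := @compact_EVT_max _ _ u [set z : C | cabs z <= r].
- by exists 0; rewrite /mkset cabs0.
- exact: compact_disc.
- by apply: continuous_in_subspaceT => z /set_mem; exact: cu.
by exists p => // z zr; apply: pmax; exact/mem_set.
Qed.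

End Compactness.

Section MaximumModulus2.
Variable R : realType.
Local Notation C := (R[i]^o).
Implicit Types (f : C -> C) (z w : C).
Local Notation i := ('i%C : C).

Lemma pow_lt_ex (q e : R) : 0 <= q < 1 -> 0 < e -> exists m, q ^+ m < e.
Proof.
move=> /andP[q0 q1] e0.
have /cvgrPdist_lt /(_ _ e0) [k _ /(_ k (leqnn k))] :
    geometric 1 q @ \oo --> (0 : R) by apply: cvg_geometric; rewrite ger0_norm.
rewrite sub0r normrN /geometric/= mul1r => h; exists k.
by apply: le_lt_trans h; exact: ler_norm.
Qed.

(** Holomorphy is asked only off the zeros, as Rado's class requires. A weight
    [expR (eta * cabs z ^+ 2)] pushes the maximum of the weighted modulus to an interior point [p]
    with [f p != 0]; the strict subharmonicity of the weight then contradicts maximality, by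
    [center_le] applied to a high power. *)
Lemma max_modulus f (r M : R) : 0 < r ->
  (forall z, cabs z <= r -> {for z, continuous f}) ->
  (forall z, cabs z < r -> f z != 0 -> differentiable f z) ->
  (forall z, cabs z = r -> cabs (f z) <= M) ->
  forall z, cabs z <= r -> cabs (f z) <= M.
Proof.
move=> r0 cf df fM z0 z0r; rewrite leNgt; apply/negP => Mz0.
have M0 : 0 <= M.
  apply: le_trans (cabs_ge0 (f r%:C)) (fM _ _).
  by rewrite cabs_real gtr0_norm.
pose M' := (M + cabs (f z0)) / 2.
have MM' : M < M' by rewrite /M'; lra.
have M'z : M' < cabs (f z0) by rewrite /M'; lra.
have M'0 : 0 < M' by apply: le_lt_trans MM'.
(* With this [eta] the weight equals [cabs (f z0) / M'] on the circle of radius [r], so the weighted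
   modulus there stays below [cabs (f z0)]. *)
pose eta := ln (cabs (f z0) / M') / r ^+ 2.
have r20 : 0 < r ^+ 2 by rewrite exprn_gt0.
have eta0 : 0 < eta by rewrite divr_gt0// ln_gt0// ltr_pdivlMr// mul1r.
pose E z := expR (eta * cabs z ^+ 2).
have Er z : cabs z = r -> M * E z < cabs (f z0).
  move=> zr; rewrite /E zr /eta mulfVK ?gt_eqF// lnK; last first.
    by rewrite posrE divr_gt0// (lt_trans M'0).
  rewrite mulrA ltr_pdivrMr// mulrC ltr_pM2l//.
  exact: lt_trans M'z.
pose u z := cabs (f z) * E z.
have cu z : cabs z <= r -> {for z, continuous u}.
  move=> zr; apply: (@continuousM _ _ (fun z => cabs (f z)) E).
    by apply: (@continuous_comp _ _ _ f (@cabs R)); [exact: cf|exact: cabs_continuous].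
  apply: (@continuous_comp _ _ _ (fun z => eta * cabs z ^+ 2) expR); last exact: continuous_expR.
  apply: (@continuousM _ _ (fun z => eta) (fun z => cabs z ^+ 2)); first exact: cst_continuous.
  apply: (@continuous_comp _ _ _ (@cabs R) (fun x => x ^+ 2)); first exact: cabs_continuous.
  exact: exprn_continuous.
have [p pr pmax] := disc_max (ltW r0) cu.
have up : cabs (f z0) <= u p.
  apply: le_trans (pmax _ z0r); rewrite ler_peMr ?cabs_ge0//.
  by rewrite -expR0 ler_expR mulr_ge0 ?sqr_ge0// ltW.
have {pr}pr : cabs p < r.
  rewrite lt_neqAle pr andbT; apply/eqP => pr'.
  move: up; apply/negP; rewrite -ltNge; apply: le_lt_trans (Er _ pr').
  by rewrite ler_wpM2r ?expR_ge0// fM.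
have E0 z : 0 < E z by exact: expR_gt0.
have fp0 : 0 < cabs (f p).
  have : 0 < u p by apply: lt_le_trans up; exact: lt_trans M'z.
  by rewrite pmulr_lgt0.
have [d d0 dH] : exists2 d : R, 0 < d & forall z, cabs (z - p) < d ->
    differentiable f z /\ cabs z <= r.
  have /cont_nm /(_ _ fp0) [d d0 dH] := cf _ (ltW pr).
  exists (Num.min d (r - cabs p)); first by rewrite lt_min d0 subr_gt0.
  move=> z; rewrite lt_min => /andP[/dH fz zp].
  have zr : cabs z < r by apply: le_lt_trans (cabs_leD z p) _; rewrite -ltrBrDl.
  split; last exact: ltW.
  apply: df => //; apply/eqP => fz0; move: fz.
  by rewrite nmE fz0 sub0r cabsN ltxx.
pose s := d / 3; have s0 : 0 < s by rewrite divr_gt0.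
have box w : `|Re w| <= s -> `|Im w| <= s -> cabs w < d.
  move=> wR wI; rewrite [w]complexE; apply: le_lt_trans (cabsD _ _) _.
  by rewrite cabsM cabs_i mul1r !cabs_real; move: wR wI d0; rewrite /s; lra.
(* Over the four rotations of [w] the first-order terms of [cabs (p + c * w) ^+ 2] cancel.
   Maximality at [p] then gives [cabs (h w) <= cabs (f p) ^+ 4 * expR (- (4 * eta * cabs w ^+ 2))],
   with equality at [w = 0]. *)
pose h w := f (p + w) * f (p + i * w) * (f (p - w) * f (p - i * w)).
have dbox w c : cabs w < d -> cabs c = 1 ->
    differentiable f (p + c * w) /\ cabs (p + c * w) <= r.
  move=> wd c1; apply: dH.
  by rewrite [p + _]addrC addrK cabsM c1 mul1r.
have c_1 : cabs (- 1 : C) = 1 by rewrite cabsN cabs1.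
have c_i : cabs (- i : C) = 1 by rewrite cabsN cabs_i.
have hE w : h w = f (p + 1 * w) * f (p + i * w) * (f (p + (- 1) * w) * f (p + (- i) * w)).
  by rewrite /h mul1r mulN1r mulNr.
have dlin (c : C) w : differentiable f (p + c * w) ->
    differentiable (fun w => f (p + c * w)) w.
  move=> dfw; apply: (@differentiable_comp _ C C C (fun w => p + c * w) f); last exact: dfw.
  exact: diff_affine1.
have dh w : cabs w < d -> differentiable h w.
  move=> wd; have -> : h = fun w => f (p + 1 * w) * f (p + i * w) * (f (p + (- 1) * w) * f (p + (- i) * w)).
    by apply/funext => v; exact: hE.
  have [d1 _] := dbox _ _ wd (@cabs1 R); have [d2 _] := dbox _ _ wd (@cabs_i R).
  have [d3 _] := dbox _ _ wd c_1; have [d4 _] := dbox _ _ wd c_i.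
  by apply: differentiableM; apply: differentiableM; exact: dlin.
pose q := expR (- (4 * eta * s ^+ 2)).
have hle w : cabs w < d -> cabs (h w) * expR (4 * eta * cabs w ^+ 2) <= cabs (f p) ^+ 4.
  move=> wd.
  have k c : cabs c = 1 -> cabs (f (p + c * w)) * E (p + c * w) <= cabs (f p) * E p.
    by move=> /(dbox _ _ wd)[_]; exact: pmax.
  have sq : cabs (p + 1 * w) ^+ 2 + cabs (p + i * w) ^+ 2 +
     (cabs (p + (- 1) * w) ^+ 2 + cabs (p + (- i) * w) ^+ 2) =
     4 * cabs p ^+ 2 + 4 * cabs w ^+ 2.
    by rewrite !cabs_sqr; case: (p) (w) => [x y] [x' y'] /=; ring.
  have prod : cabs (h w) * (E (p + 1 * w) * E (p + i * w) *
     (E (p + (- 1) * w) * E (p + (- i) * w))) <= cabs (f p) ^+ 4 * E p ^+ 4.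
    rewrite hE !cabsM.
    have -> : cabs (f p) ^+ 4 * E p ^+ 4 = (cabs (f p) * E p * (cabs (f p) * E p)) *
      (cabs (f p) * E p * (cabs (f p) * E p)) by ring.
    set a1 := cabs (f (p + 1 * w)); set a2 := cabs (f (p + i * w)).
    set a3 := cabs (f (p + -1 * w)); set a4 := cabs (f (p + (- i) * w)).
    rewrite (_ : _ * _ = (a1 * E (p + 1 * w) * (a2 * E (p + i * w))) *
      (a3 * E (p + (-1) * w) * (a4 * E (p + (- i) * w)))); last by ring.
    have k' c : cabs c = 1 -> 0 <= cabs (f (p + c * w)) * E (p + c * w).
      by move=> _; rewrite mulr_ge0 ?cabs_ge0 ?ltW ?E0.
    have g1 := k' _ (@cabs1 R); have g2 := k' _ (@cabs_i R).
    have g3 := k' _ c_1; have g4 := k' _ c_i.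
    have l1 := k _ (@cabs1 R); have l2 := k _ (@cabs_i R).
    have l3 := k _ c_1; have l4 := k _ c_i.
    by apply: (ler_pM (mulr_ge0 g1 g2) (mulr_ge0 g3 g4));
      [exact: (ler_pM g1 g2 l1 l2)|exact: (ler_pM g3 g4 l3 l4)].
  have EE : E (p + 1 * w) * E (p + i * w) * (E (p + (- 1) * w) * E (p + (- i) * w)) =
     expR (4 * eta * cabs w ^+ 2) * E p ^+ 4.
    rewrite /E -expRM_natl -!expRD; congr expR; rewrite -!mulrDr sq; ring.
  by move: prod; rewrite EE mulrA (ler_pM2r (exprn_gt0 4 (E0 p))).
have q01 : 0 <= q < 1.
  have s2 : 0 < s ^+ 2 by rewrite exprn_gt0.
  have e4 : 0 < 4 * eta by rewrite mulr_gt0.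
  by rewrite /q expR_ge0 expR_lt1 oppr_lt0 mulr_gt0.
(* The gain [q ^+ m] on the boundary of the small square has to beat the factor 2 of [center_le]. *)
have [|m qm] := @pow_lt_ex q 2^-1 q01; first by rewrite invr_gt0.
have bound : cabs (f p) ^+ 4 ^+ m <= 2 * ((cabs (f p) ^+ 4 * q) ^+ m).
  have h0 : h 0 = f p ^+ 4 by rewrite /h mulr0 subr0 addr0; ring.
  have hle' w : cabs w < d -> cabs (h w ^+ m) <= (cabs (f p) ^+ 4) ^+ m.
    move=> wd; rewrite cabsX lerXn2r ?nnegrE ?cabs_ge0 ?exprn_ge0 ?cabs_ge0//.
    apply: le_trans (hle w wd); rewrite ler_peMr ?cabs_ge0//.
    have x0 : 0 <= 4 * eta * cabs w ^+ 2 by rewrite mulr_ge0 ?sqr_ge0// mulr_ge0// ltW.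
    by apply: le_trans (expR_ge1Dx _); rewrite lerDl.
  have := @center_le _ (fun w => h w ^+ m) s ((cabs (f p) ^+ 4 * q) ^+ m)
    ((cabs (f p) ^+ 4) ^+ m) s0; rewrite h0 -!exprM cabsX; apply.
  - move=> w wR wI.
    have dw := dh _ (box _ wR wI).
    elim: (m) => [|m' IH]; first exact: differentiable_cst.
    have -> : (fun x => h x ^+ m'.+1) = (fun x => h x * h x ^+ m').
      by apply/funext => x; rewrite exprS.
    exact: differentiableM.
  - by move=> w wR wI; rewrite exprM; apply: hle'; exact: box.
  - move=> w wR wI sw; rewrite cabsX lerXn2r ?nnegrE ?mulr_ge0 ?expR_ge0 ?exprn_ge0 ?cabs_ge0//.
    rewrite /q expRN ler_pdivlMr ?expR_gt0//; apply: le_trans (hle w (box _ wR wI)).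
    rewrite ler_wpM2l ?cabs_ge0// ler_expR (ler_pM2l (mulr_gt0 _ eta0))//.
    by rewrite ler_pXn2r// ?nnegrE ?cabs_ge0// ltW.
have X0 : 0 < cabs (f p) ^+ 4 ^+ m by rewrite !exprn_gt0.
move: bound X0 qm; rewrite [(_ * q) ^+ m]exprMn; move: (cabs (f p) ^+ 4 ^+ m) (q ^+ m) => X Q bound X0 qm.
have : X * Q < X * 2^-1 by rewrite ltr_pM2l.
by lra.
Qed.

End MaximumModulus2.

(** * Cauchy estimates *)

Section Cauchy.
Variable R : realType.
Local Notation C := (R[i]^o).

Lemma diff_cont (V W : normedModType R[i]) (f : V -> W) x :
  differentiable f x -> {for x, continuous f}.
Proof. exact: differentiable_continuous. Qed.

(** Taking [m]-th roots, the constants [c] and [d] disappear as [m] grows. *)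
Lemma root_le (x A c d : R) : 0 <= x -> 0 <= A -> 0 < c ->
  (forall m, c * x ^+ m <= d * A ^+ m) -> x <= A.
Proof.
move=> x0 A0 c0 H; rewrite leNgt; apply/negP => Ax.
have {}x0 : 0 < x by apply: le_lt_trans Ax.
have d0 : 0 < d by apply: lt_le_trans c0 _; have := H 0%N; rewrite !expr0 !mulr1.
have [||m] := @pow_lt_ex _ (A / x) (c / d); rewrite ?divr_gt0//.
  by rewrite divr_ge0// ?ltW//= ltr_pdivrMr// mul1r.
rewrite expr_div_n ltr_pdivrMr ?exprn_gt0// mulrAC ltr_pdivlMr//.
by rewrite mulrC ltNge H.
Qed.

Lemma quot_bounded (f : C -> C) (P : set C) (M : R) : differentiable f 0 ->
  (forall w, P w -> cabs (f w - f 0) <= M) ->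
  exists c, forall w, P w -> cabs ((f w - f 0) / w) <= c.
Proof.
move=> df fM; have [d d0 dH] := diff_eps df (@ltr01 R).
exists (Num.max (cabs ('d f 0 (1 : C)) + 1) (M / d)) => w Pw.
rewrite le_max; have [wd|dw] := ltP (cabs w) d.
  apply/orP; left; have [->|w0] := eqVneq w 0.
    by rewrite invr0 mulr0 cabs0 addr_ge0 ?cabs_ge0.
  rewrite cabsM cabsV ler_pdivrMr ?cabs_gt0// mulrDl mul1r.
  have := dH w; rewrite !nmE add0r => /(_ wd).
  have -> : 'd f 0 w = 'd f 0 (1 : C) * w.
    by rewrite -{1}[w]mulr1 -[w * 1]/(w *: (1 : C)) linearZ/= mulrC.
  have := cabs_leD (f w - f 0) ('d f 0 (1 : C) * w).
  by rewrite cabsM; lra.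
apply/orP; right; rewrite cabsM cabsV.
have w0 : 0 < cabs w by apply: lt_le_trans dw.
by apply: ler_pM; rewrite ?invr_ge0 ?cabs_ge0 ?fM ?lef_pV2 ?posrE.
Qed.

(* [t * k t ^+ m] extends continuously by [0] at the singularity; let [m] go to
   infinity in the maximum principle. *)
Lemma max_modulus_punctured (k : C -> C) (r A B : R) : 0 < r ->
  (forall z, 0 < cabs z <= r -> differentiable k z) ->
  (forall z, 0 < cabs z <= r -> cabs (k z) <= B) ->
  (forall z, cabs z = r -> cabs (k z) <= A) ->
  forall z, 0 < cabs z <= r -> cabs (k z) <= A.
Proof.
move=> r0 dk kB kA z /andP[z0 zr].
have rr : cabs (r%:C : C) = r by rewrite cabs_real gtr0_norm.
have A0 : 0 <= A by apply: le_trans (cabs_ge0 _) (kA _ rr).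
have B0 : 0 <= B.
  by apply: le_trans (cabs_ge0 _) (kB r%:C _); rewrite rr r0 lexx.
apply: (@root_le _ _ (cabs z) r); rewrite ?cabs_ge0// => m.
rewrite -cabsX -cabsM.
have H := @max_modulus _ (fun t => t * k t ^+ m) r (r * A ^+ m) r0.
apply: H => [w wr|w wr w0|w wr|]; last exact: zr.
- have [->|w0] := eqVneq w 0; last first.
    apply: diff_cont; apply: (dif_mul (dif_id w)); apply: dif_exp; apply: dk.
    by rewrite wr cabs_gt0 w0.
  apply/cont_nm => e e0; exists (Num.min r (e / (B ^+ m + 1))).
    by rewrite lt_min r0/= divr_gt0// ltr_wpDl// exprn_ge0.
  move=> y; rewrite subr0 mul0r subr0 !nmE lt_min => /andP[yr].
  rewrite ltr_pdivlMr ?ltr_wpDl// ?exprn_ge0// => ye.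
  have [->|y0] := eqVneq y 0; first by rewrite mul0r cabs0.
  rewrite cabsM cabsX; apply: le_lt_trans ye.
  apply: ler_pM; rewrite ?exprn_ge0 ?cabs_ge0//.
  apply: (@le_trans _ _ (B ^+ m)); last by rewrite lerDl.
  by rewrite lerXn2r ?nnegrE ?cabs_ge0// kB// cabs_gt0 y0 ltW.
- apply: (dif_mul (dif_id w)); apply: dif_exp; apply: dk.
  rewrite ltW// andbT cabs_gt0; apply: contra_neq w0 => ->.
  by rewrite mul0r.
- rewrite cabsM cabsX wr ler_pM2l// lerXn2r ?nnegrE ?cabs_ge0//.
  exact: kA.
Qed.

Lemma lim_le (a b r : R) : 0 < r -> 0 <= a ->
  (forall rho, 0 < rho < r -> a * rho <= b) -> a * r <= b.
Proof.
move=> r0 a0 H; apply/ler_addgt0Pr => e e0.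
pose del := Num.min (r / 2) (e / (a + 1)).
have a1 : 0 < a + 1 by rewrite ltr_wpDl.
have del0 : 0 < del by rewrite lt_min !divr_gt0.
have d1 : del <= r / 2 by rewrite ge_min lexx.
have d2 : a * del <= e.
  have : del <= e / (a + 1) by rewrite ge_min lexx orbT.
  by rewrite ler_pdivlMr//; nra.
by have := H (r - del); rewrite mulrBr; lra.
Qed.

Lemma schwarz (f : C -> C) (r M : R) : 0 < r ->
  (forall z, cabs z < r -> differentiable f z) ->
  (forall z, cabs z < r -> cabs (f z) <= M) -> f 0 = 0 ->
  forall z, cabs z < r -> cabs (f z) * r <= M * cabs z.
Proof.
move=> r0 df fM f0 z zr.
have M0 : 0 <= M by apply: le_trans (cabs_ge0 _) (fM 0 _); rewrite cabs0.
have [->|z0] := eqVneq z 0; first by rewrite f0 cabs0 mul0r mulr0.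
have z00 : 0 < cabs z by rewrite cabs_gt0.
apply: lim_le => //; first exact: cabs_ge0.
move=> rho /andP[rho0 rhor].
have [rz|zrho] := ltP rho (cabs z).
  by apply: ler_pM; rewrite ?cabs_ge0 ?fM// ltW.
have df0 : differentiable f 0 by apply: df; rewrite cabs0.
have [w wr|B HB] := @quot_bounded f [set w | cabs w < r] M df0.
  by rewrite f0 subr0; exact: fM.
have H := @max_modulus_punctured (fun w => (f w - f 0) / w) rho (M / rho) B rho0.
suff : cabs ((f z - f 0) / z) <= M / rho.
  by rewrite f0 subr0 cabsM cabsV ler_pdivrMr// mulrAC ler_pdivlMr.
apply: H => [w /andP[w0 wr]|w /andP[w0 wr]|w wr|]; last by rewrite z00.
- have w0' : w != 0 by rewrite -cabs_gt0.
  apply: dif_mul; last exact: dif_inv (dif_id w) w0'.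
  apply: dif_sub; last exact: dif_cst.
  by apply: df; exact: le_lt_trans rhor.
- by apply: HB; exact: le_lt_trans rhor.
- by rewrite f0 subr0 cabsM cabsV wr ler_pM2r ?invr_gt0// fM// wr.
Qed.

Section Estimates.
Variable V : normedModType R[i].
Implicit Types (f : V -> C) (x y h v : V).

(** Schwarz's lemma on the complex line through [x] and [x + h], for [f - f x], which is bounded by
    [2 * M]. *)
Lemma cauchy1 f x (s M : R) :
  (forall y, nm (y - x) < s -> differentiable f y) ->
  (forall y, nm (y - x) < s -> cabs (f y) <= M) ->
  forall h, nm h < s -> cabs (f (x + h) - f x) <= 2 * M / s * nm h.
Proof.
move=> df fM h hs.
have s0 : 0 < s by apply: le_lt_trans hs; exact: nm_ge0.
have [->|h0] := eqVneq h 0; first by rewrite addr0 subrr cabs0 nm0 mulr0.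
have hp : 0 < nm h by rewrite nm_gt0.
have line t : cabs t < s / nm h -> nm (x + t *: h - x) < s.
  by rewrite addrC addKr nmZ ltr_pdivlMr.
have r0 : 0 < s / nm h by rewrite divr_gt0.
have H := @schwarz (fun t => f (x + t *: h) - f x) (s / nm h) (2 * M) r0.
have : cabs (f (x + (1 : C) *: h) - f x) * (s / nm h) <= 2 * M * cabs (1 : C).
  apply: H => [z /line zs|z /line zs||].
  - by apply: dif_sub; [apply: dif_line; exact: df|exact: dif_cst].
  - have := cabsB (f (x + z *: h)) (f x); have := fM _ zs.
    by have := fM x; rewrite subrr nm0 => /(_ s0); lra.
  - by rewrite scale0r addr0 subrr.
  - by rewrite cabs1 ltr_pdivlMr// mul1r.
rewrite scale1r cabs1 mulr1 mulrA ler_pdivrMr// => h1.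
by rewrite mulrAC ler_pdivlMr.
Qed.

Lemma cauchy_diff f x (s M : R) : 0 < s ->
  (forall y, nm (y - x) < s -> differentiable f y) ->
  (forall y, nm (y - x) < s -> cabs (f y) <= M) ->
  forall h, cabs ('d f x h) <= 2 * M / s * nm h.
Proof.
move=> s0 df fM h.
have [->|h0] := eqVneq h 0; first by rewrite linear0 cabs0 nm0 mulr0.
have hp : 0 < nm h by rewrite nm_gt0.
have dfx : differentiable f x by apply: df; rewrite subrr nm0.
apply/ler_addgt0Pr => e e0.
have [|d d0 dH] := diff_eps dfx (e := e / nm h); first by rewrite divr_gt0.
pose t := Num.min d s / (2 * nm h).
have t0 : 0 < t by rewrite divr_gt0 ?mulr_gt0// lt_min d0.
have ct : cabs (t%:C : C) = t by rewrite cabs_real gtr0_norm.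
have tE : nm ((t%:C : C) *: h) = Num.min d s / 2.
  by rewrite nmZ ct /t; field; rewrite gt_eqF.
have m0 : 0 < Num.min d s by rewrite lt_min d0.
have md : Num.min d s <= d by rewrite ge_min lexx.
have ms : Num.min d s <= s by rewrite ge_min lexx orbT.
have h1 := dH ((t%:C : C) *: h); rewrite tE in h1.
have {}h1 := h1 ltac:(lra).
have h2 := cauchy1 df fM (h := (t%:C : C) *: h).
rewrite tE in h2; have {}h2 := h2 ltac:(lra).
have h3 := cabs_leD ('d f x ((t%:C : C) *: h)) (f (x + (t%:C : C) *: h) - f x).
rewrite [X in _ + X]cabsBC in h3.
have E : cabs ('d f x ((t%:C : C) *: h)) = t * cabs ('d f x h).
  by rewrite linearZ/= -nmE nmZ ct.
rewrite E in h3; rewrite -(ler_pM2l t0).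
have -> : t * (2 * M / s * nm h + e) = 2 * M / s * (Num.min d s / 2) + e / nm h * (Num.min d s / 2).
  by rewrite /t; field; rewrite !gt_eqF.
by move: h1 h2 h3; rewrite !nmE; lra.
Qed.

(* The remainder [e] satisfies [e (2 h) - 2 e h = O(h ^ 2)], a second
   difference of [f]; iterate along [h / 2 ^ k]. *)
Lemma cauchy2 f x (s M : R) :
  (forall y, nm (y - x) < s -> differentiable f y) ->
  (forall y, nm (y - x) < s -> cabs (f y) <= M) ->
  forall h, nm h < s ->
  cabs (f (x + h) - f x - 'd f x h) <= 8 * M / s ^+ 2 * nm h ^+ 2.
Proof.
move=> df fM.
pose e h := f (x + h) - f x - 'd f x h.
have step h : nm h < s / 2 -> cabs (e (h + h) - 2 * e h) <= 16 * M / s ^+ 2 * nm h ^+ 2.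
  move=> hs; have s0 : 0 < s by have := nm_ge0 h; lra.
  pose D y := f (y + h) - f y.
  have in1 y : nm (y - x) < s / 2 -> nm (y + h - x) < s.
    by move=> yx; rewrite addrAC; apply: le_lt_trans (nmD _ _) _; lra.
  have in2 y z : nm (y - x) < s / 2 -> nm (z - y) < s / 2 -> nm (z - x) < s.
    by move=> yx zy; apply: le_lt_trans (nm_tri _ y _) _; lra.
  have -> : e (h + h) - 2 * e h = D (x + h) - D x.
    by rewrite /e /D linearD/= addrA; ring.
  have -> : 16 * M / s ^+ 2 * nm h ^+ 2 = 2 * (2 * M / (s / 2) * nm h) / (s / 2) * nm h.
    by field; rewrite gt_eqF.
  apply: (@cauchy1 D x (s / 2)); last exact: hs.
    move=> y yx; apply: dif_sub; last by apply: df; lra.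
    by apply: dif_shift; apply: df; exact: in1.
  move=> y yx; apply: (@cauchy1 f y (s / 2)); last exact: hs.
    by move=> z zy; apply: df; exact: in2 zy.
  by move=> z zy; apply: fM; exact: in2 zy.
have iter k h : nm h < s -> cabs (e h - 2 ^+ k * e ((2^-1 : C) ^+ k *: h)) <=
    8 * M / s ^+ 2 * nm h ^+ 2 * (1 - (2^-1) ^+ k).
  move=> hs; have s0 : 0 < s by apply: le_lt_trans hs; exact: nm_ge0.
  elim: k => [|k IH]; first by rewrite !expr0 scale1r mul1r !subrr cabs0 mulr0.
  pose h' := (2^-1 : C) ^+ k.+1 *: h.
  have hh : (2^-1 : C) ^+ k *: h = h' + h'.
    rewrite -scalerDl; congr (_ *: _); rewrite exprS -mulrDl.
    have -> : 2^-1 + 2^-1 = 1 :> C by field.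
    by rewrite mul1r.
  have n' : nm h' = (2^-1) ^+ k.+1 * nm h by rewrite nmZ cabsX cabsV cabs_nat.
  have p1 : (2^-1 : R) ^+ k.+1 <= 2^-1.
    by rewrite exprS ger_pMr ?invr_gt0// exprn_ile1// invf_le1// ler1n.
  have hs' : nm h' < s / 2.
    rewrite n'; apply: (@le_lt_trans _ _ (2^-1 * nm h)); last by lra.
    by rewrite ler_wpM2r ?nm_ge0.
  have st := step _ hs'; rewrite -hh in st.
  have -> : e h - 2 ^+ k.+1 * e h' = e h - 2 ^+ k * e (2^-1 ^+ k *: h) +
    2 ^+ k * (e (2^-1 ^+ k *: h) - 2 * e h') by rewrite exprS; ring.
  apply: le_trans (cabsD _ _) _; rewrite cabsM cabsX cabs_nat.
  have p2 : 0 < (2 : R) ^+ k by rewrite exprn_gt0.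
  have st2 : 2 ^+ k * cabs (e (2^-1 ^+ k *: h) - 2 * e h') <=
     2 ^+ k * (16 * M / s ^+ 2 * nm h' ^+ 2) by rewrite ler_pM2l.
  have E : 2 ^+ k * (16 * M / s ^+ 2 * nm h' ^+ 2) =
     8 * M / s ^+ 2 * nm h ^+ 2 * (2^-1) ^+ k.+1.
    have pr : 2 ^+ k * (2^-1) ^+ k = 1 :> R by rewrite -exprMn divff ?expr1n ?pnatr_eq0.
    rewrite n' [_ ^+ k.+1]exprS; move: pr; move: (2 ^+ k) ((2^-1) ^+ k) => p r pr.
    have -> : p * (16 * M / s ^+ 2 * (2^-1 * r * nm h) ^+ 2) =
      (p * r) * (8 * M / s ^+ 2 * nm h ^+ 2 * (2^-1 * r)) by field; rewrite gt_eqF.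
    by rewrite pr mul1r.
  rewrite E in st2; apply: le_trans (lerD IH st2) _.
  by rewrite [(2^-1) ^+ k.+1]exprS; lra.
move=> h hs; have s0 : 0 < s by apply: le_lt_trans hs; exact: nm_ge0.
have M0 : 0 <= M.
  by apply: le_trans (cabs_ge0 _) (fM x _); rewrite subrr nm0.
have dfx : differentiable f x by apply: df; rewrite subrr nm0.
have [->|h0] := eqVneq h 0.
  by rewrite addr0 linear0 subrr subr0 cabs0 nm0 expr0n mulr0.
have hp : 0 < nm h by rewrite nm_gt0.
apply/ler_addgt0Pr => d d0.
have [|del del0 delH] := diff_eps dfx (e := d / nm h); first by rewrite divr_gt0.
have [k kd] := half_pow_lt (nm h) del0.
have p2 : 0 < (2 : R) ^+ k by rewrite exprn_gt0.
have n' : nm ((2^-1 : C) ^+ k *: h) = nm h / 2 ^+ k.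
  by rewrite nmZ cabsX cabsV cabs_nat mulrC exprVn.
have h1 := delH ((2^-1 : C) ^+ k *: h); rewrite n' in h1; have {}h1 := h1 kd.
have h2 : cabs (2 ^+ k * e ((2^-1 : C) ^+ k *: h)) <= d.
  rewrite cabsM cabsX cabs_nat mulrC -ler_pdivlMr//.
  apply: le_trans h1 _; rewrite mulrA mulfVK// gt_eqF//.
have := iter k _ hs; have := cabs_leD (e h) (2 ^+ k * e ((2^-1 : C) ^+ k *: h)).
have : 8 * M / s ^+ 2 * nm h ^+ 2 * (1 - 2^-1 ^+ k) <= 8 * M / s ^+ 2 * nm h ^+ 2.
  have K0 : 0 <= 8 * M / s ^+ 2 * nm h ^+ 2.
    by rewrite mulr_ge0 ?sqr_ge0// divr_ge0 ?sqr_ge0// mulr_ge0.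
  by rewrite mulrBr mulr1 gerBl mulr_ge0// exprn_ge0// invr_ge0.
by rewrite -/(e h); lra.
Qed.

End Estimates.
End Cauchy.

(** * Limits and derivatives of holomorphic functions *)

Section Limits.
Variable R : realType.
Local Notation C := (R[i]^o).

Definition tends (u : nat -> C) (l : C) := forall e : R, 0 < e ->
  exists N, forall n, (N <= n)%N -> cabs (u n - l) <= e.

Lemma tendsD u v (l m : C) : tends u l -> tends v m ->
  tends (fun n => u n + v n) (l + m).
Proof.
move=> ul vm e e0; have e20 : 0 < e / 2 by rewrite divr_gt0.
have [N1 H1] := ul _ e20; have [N2 H2] := vm _ e20.
exists (maxn N1 N2) => n; rewrite geq_max => /andP[/H1 h1 /H2 h2].
have -> : u n + v n - (l + m) = (u n - l) + (v n - m) by ring.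
by apply: le_trans (cabsD _ _) _; lra.
Qed.

Lemma tendsZ u (l c : C) : tends u l -> tends (fun n => c * u n) (c * l).
Proof.
move=> ul e e0; have c1 : 0 < cabs c + 1 by rewrite ltr_wpDl// cabs_ge0.
have [|N H] := ul (e / (cabs c + 1)); first by rewrite divr_gt0.
exists N => n /H h; rewrite -mulrBr cabsM.
rewrite ler_pdivlMr// in h; apply: le_trans h.
by rewrite mulrC ler_wpM2l ?cabs_ge0// lerDl.
Qed.

Lemma tends_cst (c : C) : tends (fun=> c) c.
Proof. by move=> e e0; exists 0%N => n _; rewrite subrr cabs0 ltW. Qed.

Lemma tends_le u (l : C) (B : R) : tends u l ->
  (exists N, forall n, (N <= n)%N -> cabs (u n) <= B) -> cabs l <= B.
Proof.
move=> ul [N uB]; apply/ler_addgt0Pr => e e0; have [N' H] := ul _ e0.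
have h1 := uB _ (leq_maxl N N'); have h2 := H _ (leq_maxr N N').
by have := cabs_leD l (u (maxn N N')); rewrite cabsBC; lra.
Qed.

Lemma tends_unique u (l m : C) : tends u l -> tends u m -> l = m.
Proof.
move=> ul um; apply/eqP; rewrite -subr_eq0 -cabs_eq0 eq_le cabs_ge0 andbT.
have h : tends (fun n => u n + (-1) * u n) (l + (-1) * m) by apply: tendsD => //; exact: tendsZ.
rewrite -mulN1r; apply: tends_le h _; exists 0%N => n _.
by rewrite mulN1r subrr cabs0.
Qed.

Lemma tends_cauchy (u : nat -> C) : (forall e : R, 0 < e -> exists N,
    forall m n, (N <= m)%N -> (N <= n)%N -> cabs (u m - u n) <= e) ->
  exists l, tends u l.
Proof.
move=> uc.
have real (F : C -> R) : (forall a b, `|F a - F b| <= cabs (a - b)) ->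
    exists l : R, forall e : R, 0 < e -> exists N, forall n, (N <= n)%N -> `|F (u n) - l| <= e.
  move=> FC.
  have cF : cvg ((fun n => F (u n)) @ \oo).
    apply: cauchy_cvg; apply: cauchy_exP => e e0.
    have [|N HN] := uc (e / 2); first by rewrite divr_gt0.
    exists (F (u N)); exists N => // n /= Nn; rewrite /ball/=.
    apply: le_lt_trans (FC _ _) _; apply: le_lt_trans (HN _ _ _ Nn) _ => //.
    lra.
  exists (lim ((fun n => F (u n)) @ \oo)) => e e0.
  have /cvgrPdist_le /(_ _ e0) [N _ HN] := cF.
  by exists N => n Nn; rewrite distrC; exact: HN.
have [|x Hx] := real (@Re R).
  by move=> a b; have := Re_le_cabs (a - b); case: a b => [? ?] [? ?].
have [|y Hy] := real (@Im R).
  by move=> a b; have := Im_le_cabs (a - b); case: a b => [? ?] [? ?].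
exists (x +i* y) => e e0; have e20 : 0 < e / 2 by rewrite divr_gt0.
have [N1 H1] := Hx _ e20; have [N2 H2] := Hy _ e20.
exists (maxn N1 N2) => n; rewrite geq_max => /andP[/H1 h1 /H2 h2].
have -> : u n - (x +i* y) = (Re (u n) - x)%:C + 'i%C * (Im (u n) - y)%:C.
  by rewrite [LHS]complexE; case: (u n).
apply: le_trans (cabsD _ _) _; rewrite cabsM cabs_i mul1r !cabs_real.
lra.
Qed.

Section HolomorphicLimits.
Variable V : normedModType R[i].
Implicit Types (f : V -> C) (x y h : V).

(** Pointwise convergence under a common bound is enough: by [cauchy2] the remainders are
    [O(nm h ^+ 2)] uniformly in [n], so the differentials at [x] form a Cauchy sequence and the
    limit inherits the expansion. *)
Lemma tends_differentiable (g : nat -> V -> C) f x (s M : R) : 0 < s ->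
  (forall n y, nm (y - x) < s -> differentiable (g n) y) ->
  (forall n y, nm (y - x) < s -> cabs (g n y) <= M) ->
  (forall y, nm (y - x) < s -> tends (fun n => g n y) (f y)) ->
  differentiable f x.
Proof.
move=> s0 dg gM gf; pose K := 8 * M / s ^+ 2.
have M0 : 0 <= M.
  by apply: le_trans (cabs_ge0 _) (gM 0%N x _); rewrite subrr nm0.
have K0 : 0 <= K by rewrite divr_ge0 ?sqr_ge0// mulr_ge0.
have [D [c2 c1]] : exists D : nat -> {linear V -> C},
    (forall n h, nm h < s -> cabs (g n (x + h) - g n x - D n h) <= K * nm h ^+ 2) /\
    (forall n h, cabs (D n h) <= 2 * M / s * nm h).
  exists (fun n => 'd (g n) x); split=> n h.
    by apply: cauchy2; [exact: dg|exact: gM].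
  by apply: cauchy_diff; [|exact: dg|exact: gM].
have inb h : nm h < s -> nm (x + h - x) < s by rewrite addrC addKr.
have xx : nm (x - x) < s by rewrite subrr nm0.
have Lex h : exists l, tends (fun n => D n h) l.
  apply: tends_cauchy => e e0.
  pose c := K * nm h ^+ 2; have c0 : 0 <= c by rewrite mulr_ge0 ?sqr_ge0.
  (* [D m h - D n h] is read off increments along [t h]. The two remainders contribute at most
     [2 * t * c], which this [t] keeps below [e / 2]; four values of [g], each within [t * e / 8] of
     its limit, contribute the other half. *)
  pose t := Num.min (s / (nm h + 1)) (e / (4 * (c + 1))) / 2.
  have h1 : 0 < nm h + 1 by rewrite ltr_wpDl// nm_ge0.
  have cc : 0 < 4 * (c + 1) by rewrite mulr_gt0// ltr_wpDl.
  have m0 : 0 < Num.min (s / (nm h + 1)) (e / (4 * (c + 1))).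
    by rewrite lt_min !divr_gt0.
  have t0 : 0 < t by rewrite divr_gt0.
  have t1 : t * (nm h + 1) < s.
    rewrite -ltr_pdivlMr//; apply: (@lt_le_trans _ _ (Num.min (s / (nm h + 1)) (e / (4 * (c + 1))))); last by rewrite ge_min lexx.
    by rewrite /t; lra.
  have t2 : t * (4 * (c + 1)) <= e.
    rewrite -ler_pdivlMr//; apply: (@le_trans _ _ (Num.min (s / (nm h + 1)) (e / (4 * (c + 1))))); last by rewrite ge_min lexx orbT.
    by rewrite /t; lra.
  have ct : cabs (t%:C : C) = t by rewrite cabs_real gtr0_norm.
  have nth : nm ((t%:C : C) *: h) = t * nm h by rewrite nmZ ct.
  have ths : nm ((t%:C : C) *: h) < s by rewrite nth; apply: le_lt_trans t1; rewrite ler_pM2l// lerDl.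
  have te : 0 < t * e / 8 by rewrite divr_gt0// mulr_gt0.
  have [N1 H1] := gf _ (inb _ ths) _ te; have [N2 H2] := gf _ xx _ te.
  exists (maxn N1 N2) => m n; rewrite !geq_max.
  move=> /andP[/H1 a1 /H2 a2] /andP[/H1 b1 /H2 b2].
  have linE j : D j ((t%:C : C) *: h) = (t%:C : C) * D j h by rewrite linearZ.
  have := c2 m _ ths; have := c2 n _ ths; rewrite nth (linE m) (linE n).
  set y := x + _ in a1 b1 *.
  move: a1 a2 b1 b2; set dm := D m h; set dn := D n h.
  move=> a1 a2 b1 b2 h2 h3.
  have E : (t%:C : C) * (dm - dn) = ((g m y - f y) - (g m x - f x)) - ((g n y - f y) - (g n x - f x))
     - ((g m y - g m x - t%:C * dm) - (g n y - g n x - t%:C * dn)).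
    by ring.
  have : t * cabs (dm - dn) <= t * e / 2 + 2 * (K * (t * nm h) ^+ 2).
    rewrite -ct -cabsM ct E.
    apply: le_trans (cabsB _ _) _.
    have := cabsB ((g m y - f y) - (g m x - f x)) ((g n y - f y) - (g n x - f x)).
    have := cabsB (g m y - f y) (g m x - f x).
    have := cabsB (g n y - f y) (g n x - f x).
    have := cabsB (g m y - g m x - t%:C * dm) (g n y - g n x - t%:C * dn).
    by move: a1 a2 b1 b2 h2 h3; lra.
  have -> : 2 * (K * (t * nm h) ^+ 2) = t * (2 * (t * c)) by rewrite /c; ring.
  have -> : t * e / 2 = t * (e / 2) by ring.
  by rewrite -mulrDr ler_pM2l//; move: t2; nra.
pose L h := xget 0 [set l | tends (fun n => D n h) l].
have LP h : tends (fun n => D n h) (L h).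
  by rewrite /L; case: xgetP => // /(_ _) nl; have [l] := Lex h => /nl.
have Llin : linear L.
  move=> c u v; apply: (tends_unique (LP _)).
  have -> : (fun n => D n (c *: u + v)) = (fun n => c * D n u + D n v).
    by apply/funext => n; rewrite linearP.
  by apply: tendsD => //; apply: tendsZ.
pose Lin : {linear V -> C} := HB.pack L (GRing.isLinear.Build _ _ _ _ L Llin).
suff [] : differentiable f x /\ 'd f x = Lin :> (V -> C) by [].
apply: (@eps_diff _ _ _ _ _ _ (2 * M / s)).
  move=> h; rewrite nmE; apply: tends_le (LP h) _; exists 0%N => n _.
  exact: c1.
move=> e e0; exists (Num.min s (e / (K + 1))).
  by rewrite lt_min s0 divr_gt0// ltr_wpDl.
move=> h; rewrite lt_min => /andP[hs he].
apply: (@le_trans _ _ (K * nm h ^+ 2)).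
  rewrite nmE.
  have T : tends (fun n => g n (x + h) + (-1) * g n x + (-1) * D n h)
      (f (x + h) + (-1) * f x + (-1) * L h).
    apply: tendsD; last exact: tendsZ.
    by apply: tendsD; [apply: gf; exact: inb|apply: tendsZ; exact: gf].
  rewrite -[- f x]mulN1r -[- Lin h]mulN1r; apply: tends_le T _.
  by exists 0%N => n _; rewrite !mulN1r; exact: c2.
rewrite expr2 mulrA ler_wpM2r ?nm_ge0//.
have : nm h * (K + 1) < e by rewrite -ltr_pdivlMr// ltr_wpDl.
by have := nm_ge0 h; nra.
Qed.

Lemma locally_bounded (W : normedModType R[i]) (f : V -> W) x :
  {for x, continuous f} ->
  exists M, exists2 s : R, 0 < s & forall y, nm (y - x) < s -> nm (f y) <= M.
Proof.
move=> /cont_nm /(_ _ ltr01)[s s0 H]; exists (nm (f x) + 1), s => // y /H h.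
by have := nm_leD (f y) (f x); lra.
Qed.

(** The directional derivative is the pointwise limit of difference quotients, which are holomorphic
    and bounded by [cauchy1]; thus [tends_differentiable] applies, with no integral formula. *)
Lemma differentiable_diff f x e : (\forall y \near x, differentiable f y) ->
  differentiable (fun y => 'd f y e) x.
Proof.
move=> /nbhs_nm[s1 s10 df].
have dfx : differentiable f x by apply: df; rewrite subrr nm0.
have [M [s2 s20 fM]] := locally_bounded (diff_cont dfx).
pose s := Num.min s1 s2 / 2.
have s0 : 0 < s by rewrite divr_gt0// lt_min s10.
have ss1 : 2 * s <= s1 by rewrite /s mulrC mulfVK// ge_min lexx.
have ss2 : 2 * s <= s2 by rewrite /s mulrC mulfVK// ge_min lexx orbT.
pose c := s / (nm e + 1).
have e1 : 0 < nm e + 1 by rewrite ltr_wpDl// nm_ge0.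
have c0 : 0 < c by rewrite divr_gt0.
pose t (n : nat) := c / n.+1%:R.
have t0 n : 0 < t n by rewrite divr_gt0.
have tc n : t n <= c by rewrite ler_pdivrMr// ler_peMr ?(ltW c0)// ler1n.
have ct n : cabs ((t n)%:C : C) = t n by rewrite cabs_real gtr0_norm.
have te n : nm (((t n)%:C : C) *: e) < s.
  rewrite nmZ ct; apply: (@le_lt_trans _ _ (c * nm e)).
    by rewrite ler_wpM2r ?nm_ge0.
  by rewrite /c mulrAC ltr_pdivrMr// ltr_pM2l// ltrDl.
have tn0 n : ((t n)%:C : C) != 0 by rewrite -cabs_gt0 ct.
have in2 y z : nm (y - x) < s -> nm (z - y) < s -> nm (z - x) < 2 * s.
  by move=> yx zy; apply: le_lt_trans (nm_tri _ y _) _; lra.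
pose g n y : C := (f (y + ((t n)%:C : C) *: e) - f y) / (t n)%:C.
have df' y : nm (y - x) < 2 * s -> differentiable f y.
  by move=> ys; apply: df; exact: lt_le_trans ss1.
have fM' y : nm (y - x) < 2 * s -> cabs (f y) <= M.
  by move=> ys; apply: fM; exact: lt_le_trans ss2.
have sh n y : nm (y - x) < s -> nm (y + ((t n)%:C : C) *: e - x) < 2 * s.
  by move=> ys; apply: (in2 y) => //; rewrite addrC addKr.
apply: (@tends_differentiable g _ x s (2 * M / s * nm e) s0) => [n y yx|n y yx|y yx].
- apply: dif_mul; last exact: dif_cst.
  apply: dif_sub; last by apply: df'; lra.
  by apply: dif_shift; apply: df'; exact: sh.
- rewrite /g cabsM cabsV ct ler_pdivrMr//.
  have -> : 2 * M / s * nm e * t n = 2 * M / s * nm (((t n)%:C : C) *: e).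
    by rewrite nmZ ct; ring.
  apply: cauchy1 (te n) => z zy; first by apply: df'; exact: in2 zy.
  by apply: fM'; exact: in2 zy.
- move=> eps eps0.
  have dfy : differentiable f y by apply: df'; lra.
  have [|d d0 dH] := diff_eps dfy (e := eps / (nm e + 1)); first by rewrite divr_gt0.
  have [N hN] : exists N, forall n, (N <= n)%N -> t n * (nm e + 1) < d.
    pose a := c * (nm e + 1) / d.
    have a0 : 0 <= a by exact: ltW (divr_gt0 (mulr_gt0 c0 e1) d0).
    exists (Num.Def.archi_bound a) => n Nn.
    have h : a < n.+1%:R.
      by apply: lt_le_trans (archi_boundP a0) _; rewrite ler_nat leqW.
    by rewrite /t mulrAC ltr_pdivrMr// [d * _]mulrC -ltr_pdivrMr.
  exists N => n /hN tn.
  have ted : nm (((t n)%:C : C) *: e) < d.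
    by rewrite nmZ ct; apply: le_lt_trans tn; rewrite ler_pM2l// lerDl.
  have := dH _ ted; rewrite nmZ ct linearZ/= nmE => h1.
  have -> : g n y - 'd f y e = (f (y + ((t n)%:C : C) *: e) - f y - (t n)%:C * 'd f y e) / (t n)%:C.
    by rewrite /g [in RHS]mulrBl [X in _ = _ - X]mulrAC divff ?mul1r.
  rewrite cabsM cabsV ct ler_pdivrMr//; apply: le_trans h1 _.
  rewrite mulrCA mulrC ler_pM2r// mulrAC ler_pdivrMr// ler_pM2l// lerDl//.
Qed.

End HolomorphicLimits.
End Limits.

(** * The identity theorem *)

Section Identity.
Variable R : realType.
Local Notation C := (R[i]^o).

(* The class of Rado's theorem: continuous, and holomorphic off the zero set.
   It satisfies the maximum principle, hence the identity theorem. *)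
Definition rado (V : normedModType R[i]) (f : V -> C) (x : V) :=
  {for x, continuous f} /\ (f x != 0 -> differentiable f x).

Lemma rado_diff (V : normedModType R[i]) (f : V -> C) x :
  differentiable f x -> rado f x.
Proof. by move=> df; split=> [|_]; [exact: diff_cont|]. Qed.

Lemma rado_line (V : normedModType R[i]) (f : V -> C) (x v : V) (t : C) :
  rado f (x + t *: v) -> rado (fun t : C => f (x + t *: v)) t.
Proof.
move=> [cf df]; split; last by move=> /df; exact: dif_line.
apply: (@continuous_comp C V C (fun t => x + t *: v) f); last exact: cf.
by apply: diff_cont; exact: diff_affine.
Qed.

(** Since [f] vanishes near [0], every [f w / w ^+ j] is again in the class. The maximum principle
    bounds [cabs (f z)] by [B * (cabs z / r) ^+ j] for all [j]. *)
Lemma rado_zero_disc (f : C -> C) (r d : R) : 0 < r -> 0 < d ->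
  (forall z, cabs z <= r -> rado f z) ->
  (forall z, cabs z < d -> f z = 0) -> forall z, cabs z < r -> f z = 0.
Proof.
move=> r0 d0 rf f0 z zr.
have [|p _ pmax] := @disc_max _ (fun z => cabs (f z)) r (ltW r0).
  move=> w wr; apply: (@continuous_comp C C R f (@cabs R)); last exact: cabs_continuous.
  by have [] := rf _ wr.
pose B := cabs (f p); have B0 : 0 <= B by exact: cabs_ge0.
have [->|z0] := eqVneq z 0; first by apply: f0; rewrite cabs0.
have z00 : 0 < cabs z by rewrite cabs_gt0.
have key j : cabs (f z) <= B * (cabs z / r) ^+ j.
  have H := @max_modulus _ (fun w => f w / w ^+ j) r (B / r ^+ j) r0.
  suff : cabs (f z / z ^+ j) <= B / r ^+ j.
    rewrite cabsM cabsV cabsX ler_pdivrMr ?exprn_gt0//.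
    by rewrite expr_div_n mulrAC mulrA.
  apply: H => [w wr|w wr w0|w wr|]; last exact: ltW.
  - have [->|w0] := eqVneq w 0.
      apply/cont_nm => e e0; exists d => // y; rewrite subr0 nmE => yd.
      by rewrite !f0 ?cabs0// !mul0r subrr nm0.
    have [cf _] := rf _ wr.
    apply: (@continuousM _ _ f (fun w => (w ^+ j)^-1)); first exact: cf.
    apply: (diff_cont (f := fun w : C => (w ^+ j)^-1)).
    by apply: dif_inv; [exact: dif_exp (dif_id _)|rewrite expf_neq0].
  - have fw0 : f w != 0 by apply: contra_neq w0 => ->; rewrite mul0r.
    have w00 : w != 0 by apply: contra_neq fw0 => ->; rewrite f0// cabs0.
    apply: dif_mul; first by have [_] := rf _ (ltW wr); apply.
    by apply: dif_inv; [exact: dif_exp (dif_id _)|rewrite expf_neq0].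
  - rewrite cabsM cabsV cabsX wr ler_pM2r ?invr_gt0 ?exprn_gt0//.
    by apply: pmax; rewrite wr.
apply/eqP; rewrite -cabs_eq0 eq_le cabs_ge0 andbT leNgt; apply/negP => fz0.
have B1 : 0 < B + 1 by rewrite ltr_wpDl.
have [||j] := @pow_lt_ex _ (cabs z / r) (cabs (f z) / (B + 1)).
- by rewrite divr_ge0 ?cabs_ge0 ?(ltW r0)//= ltr_pdivrMr// mul1r.
- by rewrite divr_gt0.
have q0 : 0 <= (cabs z / r) ^+ j.
  by rewrite exprn_ge0// divr_ge0 ?cabs_ge0 ?(ltW r0).
rewrite ltr_pdivlMr//; have := key j; move: q0; nra.
Qed.

Section Several.
Variable V : normedModType R[i].
Implicit Types (f : V -> C) (x y p c : V) (U : set V).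

(** Apply the disc lemma on the complex line from [c] to [y]. Both points are within [r] of [p], so
    a disc of radius [2 * r] about [c] reaches beyond [y] and stays within [3 * r] of [p]. *)
Lemma rado_zero_ball f p c (r d : R) : 0 < d ->
  (forall y, nm (y - p) < 3 * r -> rado f y) -> nm (c - p) < r ->
  (forall y, nm (y - c) < d -> f y = 0) ->
  forall y, nm (y - p) < r -> f y = 0.
Proof.
move=> d0 rf cp f0 y yp.
have [->|yc] := eqVneq y c; first by apply: f0; rewrite subrr nm0.
have yc0 : 0 < nm (y - c) by rewrite nm_gt0 subr_eq0.
have yc2 : nm (y - c) < 2 * r.
  by apply: le_lt_trans (nm_tri _ p _) _; rewrite [nm (p - c)]nmBC; lra.
have r0 : 0 < r by apply: le_lt_trans yp; exact: nm_ge0.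
have H := @rado_zero_disc (fun t => f (c + t *: (y - c)))
  (2 * r / nm (y - c)) (d / nm (y - c)).
have -> : y = c + (1 : C) *: (y - c) by rewrite scale1r addrC subrK.
apply: H => [||z zr|z zd|].
- by rewrite divr_gt0// mulr_gt0.
- by rewrite divr_gt0.
- apply: rado_line; apply: rf; rewrite addrAC.
  apply: le_lt_trans (nmD _ _) _; rewrite nmZ.
  by move: zr; rewrite ler_pdivlMr//; lra.
- apply: f0; rewrite addrC addKr nmZ.
  by move: zd; rewrite ltr_pdivlMr.
- by rewrite cabs1 ltr_pdivlMr// mul1r.
Qed.

Lemma rado_identity f U c : open U -> connected U -> U c ->
  (forall y, U y -> rado f y) -> (\forall y \near c, f y = 0) ->
  forall y, U y -> f y = 0.
Proof.
move=> oU cU Uc rf fc.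
pose Z : set V := [set y : V | \forall z \near y, f z = 0].
have oZ : open Z.
  by rewrite openE => y /nbhs_interior.
suff E : U `&` Z = U.
  by move=> y; rewrite -E => -[_ /nbhs_singleton].
apply: cU; first by exists c.
  by exists Z.
exists (closure Z); first exact: closed_closure.
apply/seteqP; split=> p [Up Zp]; split=> //; first exact: subset_closure.
have /nbhs_nm[s s0 sU] : nbhs p U by exact: open_nbhs_nbhs.
have r0 : 0 < s / 3 by rewrite divr_gt0.
have /Zp[q [/nbhs_nm[d d0 qf] qp]] : nbhs p [set y | nm (y - p) < s / 3].
  by apply/nbhs_nm; exists (s / 3).
apply/nbhs_nm; exists (s / 3) => // y yp.
apply: (@rado_zero_ball f p q (s / 3) d) => // z zp; apply: rf; apply: sU.
lra.
Qed.

Lemma diff_identity f g U c : open U -> connected U -> U c ->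
  (forall y, U y -> differentiable f y) ->
  (forall y, U y -> differentiable g y) -> (\forall y \near c, f y = g y) ->
  forall y, U y -> f y = g y.
Proof.
move=> oU cU Uc df dg fgc y Uy; apply/eqP; rewrite -subr_eq0; apply/eqP.
apply: (@rado_identity (fun y => f y - g y) U c oU cU Uc); last exact: Uy.
  by move=> z Uz; apply: rado_diff; apply: dif_sub; [exact: df|exact: dg].
by apply: filterS fgc => z ->; rewrite subrr.
Qed.

End Several.
End Identity.

(** * Hermitian geometry *)

Section Hermitian.
Variable R : realType.
Local Notation C := (R[i]^o).
Variable n : nat.
Local Notation V := (Cvec R n).
Implicit Types (x y z w a : V) (c : C).

Lemma mul_conj c : c * c^*%C = (cabs c ^+ 2)%:C.
Proof.
rewrite cabs_sqr; case: c => x y; apply/eqP; rewrite eq_complex/=.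
by apply/andP; split; apply/eqP; ring.
Qed.

Lemma cabs_coord z i : cabs (z 0 i) <= nm z.
Proof.
rewrite -lecR -!nmE -!normE.
have : `|z 0 i| <= mx_norm z by rewrite mx_normE -[leLHS]nngE num_le; exact: (le_bigmax _ _ (0, i)).
by [].
Qed.

Lemma nm_le z (B : R) : 0 <= B -> (forall i, cabs (z 0 i) <= B) -> nm z <= B.
Proof.
move=> B0 zB; have [z0|] := eqVneq (mx_norm z) 0.
  by rewrite (_ : nm z = 0)// /nm (_ : `|z| = mx_norm z)// z0.
move=> /mx_norm_neq0[[i j] /= zE].
rewrite -lecR -normE (_ : `|z| = mx_norm z)// zE (ord1 i).
by have := zB j; rewrite -lecR; apply.
Qed.

Lemma enorm_ge0 z : 0 <= enorm z.
Proof. exact: sqrtr_ge0. Qed.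

Lemma enorm_sqr z : enorm z ^+ 2 = \sum_(i < n) cabs (z 0 i) ^+ 2.
Proof. by rewrite sqr_sqrtr// sumr_ge0// => i _; rewrite sqr_ge0. Qed.

(** Linear in the first argument, so that [dot z a] is holomorphic in [z]. *)
Definition dot x y : C := \sum_(i < n) x 0 i * (y 0 i)^*%C.

Lemma dotDl x y z : dot (x + y) z = dot x z + dot y z.
Proof.
rewrite /dot -big_split/=; apply: eq_bigr => i _.
by rewrite mxE mulrDl.
Qed.

Lemma dotZl c x z : dot (c *: x) z = c * dot x z.
Proof. by rewrite /dot mulr_sumr; apply: eq_bigr => i _; rewrite mxE mulrA. Qed.

Lemma dotC x y : dot y x = (dot x y)^*%C.
Proof.
rewrite /dot rmorph_sum/=; apply: eq_bigr => i _.
by rewrite rmorphM/= conjcK mulrC.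
Qed.

Lemma dotNl x z : dot (- x) z = - dot x z.
Proof. by rewrite -scaleN1r dotZl mulN1r. Qed.

Lemma dotBl x y z : dot (x - y) z = dot x z - dot y z.
Proof. by rewrite dotDl dotNl. Qed.

Lemma dotDr x y z : dot z (x + y) = dot z x + dot z y.
Proof. by rewrite dotC dotDl rmorphD/= -!dotC. Qed.

Lemma dotZr c x z : dot z (c *: x) = c^*%C * dot z x.
Proof. by rewrite dotC dotZl rmorphM/= -dotC. Qed.

Lemma dotBr x y z : dot z (x - y) = dot z x - dot z y.
Proof. by rewrite dotC dotBl rmorphB/= -!dotC. Qed.

Lemma dot0l z : dot 0 z = 0.
Proof. by rewrite -(scale0r 0) dotZl mul0r. Qed.

Lemma dotxx z : dot z z = (enorm z ^+ 2)%:C.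
Proof.
rewrite enorm_sqr rmorph_sum/=; apply: eq_bigr => i _; exact: mul_conj.
Qed.

Lemma enorm_sqr_dot z : enorm z ^+ 2 = Re (dot z z).
Proof. by rewrite dotxx. Qed.

Lemma enorm0 : enorm (0 : V) = 0.
Proof. by apply/eqP; rewrite -sqrf_eq0 enorm_sqr_dot dot0l. Qed.

Lemma enorm_eq0 z : (enorm z == 0) = (z == 0).
Proof.
apply/eqP/eqP => [z0|->]; last exact: enorm0.
have : \sum_(i < n) cabs (z 0 i) ^+ 2 = 0 by rewrite -enorm_sqr z0 expr0n.
move=> /eqP; rewrite psumr_eq0 => [/allP H|i _]; last exact: sqr_ge0.
apply/rowP => i; rewrite mxE; apply/eqP; rewrite -cabs_eq0 -sqrf_eq0.
exact: H (mem_index_enum _).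
Qed.

Lemma enorm_gt0 z : (0 < enorm z) = (z != 0).
Proof. by rewrite lt_def enorm_eq0 enorm_ge0 andbT. Qed.

Lemma enormZ c z : enorm (c *: z) = cabs c * enorm z.
Proof.
apply/eqP; rewrite -(@eqrXn2 _ 2)// ?enorm_ge0 ?mulr_ge0 ?cabs_ge0 ?enorm_ge0//.
rewrite exprMn !enorm_sqr mulr_sumr; apply/eqP; apply: eq_bigr => i _.
by rewrite mxE cabsM exprMn.
Qed.

Lemma enormN z : enorm (- z) = enorm z.
Proof. by rewrite -scaleN1r enormZ cabsN cabs1 mul1r. Qed.

Lemma enormBC x y : enorm (x - y) = enorm (y - x).
Proof. by rewrite -enormN opprB. Qed.

Lemma enorm_sqrB x y :
  enorm (x - y) ^+ 2 = enorm x ^+ 2 + enorm y ^+ 2 - 2 * Re (dot x y).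
Proof.
rewrite !enorm_sqr_dot dotBl !dotBr [dot y x]dotC.
by case: (dot x x) (dot x y) (dot y y) => [? ?] [? ?] [? ?] /=; ring.
Qed.

Lemma enorm_sqrD x y :
  enorm (x + y) ^+ 2 = enorm x ^+ 2 + enorm y ^+ 2 + 2 * Re (dot x y).
Proof.
rewrite !enorm_sqr_dot dotDl !dotDr [dot y x]dotC.
by case: (dot x x) (dot x y) (dot y y) => [? ?] [? ?] [? ?] /=; ring.
Qed.

Lemma cauchy_schwarz x y : cabs (dot x y) <= enorm x * enorm y.
Proof.
have [->|y0] := eqVneq y 0.
  by rewrite dotC dot0l rmorph0 cabs0 enorm0 mulr0.
have yy : 0 < enorm y by rewrite enorm_gt0.
rewrite -(@ler_pXn2r _ 2)// ?nnegrE ?cabs_ge0 ?mulr_ge0 ?enorm_ge0//.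
have := sqr_ge0 (enorm (((enorm y ^+ 2)%:C : C) *: x - dot x y *: y)).
rewrite enorm_sqrB !enormZ dotZl dotZr.
have -> : (dot x y)^*%C * dot x y = (cabs (dot x y) ^+ 2)%:C :> C.
  by rewrite mulrC mul_conj.
rewrite cabs_real -rmorphM/= ger0_norm ?sqr_ge0// !exprMn => h.
have : 0 <= enorm y ^+ 2 * (enorm x ^+ 2 * enorm y ^+ 2 - cabs (dot x y) ^+ 2) by lra.
by rewrite pmulr_rge0 ?exprn_gt0// subr_ge0.
Qed.

Lemma enormD x y : enorm (x + y) <= enorm x + enorm y.
Proof.
rewrite -(@ler_pXn2r _ 2)// ?nnegrE ?addr_ge0 ?enorm_ge0//.
rewrite enorm_sqrD sqrrD.
have := le_trans (ler_norm _) (le_trans (Re_le_cabs (dot x y)) (cauchy_schwarz x y)).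
by lra.
Qed.

Lemma enorm_leD x y : enorm x <= enorm y + enorm (x - y).
Proof. by apply: le_trans (enormD _ _); rewrite addrC subrK. Qed.

Lemma enorm_tri x y z : enorm (x - z) <= enorm (x - y) + enorm (y - z).
Proof. by apply: le_trans (enormD _ _); rewrite addrA subrK. Qed.

(** The topology is that of the sup norm [nm], while balls are measured by [enorm]; this bound and
    the next show that the neighbourhoods agree. *)
Lemma nm_le_enorm z : nm z <= enorm z.
Proof.
apply: nm_le; first exact: enorm_ge0.
move=> i; rewrite -(@ler_pXn2r _ 2)// ?nnegrE ?cabs_ge0 ?enorm_ge0//.
rewrite enorm_sqr (bigD1 i)//= lerDl sumr_ge0// => j _; exact: sqr_ge0.
Qed.

Lemma enorm_le_nm z : enorm z <= n%:R * nm z.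
Proof.
rewrite -(@ler_pXn2r _ 2)// ?nnegrE ?mulr_ge0 ?enorm_ge0 ?nm_ge0//.
rewrite enorm_sqr; apply: (@le_trans _ _ (\sum_(i < n) nm z ^+ 2)).
  apply: ler_sum => i _; rewrite lerXn2r ?nnegrE ?cabs_ge0 ?nm_ge0//.
  exact: cabs_coord.
rewrite sumr_const card_ord [leRHS]exprMn -[leLHS]mulr_natl ler_wpM2r ?sqr_ge0//.
by rewrite -natrX ler_nat; case: (n) => // m; rewrite leq_pmulr.
Qed.

Lemma nbhs_enorm x (A : set V) :
  nbhs x A <-> exists2 e : R, 0 < e & forall y, enorm (y - x) < e -> A y.
Proof.
rewrite nbhs_nm; split=> -[e e0 xA].
  by exists e => // y yx; apply: xA; apply: le_lt_trans yx; exact: nm_le_enorm.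
have n0 : 0 < (n%:R + 1 : R) by rewrite ltr_wpDl.
exists (e / (n%:R + 1)); first by rewrite divr_gt0.
move=> y; rewrite ltr_pdivlMr// => yx; apply: xA; apply: le_lt_trans yx.
apply: le_trans (enorm_le_nm _) _; rewrite mulrC ler_wpM2l ?nm_ge0//.
by rewrite lerDl.
Qed.

Lemma enorm_continuous : continuous (@enorm R n).
Proof.
move=> x A /nbhs_ballP[e /= e0 eA]; apply/nbhs_enorm; exists e => // y yx.
apply: eA; rewrite -ball_normE/=; apply: le_lt_trans yx; rewrite ler_norml.
by have := enorm_leD x y; have := enorm_leD y x; rewrite enormBC; lra.
Qed.

Lemma open_eball p (r : R) : open (eball p r : set V).
Proof.
rewrite openE => x /= px; apply/nbhs_enorm; exists (r - enorm (x - p)).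
  by rewrite subr_gt0.
move=> y yx; rewrite /eball/=; apply: le_lt_trans (enorm_tri _ x _) _.
by move: yx; lra.
Qed.

Lemma compact_eball p (r : R) : compact [set z : V | enorm (z - p) <= r].
Proof.
have c1 : compact [set v : V | forall i, [set w : C | cabs w <= r + enorm p] (v 0 i)].
  by apply: (@rV_compact C n (fun _ => [set w : C | cabs w <= r + enorm p])) => i; exact: compact_disc.
have cl : closed [set z : V | enorm (z - p) <= r].
  have -> : [set z : V | enorm (z - p) <= r] = [set z | ((@enorm R n) \o (fun z => z - p)) z <= r] by [].
  apply: closed_sublevel => x; apply: continuous_comp; last exact: enorm_continuous.
  apply: diff_cont; apply: differentiableD; [exact: dif_id|exact: dif_cst].
apply: (subclosed_compact cl c1) => z /= zr i.
apply: le_trans (cabs_coord _ _) _; apply: le_trans (nm_le_enorm _) _.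
by apply: le_trans (enorm_leD _ (z - p)) _; rewrite subKr lerD2r.
Qed.

Lemma dif_coord i x : differentiable (fun z : V => z 0 i : C) x.
Proof. exact: differentiable_coord. Qed.

Lemma dif_sum (U : normedModType R[i]) m (f : 'I_m -> U -> C) (x : U) :
  (forall i, differentiable (f i) x) ->
  differentiable (fun u : U => \sum_(i < m) f i u) x.
Proof.
elim: m f => [|m IH] f df.
  have -> : (fun u : U => \sum_(i < 0) f i u) = (fun=> 0).
    by apply/funext => u; rewrite big_ord0.
  exact: dif_cst.
have -> : (fun u : U => \sum_(i < m.+1) f i u) =
    (fun u : U => \sum_(i < m) f (widen_ord (leqnSn m) i) u + f ord_max u).
  by apply/funext => u; rewrite big_ord_recr.
apply: dif_add; last exact: df.
by apply: IH => i; exact: df.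
Qed.

Lemma dif_dot a x : differentiable (fun z => dot z a) x.
Proof.
by apply: dif_sum => i; apply: dif_mul; [exact: dif_coord|exact: dif_cst].
Qed.

Lemma dif_row (U : normedModType R[i]) (f : U -> V) (x : U) :
  (forall i, differentiable (fun u : U => f u 0 i : C) x) -> differentiable f x.
Proof.
move=> df; have -> : f = \sum_(i < n) (fun u : U => (f u 0 i : C) *: (delta_mx 0 i : V)).
  by apply/funext => y; rewrite fct_sumE -row_sum_delta.
by apply: differentiable_sum => i; apply: differentiableZl; exact: df.
Qed.

Lemma dif_col (U : normedModType R[i]) (f : U -> V) (x : U) i :
  differentiable f x -> differentiable (fun u : U => f u 0 i : C) x.
Proof.
move=> df; apply: (@differentiable_comp _ U V C f (fun z => z 0 i)) => //.
exact: dif_coord.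
Qed.

Lemma dif_comp (U W X : normedModType R[i]) (f : U -> W) (g : W -> X) (x : U) :
  differentiable f x -> differentiable g (f x) ->
  differentiable (fun u : U => g (f u)) x.
Proof. by move=> df dg; apply: (@differentiable_comp _ U W X f g). Qed.

End Hermitian.

(** * Automorphisms of the ball *)

Section TanhArtanh.
Variable R : realType.
Implicit Types x y : R.

Lemma tanhE x : tanh x = 1 - 2 / (expR (2 * x) + 1).
Proof.
have e0 := expR_gt0 x.
have -> : expR (2 * x) = expR x ^+ 2 by rewrite -expRM_natl.
rewrite /tanh expRN; field.
have h : 0 < expR x ^+ 2 + 1 by rewrite ltr_wpDl// sqr_ge0.
by rewrite !gt_eqF// -expr2.
Qed.

Lemma tanh_le x y : x <= y -> tanh x <= tanh y.
Proof.
move=> xy; rewrite !tanhE lerD2l lerN2 ler_pM2l// lef_pV2 ?posrE; last 2 first.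
- by rewrite ltr_wpDl// expR_ge0.
- by rewrite ltr_wpDl// expR_ge0.
by rewrite lerD2r ler_expR ler_pM2l.
Qed.

Lemma artanhK x : 0 <= x < 1 -> tanh (artanh x) = x.
Proof.
move=> /andP[x0 x1]; rewrite tanhE /artanh.
have -> : 2 * (ln ((1 + x) / (1 - x)) / 2) = ln ((1 + x) / (1 - x)) by field.
rewrite lnK; last first.
  by rewrite posrE divr_gt0//; lra.
by field; apply/andP; split; rewrite ?gt_eqF//; lra.
Qed.

Lemma artanh_le x y : 0 <= x -> x <= y -> y < 1 -> artanh x <= artanh y.
Proof.
move=> x0 xy y1; rewrite /artanh ler_pM2r ?invr_gt0// ler_ln ?posrE ?divr_gt0//; try lra.
by rewrite ler_pdivrMr ?subr_gt0 ?(le_lt_trans xy)// mulrAC ler_pdivlMr; nra.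
Qed.

Lemma artanh_gt0 x : 0 < x < 1 -> 0 < artanh x.
Proof.
move=> /andP[x0 x1]; rewrite divr_gt0// ln_gt0// ltr_pdivlMr; lra.
Qed.

Lemma sup_max (S : set R) m : S m -> ubound S m -> sup S = m.
Proof.
move=> Sm ubm; apply/le_anti/andP; split.
  by apply: ge_sup => //; exists m.
by apply: ub_le_sup => //; exists m.
Qed.

End TanhArtanh.

(** * Involutions of the ball, Schwarz lemmas and the Caratheodory distance *)

Section Automorphisms.
Variables (R : realType) (n : nat).
Local Notation C := (R[i]^o).
Local Notation V := (Cvec R n).
Local Notation B := (unit_ball R n).
Implicit Types a z w u : V.

Lemma unit_ballE z : B z = (enorm z < 1) :> Prop.
Proof. by rewrite /unit_ball /eball /= subr0. Qed.

Definition moebius_scale a : R := Num.sqrt (1 - enorm a ^+ 2).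

(* The involution of the ball exchanging [0] and [a]; the usual formula
   [(a - P z - s Q z) / (1 - <z, a>)] with [(1 - s) / |a| ^ 2] replaced by
   [1 / (1 + s)], so that [a = 0] is no exception. *)
Definition moebius a z : V :=
  (1 - dot z a)^-1 *: ((1 - ((1 + moebius_scale a)^-1)%:C * dot z a) *: a -
    ((moebius_scale a)%:C : C) *: z).

Section Fixed.
Variable a : V.
Hypothesis a1 : B a.
Let s := moebius_scale a.

Let s2 : s ^+ 2 = 1 - enorm a ^+ 2.
Proof.
rewrite sqr_sqrtr// subr_ge0 expr_le1// ?enorm_ge0//.
by move: a1; rewrite unit_ballE => /ltW.
Qed.

Let s0 : 0 < s.
Proof.
rewrite lt_def sqrtr_ge0 andbT -sqrf_eq0 s2 subr_eq0 eq_sym lt_eqF//.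
by rewrite expr_lt1// ?enorm_ge0//; move: a1; rewrite unit_ballE.
Qed.

Lemma moebius_den z : B z -> 1 - dot z a != 0.
Proof.
rewrite unit_ballE subr_eq0 => z1; apply/eqP => h.
have := cauchy_schwarz z a; rewrite -h cabs1.
have : enorm a < 1 by move: a1; rewrite unit_ballE.
by have := enorm_ge0 z; have := enorm_ge0 a; nra.
Qed.

Let sC0 : (s%:C : C) != 0.
Proof. by rewrite -cabs_gt0 cabs_real normr_gt0 gt_eqF. Qed.

Let s1C : (1 + s%:C : C) != 0.
Proof.
have -> : 1 + s%:C = (1 + s)%:C :> C by rewrite rmorphD.
by rewrite -cabs_gt0 cabs_real normr_gt0 gt_eqF// ltr_wpDl// addr_gt0.
Qed.

Let aa : dot a a = 1 - s%:C ^+ 2.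
Proof. by rewrite dotxx -rmorphXn s2 rmorphB/= opprB addrC subrK. Qed.

Let invC : (((1 + s)^-1)%:C : C) = (1 + s%:C)^-1.
Proof. by rewrite fmorphV rmorphD. Qed.

(** The denominators at a point and at its image multiply to [s ^+ 2], from which the involution
    property follows by algebra. *)
Lemma moebius_dot z : B z -> 1 - dot (moebius a z) a = s%:C ^+ 2 / (1 - dot z a).
Proof.
move=> /moebius_den z0; rewrite /moebius -/s dotZl dotBl !dotZl aa invC.
by field; rewrite z0 s1C.
Qed.

Lemma moebius0 : moebius a 0 = a.
Proof. by rewrite /moebius dot0l mulr0 !subr0 invr1 !scale1r scaler0 subr0. Qed.

Lemma moebiusK z : B z -> moebius a (moebius a z) = z.
Proof.
move=> z1; have z0 := moebius_den z1.
have E := moebius_dot z1.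
have D : dot (moebius a z) a = 1 - s%:C ^+ 2 / (1 - dot z a).
  by rewrite -E; ring.
rewrite {1}/moebius E D -/s invC; apply/rowP => j.
rewrite /moebius -/s invC !mxE; move: (dot z a) (z 0 j) (a 0 j) z0 => l zj aj z0.
by field; rewrite z0 s1C sC0.
Qed.

(** Positivity of the right-hand side is what keeps the image inside the ball. *)
Lemma moebius_norm z : B z ->
  cabs (1 - dot z a) ^+ 2 * (1 - enorm (moebius a z) ^+ 2) =
  (1 - enorm a ^+ 2) * (1 - enorm z ^+ 2).
Proof.
move=> /moebius_den z0.
rewrite /moebius enormZ exprMn mulrBr mulr1 mulrA -exprMn -cabsM divff// cabs1.
rewrite expr1n mul1r enorm_sqrB !enormZ dotZl dotZr [dot a z]dotC -/s.
have -> : enorm a ^+ 2 = 1 - s ^+ 2 by rewrite s2 opprB addrC subrK.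
rewrite !exprMn !cabs_sqr.
have -> : enorm a ^+ 2 = 1 - s ^+ 2 by rewrite s2 opprB addrC subrK.
case: (dot z a) => x y /=; rewrite !(mul0r, mulr0, subr0, addr0, add0r, oppr0).
by field; rewrite gt_eqF// ltr_wpDl// addr_gt0.
Qed.

Lemma moebius_ball z : B z -> B (moebius a z).
Proof.
move=> z1; have d0 : 0 < cabs (1 - dot z a) by rewrite cabs_gt0 moebius_den.
have h := moebius_norm z1; rewrite unit_ballE.
have lt1 (v : V) : B v -> 0 < 1 - enorm v ^+ 2.
  by rewrite unit_ballE => v1; rewrite subr_gt0 expr_lt1 ?enorm_ge0.
have : 0 < cabs (1 - dot z a) ^+ 2 * (1 - enorm (moebius a z) ^+ 2).
  by rewrite h mulr_gt0// lt1.
by rewrite pmulr_rgt0 ?exprn_gt0// subr_gt0 expr_lt1// enorm_ge0.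
Qed.

Lemma moebius_diff z : B z -> differentiable (moebius a) z.
Proof.
move=> /moebius_den z0; apply: dif_row => j.
have -> : (fun u => moebius a u 0 j) = (fun u => (1 - dot u a)^-1 *
    ((1 - ((1 + s)^-1)%:C * dot u a) * a 0 j - s%:C * (u 0 j))).
  by apply/funext => u; rewrite /moebius -/s !mxE.
have dd := dif_dot a z.
apply: dif_mul.
  by apply: dif_inv; [apply: dif_sub; [exact: dif_cst|exact: dd]|exact: z0].
apply: dif_sub; last by apply: dif_mul; [exact: dif_cst|exact: dif_coord].
apply: dif_mul; last exact: dif_cst.
apply: dif_sub; first exact: dif_cst.
by apply: dif_mul; [exact: dif_cst|exact: dd].
Qed.

Lemma moebiusa : moebius a a = 0.
Proof. by rewrite -{2}moebius0 moebiusK// unit_ballE enorm0. Qed.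

End Fixed.

Lemma schwarz_ball (f : V -> C) : (forall u, B u -> differentiable f u) ->
  (forall u, B u -> cabs (f u) <= 1) -> f 0 = 0 ->
  forall u, B u -> cabs (f u) <= enorm u.
Proof.
move=> df f1 f0 u; rewrite unit_ballE => u1.
have [->|u0] := eqVneq u 0; first by rewrite f0 cabs0 enorm0.
have uu : 0 < enorm u by rewrite enorm_gt0.
pose e := (((enorm u)^-1)%:C : C) *: u.
have e1 : enorm e = 1.
  by rewrite enormZ cabs_real ger0_norm ?invr_ge0 ?(ltW uu)// mulVf// gt_eqF.
have line t : cabs t < 1 -> B (0 + t *: e).
  by rewrite unit_ballE add0r enormZ e1 mulr1.
have H := @schwarz _ (fun t => f (0 + t *: e)) 1 1 ltr01.
have {}H : cabs (f (0 + ((enorm u)%:C : C) *: e)) * 1 <= 1 * cabs ((enorm u)%:C : C).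
  apply: H => [z /line zB|z /line zB||].
  - by apply: dif_line; exact: df.
  - exact: f1.
  - by rewrite scale0r addr0.
  - by rewrite cabs_real ger0_norm// enorm_ge0.
move: H; rewrite mulr1 mul1r cabs_real ger0_norm ?enorm_ge0// add0r scalerA -rmorphM/=.
by rewrite mulfV ?gt_eqF// scale1r.
Qed.

(** At [u = 0] this is [0], and [dot u (unit_dir u)] is still the norm of [u]; pairing with a fixed
    direction reduces bounds on vector-valued maps to scalar ones. *)
Definition unit_dir u : V := (((enorm u)^-1)%:C : C) *: u.

Lemma enorm_unit_dir u : enorm (unit_dir u) <= 1.
Proof.
rewrite enormZ cabs_real ger0_norm ?invr_ge0 ?enorm_ge0//.
have [->|u0] := eqVneq (enorm u) 0; first by rewrite mulr0.
by rewrite mulVf.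
Qed.

Lemma dot_unit_dir u : dot u (unit_dir u) = (enorm u)%:C.
Proof.
rewrite dotZr dotxx conjc_real -rmorphM/=; congr (_%:C).
have [->|u0] := eqVneq (enorm u) 0; first by rewrite expr0n mulr0.
by rewrite expr2 mulKf.
Qed.

Lemma cabs_dot_dir u w : cabs (dot u (unit_dir w)) <= enorm u.
Proof.
apply: le_trans (cauchy_schwarz _ _) _.
by rewrite ler_piMr ?enorm_ge0// enorm_unit_dir.
Qed.

Lemma schwarz_ball_map (f : V -> V) : (forall u, B u -> differentiable f u) ->
  (forall u, B u -> enorm (f u) <= 1) -> f 0 = 0 ->
  forall u, B u -> enorm (f u) <= enorm u.
Proof.
move=> df f1 f0 u u1.
have H := @schwarz_ball (fun v => dot (f v) (unit_dir (f u))).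
have : cabs (dot (f u) (unit_dir (f u))) <= enorm u.
  apply: H => [v vB|v vB||]; last exact: u1.
  - apply: (@dif_comp _ V V C f (fun v => dot v (unit_dir (f u)))).
      exact: df.
    exact: dif_dot.
  - by apply: le_trans (cabs_dot_dir _ _) _; exact: f1.
  - by rewrite f0 dot0l.
by rewrite dot_unit_dir cabs_real ger0_norm// enorm_ge0.
Qed.

(** Stated with extension as a hypothesis, to cover both the ball and the ball with a hole. The
    extremal function is the component of [moebius z] along [moebius z w]; the upper bound is
    Schwarz's lemma for the extension composed with [moebius z]. *)
Lemma caratheodoryE (X : set V) z w : X `<=` B -> X z -> X w ->
  (forall f : V -> C, hol X (unit_disk R) f -> exists F : V -> C,
    [/\ forall u, B u -> differentiable F u,
        forall u, B u -> cabs (F u) <= 1 & forall u, X u -> F u = f u]) ->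
  caratheodory X z w = artanh (enorm (moebius z w)).
Proof.
move=> XB Xz Xw ext; apply: sup_max.
  exists (fun u => dot (moebius z u) (unit_dir (moebius z w))) => /=.
    split; last by rewrite /= moebiusa ?dot0l//; exact: XB.
    split=> [u Xu|_ [u Xu <-]].
      apply: (@dif_comp _ V V C (moebius z) (fun v => dot v (unit_dir (moebius z w)))).
        by apply: moebius_diff; exact: XB.
      exact: dif_dot.
    rewrite /unit_disk/=; apply: le_lt_trans (cabs_dot_dir _ _) _.
    by rewrite -unit_ballE; apply: moebius_ball; exact: XB.
  by rewrite dot_unit_dir cabs_real ger0_norm// enorm_ge0.
move=> _ [f [fh fz] <-].
have [F [dF F1 FE]] := ext _ fh.
have Bz := XB _ Xz; have Bw := XB _ Xw.
apply: artanh_le; first exact: cabs_ge0; last by rewrite -unit_ballE; apply: moebius_ball.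
rewrite -FE// -{1}(moebiusK Bz Bw).
have H := @schwarz_ball (fun u => F (moebius z u)).
apply: H => [u Bu|u Bu||]; last exact: moebius_ball.
- by apply: (@dif_comp _ V V C (moebius z) F); [exact: moebius_diff|apply: dF; exact: moebius_ball].
- by apply: F1; exact: moebius_ball.
- by rewrite moebius0// FE.
Qed.

End Automorphisms.

(** * Cauchy's formula on circles *)

Section CircleMean.
Variable R : realType.
Local Notation C := (R[i]^o).
Implicit Types (w u z : C) (phi psi chi : C -> C).

Definition half_root w : C :=
  if 0 <= Re (sqrtc w) then sqrtc w else - sqrtc w.

(** The root [-1] is put in by hand, since [half_root 1] would be [1] for ever. From then on the
    choice of nonnegative real part makes the roots tend to [1]. *)
Fixpoint dyroot N : C :=
  if N is N'.+1 then (if N' is 0%N then -1 else half_root (dyroot N')) else 1.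

Lemma dyroot_sqr N : dyroot N.+1 ^+ 2 = dyroot N.
Proof.
case: N => [|N] /=; first by rewrite sqrrN expr1n.
by rewrite /half_root; case: ifP => _; rewrite ?sqrrN sqr_sqrtc.
Qed.

Lemma cabs_dyroot N : cabs (dyroot N) = 1.
Proof.
elim: N => [|N IH]; first exact: cabs1.
apply/eqP; rewrite -(@eqrXn2 _ 2)// ?cabs_ge0//.
by rewrite -cabsX dyroot_sqr IH expr1n.
Qed.

Lemma Re_dyroot N : 0 <= Re (dyroot N.+2).
Proof.
rewrite [dyroot _]/= -[match N with 0%N => _ | _ => _ end]/(dyroot N.+1) /half_root.
case: ifP => //; case: (sqrtc _) => x y /=.
by rewrite oppr_ge0 => /negbT; rewrite -ltNge => /ltW.
Qed.

Lemma dyroot_neq1 N : dyroot N.+1 != 1.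
Proof.
elim: N => [|N IH]; first by rewrite /= eq_sym -subr_eq0 opprK (_ : 1 + 1 = 2%:R) ?pnatr_eq0.
apply: contra_neq IH => h; by rewrite -dyroot_sqr h expr1n.
Qed.

(** If [w] has nonnegative real part then [cabs (w + 1) ^+ 2 >= 2], so each square root at least
    halves the squared distance to [1]; the value [4] at [N = 1] sets the constant. *)
Lemma dyroot_dist N : cabs (dyroot N - 1) ^+ 2 <= 8 * (2^-1) ^+ N.
Proof.
elim: N => [|[_|N IH]]; first by rewrite /= subrr cabs0 expr0n/= expr0 mulr1.
  rewrite /= expr1 -opprD cabsN (_ : 1 + 1 = 2%:R)// cabs_nat; lra.
have E : dyroot N.+1 - 1 = (dyroot N.+2 - 1) * (dyroot N.+2 + 1).
  by rewrite -dyroot_sqr; ring.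
have h2 : 2 <= cabs (dyroot N.+2 + 1) ^+ 2.
  have := cabs_sqr (dyroot N.+2); rewrite cabs_dyroot expr1n.
  rewrite cabs_sqr; have := Re_dyroot N; case: (dyroot N.+2) => x y /= x0 h.
  by rewrite addr0; nra.
have := IH; rewrite E cabsM exprMn [_ ^+ N.+2]exprS.
have := sqr_ge0 (cabs (dyroot N.+2 - 1)); nra.
Qed.

(* Mean over the [2 ^ N]-th roots of unity; the limit plays the role of the
   integral over the circle. *)
Fixpoint rmean N phi : C :=
  if N is N'.+1 then
    (rmean N' phi + rmean N' (fun w => phi (dyroot N * w))) / 2
  else phi 1.

Lemma rmeanS N phi : rmean N.+1 phi =
  (rmean N phi + rmean N (fun w => phi (dyroot N.+1 * w))) / 2.
Proof. by []. Qed.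

Lemma rmean_lin N phi psi (c : C) :
  rmean N (fun w => c * phi w + psi w) = c * rmean N phi + rmean N psi.
Proof. by elim: N phi psi => [//|N IH] phi psi; rewrite !rmeanS !IH; field. Qed.

Lemma rmean_le N phi (A : R) : (forall w, cabs w = 1 -> cabs (phi w) <= A) ->
  cabs (rmean N phi) <= A.
Proof.
elim: N phi => [|N IH] phi pA; first by apply: pA; exact: cabs1.
rewrite rmeanS cabsM cabsV cabs_nat ler_pdivrMr//.
apply: le_trans (cabsD _ _) _; rewrite mulr_natr mulr2n.
apply: lerD; apply: IH => // w w1; apply: pA.
by rewrite cabsM w1 mulr1 cabs_dyroot.
Qed.

Lemma rmean_rot N phi : rmean N (fun w => phi (dyroot N * w)) = rmean N phi.
Proof.
elim: N phi => [|N IH] phi; first by rewrite /= mul1r.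
rewrite !rmeanS; congr (_ / _); rewrite addrC; congr (_ + _).
have -> : (fun w => phi (dyroot N.+1 * (dyroot N.+1 * w))) = (fun w => phi (dyroot N * w)).
  by apply/funext => w; rewrite mulrA -expr2 dyroot_sqr.
exact: IH.
Qed.

Lemma rmean_cst N (c : C) : rmean N (fun=> c) = c.
Proof. by elim: N => [//|N IH]; rewrite rmeanS IH; field. Qed.

Lemma dif_rmean (V : normedModType R[i]) N (phi : V -> C -> C) (x : V) :
  (forall w, cabs w = 1 -> differentiable (fun y => phi y w) x) ->
  differentiable (fun y => rmean N (phi y)) x.
Proof.
elim: N phi => [|N IH] phi dphi; first by apply: dphi; exact: cabs1.
apply: dif_mul; last exact: dif_cst.
apply: dif_add; apply: IH => // w w1; apply: dphi.
by rewrite cabsM w1 mulr1 (cabs_dyroot N.+1).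
Qed.

Definition circle_hol phi := exists eta A : R, 0 < eta /\
  forall u, 1 - eta < cabs u < 1 + eta -> differentiable phi u /\ cabs (phi u) <= A.

Lemma diff1E phi u (h : C) : 'd phi u h = h * 'd phi u (1 : C).
Proof. by rewrite -[in LHS](mulr1 h) -[h * 1]/(h *: (1 : C)) linearZ. Qed.

Lemma circle_near (eta : R) w u : cabs w = 1 -> cabs (u - w) < eta ->
  1 - eta < cabs u < 1 + eta.
Proof.
move=> w1 uw; have := cabs_leD u w; have := cabs_leD w u.
by rewrite [cabs (w - u)]cabsBC w1; lra.
Qed.

Lemma cauchy2_circle phi : circle_hol phi -> exists K eta : R,
  [/\ 0 < eta, 0 <= K & forall w h, cabs w = 1 -> cabs h < eta ->
  cabs (phi (w + h) - phi w - h * 'd phi w (1 : C)) <= K * cabs h ^+ 2].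
Proof.
move=> [eta [A [eta0 H]]]; exists (8 * A / eta ^+ 2), eta; split=> //.
  rewrite divr_ge0 ?sqr_ge0// mulr_ge0//.
  have [_ ] := H 1 ltac:(by rewrite cabs1; lra).
  by apply: le_trans; exact: cabs_ge0.
move=> w h w1 hh.
rewrite -diff1E.
apply: (@cauchy2 _ C) => // y yw; have [//] := H y (circle_near w1 yw).
Qed.

(* Invariance of the mean under the rotation by [dyroot N] makes the sum of
   [phi (dyroot N * w) - phi w] telescope to [0]. *)
Lemma rmean_diff_le phi (K eta : R) N : 0 <= K ->
  (forall w h, cabs w = 1 -> cabs h < eta ->
    cabs (phi (w + h) - phi w - h * 'd phi w (1 : C)) <= K * cabs h ^+ 2) ->
  cabs (dyroot N.+1 - 1) < eta ->
  cabs (rmean N.+1 (fun w => w * 'd phi w (1 : C))) <= K * cabs (dyroot N.+1 - 1).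
Proof.
move=> K0 H small; set d := dyroot N.+1 - 1 in small *.
have d0 : 0 < cabs d by rewrite cabs_gt0 subr_eq0 dyroot_neq1.
have -> : rmean N.+1 (fun w => w * 'd phi w (1 : C)) =
   - d^-1 * rmean N.+1 (fun w => phi (dyroot N.+1 * w) - phi w - d * w * 'd phi w (1 : C)).
  have -> : (fun w => phi (dyroot N.+1 * w) - phi w - d * w * 'd phi w (1 : C)) =
     (fun w => (- d) * (w * 'd phi w (1 : C)) + ((-1) * phi w + phi (dyroot N.+1 * w))).
    by apply/funext => w; ring.
  rewrite rmean_lin (rmean_lin _ phi) rmean_rot mulN1r addNr addr0.
  by rewrite mulrA mulrNN mulVf ?mul1r// -cabs_gt0.
rewrite cabsM cabsN cabsV mulrC ler_pdivrMr// -mulrA -expr2.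
apply: rmean_le => w w1.
have -> : dyroot N.+1 * w = w + d * w by rewrite /d; ring.
by have := H w (d * w) w1; rewrite cabsM w1 mulr1; exact.
Qed.

Lemma dyroot_small (eta : R) : 0 < eta -> exists N0, forall N, (N0 <= N)%N ->
  cabs (dyroot N - 1) < eta.
Proof.
move=> eta0; have e2 : 0 < eta ^+ 2 by rewrite exprn_gt0.
have [k kd] := half_pow_lt 8 e2; exists k => N kN.
rewrite -(@ltr_pXn2r _ 2)// ?nnegrE ?cabs_ge0 ?ltW//.
apply: le_lt_trans (dyroot_dist N) (le_lt_trans _ kd).
by rewrite -exprVn ler_pM2l// -(subnKC kN) exprD ler_piMr ?exprn_ge0 ?exprn_ile1 ?invr_ge0// invf_le1// ler1n.
Qed.

(** The points added at the next level are the old ones rotated by a root close to [1]. To first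
    order the change is a multiple of the mean of [w * phi' w], small by [rmean_diff_le]; together
    with the remainder it is of order [2^-N], which is summable. *)
Lemma rmean_tends phi : circle_hol phi -> exists l, tends (fun N => rmean N phi) l.
Proof.
move=> /cauchy2_circle[K [eta [eta0 K0 H]]].
have [N0 HN0] := dyroot_small eta0.
have q0 k : 0 < (2^-1 : R) ^+ k by rewrite exprn_gt0// invr_gt0.
have step N : (N0 < N)%N ->
    cabs (rmean N.+1 phi - rmean N phi) <= 16 * K * (2^-1) ^+ N.
  case: N => // N N0N; have s1 := HN0 _ (ltnW N0N).
  have s2 := HN0 _ (ltnW (leqW N0N)).
  set d := dyroot N.+2 - 1.
  have -> : rmean N.+2 phi - rmean N.+1 phi = 2^-1 *
      (d * rmean N.+1 (fun w => w * 'd phi w (1 : C)) +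
       rmean N.+1 (fun w => phi (dyroot N.+2 * w) - phi w - d * w * 'd phi w (1 : C))).
    rewrite -rmean_lin.
    have -> : (fun w => d * (w * 'd phi w (1 : C)) + (phi (dyroot N.+2 * w) - phi w - d * w * 'd phi w (1 : C))) =
      (fun w => (-1) * phi w + phi (dyroot N.+2 * w)) by apply/funext => w; ring.
    by rewrite (rmean_lin _ phi) [rmean N.+2 _]rmeanS; field.
  have b1 := rmean_diff_le K0 H s1.
  have b2 : cabs (rmean N.+1 (fun w => phi (dyroot N.+2 * w) - phi w - d * w * 'd phi w (1 : C))) <= K * cabs d ^+ 2.
    apply: rmean_le => w w1.
    have -> : dyroot N.+2 * w = w + d * w by rewrite /d; ring.
    by have := H w (d * w) w1; rewrite cabsM w1 mulr1; exact.
  rewrite cabsM cabsV cabs_nat mulrC ler_pdivrMr//.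
  apply: le_trans (cabsD _ _) _; rewrite cabsM.
  have := dyroot_dist N.+2; have := dyroot_dist N.+1; rewrite -/d [_ ^+ N.+2]exprS.
  move=> h3 h4; move: h3 h4 b1 b2 (cabs_ge0 d) (cabs_ge0 (dyroot N.+1 - 1)) (q0 N.+1).
  set a := cabs (rmean N.+1 (fun w => w * _)); set b := cabs (rmean N.+1 _).
  move: a b (cabs d) (cabs (dyroot N.+1 - 1)) ((2^-1) ^+ N.+1) => a b x y q h3 h4 h1 h2 x0 y0 qq.
  have h5 : x * a <= x * (K * y) by rewrite ler_wpM2l.
  have h6 : x * y <= 8 * q by have := sqr_ge0 (x - y); lra.
  have h7 : K * (x * y) <= K * (8 * q) by rewrite ler_wpM2l.
  have h8 : K * x ^+ 2 <= K * (8 * q) by rewrite ler_wpM2l//; lra.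
  have h9 : 0 <= K * q by rewrite mulr_ge0// ltW.
  by lra.
have tail N j : (N0 < N)%N ->
    cabs (rmean (N + j) phi - rmean N phi) <= 32 * K * (2^-1) ^+ N * (1 - (2^-1) ^+ j).
  move=> N0N; elim: j => [|j IH]; first by rewrite addn0 !subrr cabs0 mulr0.
  have := step (N + j)%N (leq_trans N0N (leq_addr _ _)); rewrite -addnS.
  have := cabs_leD (rmean (N + j.+1) phi - rmean N phi) (rmean (N + j) phi - rmean N phi).
  have -> : rmean (N + j.+1) phi - rmean N phi - (rmean (N + j) phi - rmean N phi) =
    rmean (N + j.+1) phi - rmean (N + j) phi by ring.
  by rewrite exprD [_ ^+ j.+1]exprS; move: IH; lra.
apply: tends_cauchy => e e0.
have [k hk] := half_pow_lt (64 * K) e0; rewrite -exprVn in hk.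
have main N j : (maxn N0.+1 k <= N)%N -> cabs (rmean (N + j) phi - rmean N phi) <= e / 2.
  rewrite geq_max => /andP[N0N kN]; apply: le_trans (tail _ _ N0N) _.
  have h1 : (2^-1 : R) ^+ N <= (2^-1) ^+ k.
    by rewrite -(subnKC kN) exprD ler_piMr ?exprn_ge0 ?exprn_ile1 ?invr_ge0// invf_le1// ler1n.
  have h2 : 32 * K * (2^-1) ^+ N <= e / 2.
    have : 32 * K * (2^-1) ^+ N <= 32 * K * (2^-1) ^+ k by rewrite ler_wpM2l// mulr_ge0.
    by lra.
  apply: le_trans h2; rewrite mulrBr mulr1 gerBl mulr_ge0 ?(ltW (q0 j))//.
  by rewrite mulr_ge0 ?(ltW (q0 N))// mulr_ge0.
exists (maxn N0.+1 k) => m n Nm Nn.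
have := main _ (m - maxn N0.+1 k)%N (leqnn _); have := main _ (n - maxn N0.+1 k)%N (leqnn _).
rewrite !subnKC// => h1 h2.
have := cabsB (rmean m phi - rmean (maxn N0.+1 k) phi) (rmean n phi - rmean (maxn N0.+1 k) phi).
have -> : rmean m phi - rmean (maxn N0.+1 k) phi - (rmean n phi - rmean (maxn N0.+1 k) phi) =
  rmean m phi - rmean n phi by ring.
by lra.
Qed.

Definition cmean phi : C := xget 0 [set l | tends (fun N => rmean N phi) l].

Lemma cmeanP phi : circle_hol phi -> tends (fun N => rmean N phi) (cmean phi).
Proof.
move=> /rmean_tends[l hl]; rewrite /cmean; case: xgetP => // /(_ l) nl.
by case: nl.
Qed.

Lemma cmean_cst (c : C) : cmean (fun=> c) = c.
Proof.
have h : tends (fun N => rmean N (fun=> c)) c.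
  have -> : (fun N => rmean N (fun=> c)) = (fun=> c).
    by apply/funext => N; rewrite rmean_cst.
  exact: tends_cst.
rewrite /cmean; case: xgetP => [l _ hl|/(_ c)]; last by [].
exact: tends_unique hl h.
Qed.

(** Up to a constant, [w * chi' w] is the derivative of [chi] along the circle and has mean zero, so
    a multiple of it may be subtracted freely. This replaces differentiation under the mean. *)
Lemma cmean_dist phi psi chi (c : C) (D : R) : circle_hol phi -> circle_hol psi ->
  circle_hol chi ->
  (forall w, cabs w = 1 ->
    cabs (psi w - phi w - c * (w * 'd chi w (1 : C))) <= D) ->
  cabs (cmean psi - cmean phi) <= D.
Proof.
move=> /cmeanP hphi /cmeanP hpsi /cauchy2_circle[K [eta [eta0 K0 H]]] hD.
apply/ler_addgt0Pr => e e0.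
have T : tends (fun N => (-1) * rmean N phi + rmean N psi) ((-1) * cmean phi + cmean psi).
  by apply: tendsD => //; exact: tendsZ.
rewrite addrC -mulN1r; apply: tends_le T _.
have c1 : 0 < K * cabs c + 1 by rewrite ltr_wpDl// mulr_ge0// cabs_ge0.
have e'0 : 0 < Num.min eta (e / (K * cabs c + 1)) by rewrite lt_min eta0 divr_gt0.
have [N0 HN0] := dyroot_small e'0.
exists N0.+1 => -[//|N] /ltnW /HN0; rewrite lt_min => /andP[s1 s2].
rewrite -rmean_lin.
have -> : (fun w => (-1) * phi w + psi w) =
  (fun w => c * (w * 'd chi w (1 : C)) + (psi w - phi w - c * (w * 'd chi w (1 : C)))).
  by apply/funext => w; ring.
rewrite rmean_lin; apply: le_trans (cabsD _ _) _; rewrite addrC; apply: lerD.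
  exact: rmean_le.
rewrite cabsM; have := rmean_diff_le K0 H s1.
rewrite ltr_pdivlMr// in s2 => h.
have : cabs c * cabs (rmean N.+1 (fun w => w * 'd chi w (1 : C))) <= cabs c * (K * cabs (dyroot N.+1 - 1)).
  by rewrite ler_wpM2l// cabs_ge0.
have := cabs_ge0 (dyroot N.+1 - 1); lra.
Qed.

(** With [p] equal pieces the total increment is at most [c * (b - a) ^+ 2 / p]. *)
Lemma cst_of_quadratic (m : R -> C) (a b c : R) : a <= b -> 0 <= c ->
  (forall s t, a <= s -> s <= t -> t <= b -> cabs (m s - m t) <= c * (t - s) ^+ 2) ->
  m a = m b.
Proof.
move=> ab c0 H; apply/eqP; rewrite -subr_eq0 -cabs_eq0 eq_le cabs_ge0 andbT.
apply/ler_addgt0Pr => e e0; rewrite add0r.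
have L0 : 0 <= b - a by rewrite subr_ge0.
have [k kd] := half_pow_lt (c * (b - a) ^+ 2) e0.
have [n n0] : exists n : nat, (2 ^+ k : R) = n.+1%:R.
  by exists (2 ^ k).-1; rewrite prednK ?expn_gt0// natrX.
rewrite n0 in kd; pose d := (b - a) / n.+1%:R.
have d0 : 0 <= d by rewrite divr_ge0.
have nd : n.+1%:R * d = b - a by rewrite /d mulrCA mulfV ?mulr1// pnatr_eq0.
have it j : (j <= n.+1)%N -> cabs (m a - m (a + j%:R * d)) <= j%:R * (c * d ^+ 2).
  elim: j => [|j IH] jn; first by rewrite !mul0r addr0 subrr cabs0.
  have := IH (ltnW jn); have jb : j.+1%:R * d <= b - a by rewrite -nd ler_wpM2r// ler_nat.
  have jd0 : 0 <= j%:R * d by rewrite mulr_ge0.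
  have := H (a + j%:R * d) (a + j.+1%:R * d).
  rewrite -natr1 mulrDl mul1r in jb *.
  have -> : a + (j%:R * d + d) - (a + j%:R * d) = d by ring.
  move=> /(_ ltac:(lra) ltac:(lra) ltac:(lra)) h1 h2.
  have := cabsD (m a - m (a + j%:R * d)) (m (a + j%:R * d) - m (a + (j%:R * d + d))).
  by rewrite addrA subrK; lra.
have := it _ (leqnn _); rewrite nd [a + _]addrC subrK => /le_trans; apply.
apply: le_trans (ltW kd); rewrite /d expr_div_n.
have -> : n.+1%:R * (c * ((b - a) ^+ 2 / n.+1%:R ^+ 2)) = c * (b - a) ^+ 2 / n.+1%:R.
  have p0 : n.+1%:R != 0 :> R by rewrite pnatr_eq0.
  by move: (n.+1%:R) p0 => p p0; field.
by [].
Qed.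

(** When [cabs h >= eta] the three terms are bounded one by one, their sum being absorbed by powers
    of [cabs h / eta]. So [phi] has to be bounded at [u + h], but not along the way from [u]. *)
Lemma cauchy2_far phi (u h : C) (A eta : R) : 0 < eta ->
  (forall v, cabs (v - u) < eta -> differentiable phi v /\ cabs (phi v) <= A) ->
  cabs (phi (u + h)) <= A ->
  cabs (phi (u + h) - phi u - h * 'd phi u (1 : C)) <= 8 * A / eta ^+ 2 * cabs h ^+ 2.
Proof.
move=> eta0 H hA.
rewrite -diff1E.
have dH v : nm (v - u) < eta -> differentiable phi v by move=> /H[].
have bH v : nm (v - u) < eta -> cabs (phi v) <= A by move=> /H[].
have [hs|hl] := ltP (nm h) eta; first exact: cauchy2.
have h1 := @cauchy_diff _ C phi u eta A eta0 dH bH h.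
have h2 : cabs (phi u) <= A by apply: bH; rewrite subrr nm0.
have A0 : 0 <= A by apply: le_trans h2; exact: cabs_ge0.
have h3 := cabsB (phi (u + h)) (phi u).
have h4 := cabsB (phi (u + h) - phi u) ('d phi u h).
have r1 : 1 <= cabs h / eta by rewrite ler_pdivlMr// mul1r.
have -> : 8 * A / eta ^+ 2 * cabs h ^+ 2 = 8 * A * (cabs h / eta) ^+ 2 by field; rewrite gt_eqF.
have E : 2 * A / eta * nm h = 2 * A * (cabs h / eta) by rewrite nmE; ring.
rewrite E in h1.
move: (cabs h / eta) r1 h1 => q r1 h1.
have : A * q <= A * q ^+ 2 by rewrite ler_wpM2l//; nra.
have : A <= A * q ^+ 2 by rewrite ler_peMr//; nra.
by lra.
Qed.

Lemma diff1_unique (F : C -> C) (x a : C) : differentiable F x ->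
  (forall e : R, 0 < e -> exists2 d : R, 0 < d & forall h, cabs h < d ->
    cabs (F (x + h) - F x - h * a) <= e * cabs h) -> 'd F x (1 : C) = a.
Proof.
move=> dF Fa.
have {dF} : forall e : R, 0 < e -> exists2 d : R, 0 < d & forall h, cabs h < d ->
    cabs (F (x + h) - F x - h * 'd F x (1 : C)) <= e * cabs h.
  move=> e e0; have [d d0 H] := diff_eps dF e0; exists d => // h hd.
  by have := H h hd; rewrite !nmE (diff1E F x h).
move: ('d F x (1 : C)) => b Fb.
apply/eqP; rewrite -subr_eq0 -cabs_eq0 eq_le cabs_ge0 andbT.
apply/ler_addgt0Pr => e e0; rewrite add0r.
have e20 : 0 < e / 2 by rewrite divr_gt0.
have [d1 d10 H1] := Fa _ e20; have [d2 d20 H2] := Fb _ e20.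
pose t := Num.min d1 d2 / 2.
have m0 : 0 < Num.min d1 d2 by rewrite lt_min d10.
have t0 : 0 < t by rewrite divr_gt0.
have td : t < Num.min d1 d2 by rewrite /t; lra.
have ct : cabs (t%:C : C) = t by rewrite cabs_real gtr0_norm.
move: td; rewrite lt_min -{1 2}ct => /andP[/H1 h1 /H2 h2].
rewrite -(ler_pM2l t0) -[in leLHS]ct -cabsM.
have -> : t%:C * (b - a) = (F (x + t%:C) - F x - t%:C * a) -
  (F (x + t%:C) - F x - t%:C * b) by ring.
by apply: le_trans (cabsB _ _) _; rewrite ct in h1 h2; lra.
Qed.

Lemma diff1_affine (g : C -> C) (p c w : C) : differentiable g (p + c * w) ->
  differentiable (fun w => g (p + c * w)) w /\
  'd (fun w => g (p + c * w)) w (1 : C) = c * 'd g (p + c * w) (1 : C).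
Proof.
move=> dg.
have dF : differentiable (fun w => g (p + c * w)) w.
  by apply: (@dif_comp _ C C C (fun w => p + c * w) g) dg; exact: diff_affine1.
split=> //; apply: diff1_unique dF _ => e e0.
have c1 : 0 < cabs c + 1 by rewrite ltr_wpDl// cabs_ge0.
have e'0 : 0 < e / (cabs c + 1) by rewrite divr_gt0.
have [d d0 H] := diff_eps dg e'0.
exists (d / (cabs c + 1)); first by rewrite divr_gt0.
move=> h; rewrite ltr_pdivlMr// => hd.
have ch : cabs c * cabs h <= cabs h * (cabs c + 1).
  by rewrite mulrC ler_wpM2l ?cabs_ge0// lerDl.
have := H (c * h); rewrite !nmE cabsM (diff1E g _ (c * h)) => /(_ (le_lt_trans ch hd)) h1.
have -> : p + c * (w + h) = p + c * w + c * h by ring.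
have -> : h * (c * 'd g (p + c * w) (1 : C)) = c * h * 'd g (p + c * w) (1 : C) by ring.
apply: le_trans h1 _.
rewrite mulrA ler_wpM2r ?cabs_ge0// mulrAC ler_pdivrMr// ler_wpM2l ?(ltW e0)//.
by rewrite lerDl.
Qed.

(** The radial increment of [g] at [s * w] is [(t - s) * w * g' (s * w)] to first order, and this is
    [(t - s) / s] times the tangential term [w * chi' w] for [chi w = g (s * w)]. By [cmean_dist]
    only a quadratic error remains. *)
Lemma cmean_radius (g : C -> C) (r1 r2 eta A : R) : 0 < r1 -> r1 <= r2 -> 0 < eta ->
  (forall u, r1 - eta < cabs u < r2 + eta -> differentiable g u /\ cabs (g u) <= A) ->
  cmean (fun w => g (r1%:C * w)) = cmean (fun w => g (r2%:C * w)).
Proof.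
move=> r10 r12 eta0 H.
have A0 : 0 <= A.
  have [|_] := H r1%:C; first by rewrite cabs_real gtr0_norm//; lra.
  by apply: le_trans; exact: cabs_ge0.
have nr (r : R) w : 0 < r -> cabs (r%:C * w) = r * cabs w.
  by move=> r0; rewrite cabsM cabs_real gtr0_norm.
have dg (r : R) w : differentiable g (r%:C * w : C) ->
    differentiable (fun w => g (r%:C * w)) w /\
    'd (fun w => g (r%:C * w)) w (1 : C) = r%:C * 'd g (r%:C * w : C) (1 : C).
  have := @diff1_affine g 0 r%:C w; rewrite add0r.
  by have -> : (fun w => g (0 + r%:C * w)) = (fun w => g (r%:C * w))
    by apply/funext => v; rewrite add0r.
have ch r : r1 <= r <= r2 -> circle_hol (fun w => g (r%:C * w)).
  move=> /andP[rl rr]; have r0 : 0 < r by lra.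
  exists (eta / r), A; split; first by rewrite divr_gt0.
  move=> u /andP[u1 u2]; have [|d b] := H (r%:C * u).
    rewrite nr//; apply/andP; split.
      have : r * (1 - eta / r) < r * cabs u by rewrite ltr_pM2l.
      by rewrite mulrBr mulr1 mulrCA mulfV ?gt_eqF// mulr1; lra.
    have : r * cabs u < r * (1 + eta / r) by rewrite ltr_pM2l.
    by rewrite mulrDr mulr1 mulrCA mulfV ?gt_eqF// mulr1; lra.
  by split; [have [] := dg _ _ d|exact: b].
apply: (@cst_of_quadratic (fun r => cmean (fun w => g (r%:C * w))) r1 r2
   (8 * A / eta ^+ 2)) => // [|s t sl st tr].
  by rewrite divr_ge0 ?sqr_ge0// mulr_ge0.
have s0 : 0 < s by lra.
have chs : circle_hol (fun w => g (s%:C * w)) by apply: ch; lra.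
have cht : circle_hol (fun w => g (t%:C * w)) by apply: ch; lra.
rewrite cabsBC; apply: (cmean_dist (chi := fun w => g (s%:C * w)) (c := ((t - s) / s)%:C)) => // w w1.
have [|dgw bgw] := H (s%:C * w); first by rewrite nr// w1; lra.
have [_ ->] := dg _ _ dgw.
set D := 'd g _ _; have -> : ((t - s) / s)%:C * (w * (s%:C * D)) = ((t - s)%:C * w) * D.
  rewrite rmorphM fmorphV; field.
  by rewrite (fmorph_eq0 (real_complex R)) gt_eqF.
have E : t%:C * w = s%:C * w + (t - s)%:C * w by rewrite rmorphB/=; ring.
have E2 : (t - s) ^+ 2 = cabs ((t - s)%:C * w) ^+ 2.
  by rewrite cabsM w1 mulr1 cabs_real real_normK// num_real.
rewrite E E2; apply: (cauchy2_far eta0).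
  move=> v vs; apply: H; have := cabs_leD v (s%:C * w); have := cabs_leD (s%:C * w) v.
  by rewrite nr// w1 [cabs (s%:C * w - v)]cabsBC; lra.
by rewrite -E; have [|//] := H (t%:C * w); rewrite nr ?w1; lra.
Qed.

End CircleMean.

(** * Cauchy's formula for the limit means *)

Section CauchyFormula.
Variable R : realType.
Local Notation C := (R[i]^o).
Implicit Types (w u z : C) (phi psi : C -> C).

Lemma circle_holM phi psi : circle_hol phi -> circle_hol psi ->
  circle_hol (fun w => phi w * psi w).
Proof.
move=> [e1 [A1 [e10 H1]]] [e2 [A2 [e20 H2]]].
exists (Num.min e1 e2), (A1 * A2); split; first by rewrite lt_min e10.
have m1 : Num.min e1 e2 <= e1 by rewrite ge_min lexx.
have m2 : Num.min e1 e2 <= e2 by rewrite ge_min lexx orbT.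
move=> u /andP[u1 u2]; have [|d1 b1] := H1 u; first by lra.
have [|d2 b2] := H2 u; first by lra.
by split; [exact: dif_mul|rewrite cabsM ler_pM ?cabs_ge0].
Qed.

Lemma cmean_le phi (c : C) (D : R) : circle_hol phi ->
  (forall w, cabs w = 1 -> cabs (phi w - c) <= D) -> cabs (cmean phi - c) <= D.
Proof.
move=> cphi H; have D0 : 0 <= D.
  by apply: le_trans (cabs_ge0 _) (H 1 _); exact: cabs1.
have cc : circle_hol (fun=> c).
  by exists 1, (cabs c); split=> // u _; split=> //; exact: dif_cst.
rewrite -[X in _ - X]cmean_cst; apply: (cmean_dist (chi := fun=> c) (c := 0)) => // w w1.
by rewrite mul0r subr0 H.
Qed.

Lemma cmeanZ phi (c : C) : circle_hol phi ->
  cmean (fun w => c * phi w) = c * cmean phi.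
Proof.
move=> ch; have h1 := cmeanP ch.
have cc : circle_hol (fun=> c).
  by exists 1, (cabs c); split=> // u _; split=> //; exact: dif_cst.
have h2 := cmeanP (circle_holM cc ch).
apply: tends_unique h2 _.
have -> : (fun N => rmean N (fun w => c * phi w)) = (fun N => c * rmean N phi).
  apply/funext => N; have := rmean_lin N phi (fun=> 0) c; rewrite rmean_cst addr0 => <-.
  by congr rmean; apply/funext => w; rewrite addr0.
exact: tendsZ.
Qed.

Lemma kernel_bound (d : R) u z : 0 < d -> d <= cabs u - cabs z ->
  u - z != 0 /\ cabs (u / (u - z)) <= 1 + cabs z / d.
Proof.
move=> d0 h; have h1 : d <= cabs (u - z).
  by have := cabs_leD u z; lra.
have h2 : 0 < cabs (u - z) by apply: lt_le_trans h1.
have n0 : u - z != 0 by rewrite -cabs_gt0.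
split=> //; have -> : u / (u - z) = 1 + z / (u - z) by field.
apply: le_trans (cabsD _ _) _; rewrite cabs1 lerD2l cabsM cabsV.
by rewrite ler_wpM2l ?cabs_ge0// lef_pV2.
Qed.

Lemma dif_kernel u z : u - z != 0 -> differentiable (fun u => u / (u - z)) u.
Proof.
move=> n0; apply: dif_mul; first exact: dif_id.
by apply: dif_inv; [apply: dif_sub; [exact: dif_id|exact: dif_cst]|].
Qed.

Lemma cabs_scale (r : R) w : 0 < r -> cabs (r%:C * w) = r * cabs w.
Proof. by move=> r0; rewrite cabsM cabs_real gtr0_norm. Qed.

Lemma dif_scale_comp phi (c w : C) : differentiable phi (c * w : C) ->
  differentiable (fun w => phi (c * w)) w.
Proof.
move=> d; apply: (@dif_comp _ C C C (fun w => c * w) phi); last exact: d.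
by apply: dif_mul; [exact: dif_cst|exact: dif_id].
Qed.

Lemma circle_hol_kernel (r : R) z : cabs z < r ->
  circle_hol (fun w => r%:C * w / (r%:C * w - z)).
Proof.
move=> zr; have r0 : 0 < r by apply: le_lt_trans zr; exact: cabs_ge0.
pose d := (r - cabs z) / 2; have d0 : 0 < d by rewrite divr_gt0// subr_gt0.
exists (d / r), (1 + cabs z / d); split; first by rewrite divr_gt0.
move=> u /andP[u1 _].
have h : d <= cabs (r%:C * u) - cabs z.
  rewrite cabs_scale//; have : r * (1 - d / r) < r * cabs u by rewrite ltr_pM2l.
  by rewrite mulrBr mulr1 mulrCA mulfV ?gt_eqF// mulr1 /d; lra.
have [n0 b] := kernel_bound d0 h; split; last exact: b.
by apply: (@dif_scale_comp (fun u => u / (u - z))); exact: dif_kernel.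
Qed.

(** The mean does not depend on the radius, and on the circle of radius [r2] the denominator is so
    large that the kernel is within [e] of [1]. *)
Lemma cmean_kernel (r : R) z : cabs z < r ->
  cmean (fun w => r%:C * w / (r%:C * w - z)) = 1.
Proof.
move=> zr; have r0 : 0 < r by apply: le_lt_trans zr; exact: cabs_ge0.
apply/eqP; rewrite -subr_eq0 -cabs_eq0 eq_le cabs_ge0 andbT.
apply/ler_addgt0Pr => e e0; rewrite add0r.
pose d := (r - cabs z) / 2; have d0 : 0 < d by rewrite divr_gt0// subr_gt0.
pose r2 := r + cabs z / e + cabs z.
have ze : 0 <= cabs z / e by rewrite divr_ge0 ?cabs_ge0// ltW.
have zz := cabs_ge0 z.
have rr2 : r <= r2 by rewrite /r2; lra.
have H := @cmean_radius _ (fun u => u / (u - z)) r r2 d (1 + cabs z / d) r0 rr2 d0.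
rewrite H => [|u /andP[u1 _]]; last first.
  have [|n0 b] := @kernel_bound d u z d0; first by move: u1; rewrite /d; lra.
  by split; [exact: dif_kernel|exact: b].
apply: cmean_le => [|w w1].
  by apply: circle_hol_kernel; rewrite /r2; lra.
have r20 : 0 < r2 by lra.
have h1 : cabs z / e <= cabs (r2%:C * w - z).
  have := cabs_leD (r2%:C * w) z; rewrite cabs_scale// w1 mulr1 {1}/r2.
  lra.
have h2 : 0 < cabs (r2%:C * w - z).
  have := cabs_leD (r2%:C * w) z; rewrite cabs_scale// w1 mulr1 {1}/r2.
  lra.
have n0 : r2%:C * w - z != 0 by rewrite -cabs_gt0.
have -> : r2%:C * w / (r2%:C * w - z) - 1 = z / (r2%:C * w - z) by field.
by rewrite cabsM cabsV ler_pdivrMr// mulrC -ler_pdivrMr.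
Qed.

(* Shrink the circle [r w] to the point [z] along [z + t (r w - z)]. *)
Lemma cmean_cauchy (f : C -> C) (r eta A : R) z : cabs z < r -> 0 < eta ->
  (forall u, cabs u < r + eta -> differentiable f u /\ cabs (f u) <= A) ->
  cmean (fun w => f (r%:C * w) * (r%:C * w / (r%:C * w - z))) = f z.
Proof.
move=> zr eta0 H; have zz := cabs_ge0 z.
have r0 : 0 < r by lra.
have A0 : 0 <= A by have [|_] := H z; [lra|apply: le_trans; exact: cabs_ge0].
pose p (t : R) : C := z - t%:C * z.
pose c (t : R) : C := t%:C * r%:C.
have ub t w : 0 <= t <= 1 -> cabs (p t + c t * w) <= (1 - t) * cabs z + t * (r * cabs w).
  move=> /andP[t0 t1]; apply: le_trans (cabsD _ _) _; apply: lerD.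
    have -> : p t = (1 - t)%:C * z by rewrite /p rmorphB/=; ring.
    by rewrite cabsM cabs_real ger0_norm// subr_ge0.
  by rewrite /c !cabsM !cabs_real !ger0_norm ?(ltW r0)// mulrA.
have ub1 t w : 0 <= t <= 1 -> cabs w = 1 -> cabs (p t + c t * w) <= r.
  by move=> t01 w1; apply: le_trans (ub _ _ t01) _; rewrite w1 mulr1; case/andP: t01; nra.
have chi_hol t : 0 <= t <= 1 -> circle_hol (fun w => f (p t + c t * w)).
  move=> t01; exists (eta / r), A; split; first by rewrite divr_gt0.
  move=> u /andP[_ u2]; have [|d b] := H (p t + c t * u).
    apply: le_lt_trans (ub _ _ t01) _.
    have : r * cabs u < r * (1 + eta / r) by rewrite ltr_pM2l.
    rewrite mulrDr mulr1 mulrCA mulfV ?gt_eqF// mulr1.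
    move: (r * cabs u) => X Xlt; case/andP: t01 => t0 t1.
    have q1 : 0 <= t * (r + eta - X) by rewrite mulr_ge0// subr_ge0 ltW.
    have q2 : 0 <= (1 - t) * (r - cabs z) by rewrite mulr_ge0 ?subr_ge0// ltW.
    have [t1'|t1'] := ltP t 1; last first.
      have tt : t = 1 by lra.
      by rewrite tt; lra.
    have q3 : 0 < (1 - t) * eta by rewrite mulr_gt0// subr_gt0.
    by lra.
  by split; [have [] := diff1_affine d|exact: b].
pose kap w := r%:C * w / (r%:C * w - z).
have kap_hol : circle_hol kap := circle_hol_kernel zr.
pose m t := cmean (fun w => f (p t + c t * w) * kap w).
have m0 : m 0 = f z.
  have -> : m 0 = cmean (fun w => f z * kap w).
    by congr cmean; apply/funext => w; rewrite /p /c !mul0r subr0 addr0.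
  by rewrite cmeanZ// cmean_kernel// mulr1.
have m1 : m 1 = cmean (fun w => f (r%:C * w) * kap w).
  by congr cmean; apply/funext => w; rewrite /p /c !mul1r subrr add0r.
rewrite -m1 -m0; apply/esym.
pose k0 := 1 + cabs z / (r - cabs z).
have zr0 : 0 < r - cabs z by rewrite subr_gt0.
have k00 : 0 <= k0 by rewrite addr_ge0// divr_ge0// ltW.
pose K := 8 * A / eta ^+ 2.
have K0 : 0 <= K by rewrite divr_ge0 ?sqr_ge0// mulr_ge0.
apply: (@cst_of_quadratic _ m 0 1 (k0 * (K * (2 * r) ^+ 2))) => //.
  exact: mulr_ge0 k00 (mulr_ge0 K0 (sqr_ge0 _)).
move=> s t s0 st t1; have [t0|t0] := eqVneq t 0.
  have -> : s = t by lra.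
  by rewrite !subrr cabs0 expr0n mulr0.
have {t0}t0 : 0 < t by rewrite lt_def t0; lra.
have s01 : 0 <= s <= 1 by lra.
have t01 : 0 <= t <= 1 by lra.
apply: (cmean_dist (chi := fun w => f (p t + c t * w)) (c := ((s - t) / t)%:C)).
- by apply: circle_holM => //; exact: chi_hol.
- by apply: circle_holM => //; exact: chi_hol.
- exact: chi_hol.
move=> w w1.
have [|du _] := H (p t + c t * w); first by have := ub1 _ w t01 w1; lra.
have [_ ->] := diff1_affine du.
have [|n0 kb] := @kernel_bound (r - cabs z) (r%:C * w) z zr0.
  by rewrite cabs_scale// w1 mulr1.
set D := 'd f _ _; pose h := (s - t)%:C * (r%:C * w - z).
have tC0 : (t%:C : C) != 0 by rewrite (fmorph_eq0 (real_complex R)) gt_eqF.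
have us : p s + c s * w = p t + c t * w + h by rewrite /p /c /h rmorphB/=; ring.
have -> : f (p s + c s * w) * kap w - f (p t + c t * w) * kap w - ((s - t) / t)%:C * (w * (c t * D)) =
   kap w * (f (p t + c t * w + h) - f (p t + c t * w) - h * D).
  rewrite us /kap /h /c rmorphM fmorphV/=.
  move: (f _) (f _) => a b; field.
  by rewrite n0 tC0.
rewrite cabsM -mulrA; apply: ler_pM; rewrite ?cabs_ge0//.
have hb : cabs h ^+ 2 <= (2 * r) ^+ 2 * (t - s) ^+ 2.
  rewrite -exprMn lerXn2r ?nnegrE ?cabs_ge0 ?mulr_ge0 ?subr_ge0 ?(ltW r0)//.
  rewrite /h cabsM cabs_real distrC ger0_norm ?subr_ge0// mulrC ler_wpM2r ?subr_ge0//.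
  apply: le_trans (cabsB _ _) _; rewrite cabs_scale// w1; lra.
apply: (@le_trans _ _ (K * cabs h ^+ 2)); last by rewrite -mulrA ler_wpM2l.
apply: (cauchy2_far eta0).
  move=> v vu; apply: H; have := cabs_leD v (p t + c t * w).
  by have := ub1 _ w t01 w1; lra.
by rewrite -us; have [|//] := H (p s + c s * w); have := ub1 _ w s01 w1; lra.
Qed.

End CauchyFormula.

(** * Hartogs extension *)

Section Hartogs.
Variables (R : realType) (n : nat).
Local Notation C := (R[i]^o).
Local Notation V := (Cvec R n.+2).
Local Notation B := (unit_ball R n.+2).
Implicit Types (z y : V) (u w : C) (r : R).

Let e0 : V := delta_mx 0 0.

(** Written as an affine line in [u], so that [dif_line] gives holomorphy in [u]. *)
Definition upd z u : V := z - (z 0 0) *: e0 + u *: e0.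

Lemma upd_coord z u j : upd z u 0 j = if j == 0 then u else z 0 j.
Proof.
rewrite /upd /e0 !mxE eqxx /=; case: eqVneq => [->|j0].
  by rewrite !mulr1 subrr add0r.
by rewrite !mulr0 subr0 addr0.
Qed.

Definition rest z : R := \sum_(j < n.+1) cabs (z 0 (lift 0 j)) ^+ 2.

Lemma enorm_rest z : enorm z ^+ 2 = cabs (z 0 0) ^+ 2 + rest z.
Proof. by rewrite enorm_sqr big_ord_recl. Qed.

Lemma enorm_upd z u : enorm (upd z u) ^+ 2 = cabs u ^+ 2 + rest z.
Proof.
rewrite enorm_rest upd_coord eqxx; congr (_ + _); apply: eq_bigr => j _.
by rewrite upd_coord.
Qed.

Lemma updK z : upd z (z 0 0) = z.
Proof. by rewrite /upd subrK. Qed.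

Lemma coord0_continuous : continuous (fun z : V => cabs (z 0 0)).
Proof.
move=> z; apply: (@continuous_comp V C R (fun z => z 0 0) (@cabs R)).
  exact: diff_cont (dif_coord 0 z).
exact: cabs_continuous.
Qed.

Lemma rest_continuous : continuous (rest : V -> R).
Proof.
have -> : rest = (fun z => enorm z * enorm z - cabs (z 0 0) * cabs (z 0 0)).
  by apply/funext => z; rewrite -!expr2 enorm_rest; ring.
move=> z; apply: (@continuousB _ R V (fun z => enorm z * enorm z)
  (fun z => cabs (z 0 0) * cabs (z 0 0))).
  apply: (@continuousM _ V (@enorm R n.+2) (@enorm R n.+2)); exact: enorm_continuous.
apply: (@continuousM _ V (fun z => cabs (z 0 0)) (fun z => cabs (z 0 0)));
  exact: coord0_continuous.
Qed.

Lemma dif_upd u z : differentiable (fun z => upd z u) z.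
Proof.
apply: dif_row => j.
have -> : (fun y => upd y u 0 j) = (fun y => if j == 0 then u else y 0 j).
  by apply/funext => y; rewrite upd_coord.
by case: eqP => _; [exact: dif_cst|exact: dif_coord].
Qed.

Variables (K : set V) (rho : R).
Hypothesis clK : closed K.
Hypothesis rho0 : 0 <= rho < 1.
Hypothesis Krho : forall z, K z -> enorm z <= rho.

Lemma shell z : rho ^+ 2 < enorm z ^+ 2 -> enorm z ^+ 2 < 1 -> (B `\` K) z.
Proof.
case/andP: rho0 => r0 r1 h1 h2; split.
  by rewrite unit_ballE; move: h2; rewrite expr_lt1// enorm_ge0.
move=> /Krho; apply/negP; rewrite -ltNge.
by move: h1; rewrite ltr_pXn2r// nnegrE enorm_ge0.
Qed.

Variable f : V -> C.
Hypothesis df : forall z, (B `\` K) z -> differentiable f z.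
Hypothesis f1 : forall z, (B `\` K) z -> cabs (f z) <= 1.

Let valid z r := [/\ cabs (z 0 0) < r, rho ^+ 2 < r ^+ 2 + rest z
  & r ^+ 2 + rest z < 1].

(* Cauchy integral of [f] in the first variable; [valid z r] says that the circle
   of radius [r] encloses [z 0 0] and lies in the shell outside [K]. *)
Let Fr r z := cmean (fun w => f (upd z (r%:C * w)) *
  (r%:C * w / (r%:C * w - z 0 0))).

Let valid_ex z : B z -> exists r, valid z r.
Proof.
rewrite unit_ballE => z1; have /andP[r0 r1] := rho0.
have h1 : enorm z ^+ 2 < 1 by rewrite expr_lt1// enorm_ge0.
rewrite enorm_rest in h1.
have h2 : rho ^+ 2 < 1 by rewrite expr_lt1.
(* Validity says that [r ^+ 2] lies strictly between [m] and [1 - rest z]; the midpoint is taken. *)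
pose m := Num.max (cabs (z 0 0) ^+ 2) (rho ^+ 2 - rest z).
have m1 : m < 1 - rest z by rewrite gt_max; apply/andP; split; lra.
have m2 : cabs (z 0 0) ^+ 2 <= m by rewrite le_max lexx.
have m3 : rho ^+ 2 - rest z <= m by rewrite le_max lexx orbT.
have m0 : 0 <= m by apply: le_trans m2; exact: sqr_ge0.
exists (Num.sqrt ((m + (1 - rest z)) / 2)).
have s2 : Num.sqrt ((m + (1 - rest z)) / 2) ^+ 2 = (m + (1 - rest z)) / 2.
  by rewrite sqr_sqrtr//; lra.
split; rewrite ?s2; [|lra|lra].
rewrite -(@ltr_pXn2r _ 2)// ?nnegrE ?cabs_ge0 ?sqrtr_ge0// s2; lra.
Qed.

Let valid_gt0 z r : valid z r -> 0 < r.
Proof. by case=> h _ _; apply: le_lt_trans h; exact: cabs_ge0. Qed.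

Let margin z r1 r2 : valid z r1 -> valid z r2 -> exists eta,
  [/\ 0 < eta, cabs (z 0 0) < r1 - eta, rho ^+ 2 < (r1 - eta) ^+ 2 + rest z
    & (r2 + eta) ^+ 2 + rest z < 1].
Proof.
move=> v1 v2; have r10 := valid_gt0 v1; have r20 := valid_gt0 v2.
case: v1 v2 => a1 a2 _ [_ _ a3].
have p1 : 0 < 2 * r1 + 1 by lra.
have p2 : 0 < 2 * r2 + 1 by lra.
pose x1 := (r1 - cabs (z 0 0)).
pose x2 := (r1 ^+ 2 + rest z - rho ^+ 2) / (2 * r1 + 1).
pose x3 := (1 - (r2 ^+ 2 + rest z)) / (2 * r2 + 1).
pose m := Num.min (Num.min 1 x1) (Num.min x2 x3).
have m0 : 0 < m.
  by rewrite !lt_min ltr01 subr_gt0 a1 !divr_gt0// ?subr_gt0.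
have m1 : m <= 1 by rewrite !ge_min lexx.
have m2 : m <= x1 by rewrite !ge_min lexx orbT.
have m3 : m <= x2 by rewrite !ge_min lexx !orbT.
have m4 : m <= x3 by rewrite !ge_min lexx !orbT.
rewrite ler_pdivlMr// in m3; rewrite ler_pdivlMr// in m4.
exists (m / 2); split; first by lra.
- by rewrite /x1 in m2; lra.
- by have := sqr_ge0 m; nra.
- by nra.
Qed.

Let annulus z r1 r2 eta u : 0 < eta -> 0 < r1 -> cabs (z 0 0) < r1 - eta ->
  rho ^+ 2 < (r1 - eta) ^+ 2 + rest z -> (r2 + eta) ^+ 2 + rest z < 1 ->
  r1 - eta < cabs u < r2 + eta ->
  differentiable (fun u => f (upd z u) * (u / (u - z 0 0))) u /\
  cabs (f (upd z u) * (u / (u - z 0 0))) <= 1 + cabs (z 0 0) / (r1 - eta - cabs (z 0 0)).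
Proof.
move=> eta0 r10 h1 h2 h3 /andP[u1 u2].
have z0 := cabs_ge0 (z 0 0).
have D : (B `\` K) (upd z u).
  have s1 : (r1 - eta) ^+ 2 < cabs u ^+ 2 by rewrite ltr_pXn2r ?nnegrE ?cabs_ge0//; lra.
  have s2 : cabs u ^+ 2 < (r2 + eta) ^+ 2.
    by rewrite ltr_pXn2r ?nnegrE ?cabs_ge0//; have := cabs_ge0 u; lra.
  by apply: shell; rewrite enorm_upd; lra.
have d0 : 0 < r1 - eta - cabs (z 0 0) by lra.
have [|n0 kb] := @kernel_bound _ (r1 - eta - cabs (z 0 0)) u (z 0 0) d0; first by lra.
split.
  apply: dif_mul; last exact: dif_kernel.
  by apply: dif_line; exact: df.
rewrite cabsM; apply: le_trans kb.
by rewrite ler_piMl ?cabs_ge0// f1.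
Qed.

(** The valid radii form an interval, so the annulus between two valid circles lies in the shell and
    [cmean_radius] applies. *)
Let Fr_eq z r1 r2 : valid z r1 -> valid z r2 -> Fr r1 z = Fr r2 z.
Proof.
wlog r12 : r1 r2 / r1 <= r2.
  move=> H v1 v2; have [/H|/ltW/H] := leP r1 r2; first exact.
  by move=> /(_ v2 v1).
move=> v1 v2; have [eta [eta0 h1 h2 h3]] := margin v1 v2.
have r10 := valid_gt0 v1.
apply: (@cmean_radius _ (fun u => f (upd z u) * (u / (u - z 0 0))) r1 r2 eta
  (1 + cabs (z 0 0) / (r1 - eta - cabs (z 0 0)))) => // u uu.
exact: (annulus eta0 r10 h1 h2 h3 uu).
Qed.

Let Fr_tends z r : valid z r -> tends (fun N => rmean N (fun w =>
  f (upd z (r%:C * w)) * (r%:C * w / (r%:C * w - z 0 0)))) (Fr r z).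
Proof.
move=> v; have r0 := valid_gt0 v; have [eta [eta0 h1 h2 h3]] := margin v v.
apply: cmeanP; exists (eta / r), (1 + cabs (z 0 0) / (r - eta - cabs (z 0 0))).
split; first by rewrite divr_gt0.
move=> w /andP[w1 w2].
have [|d b] := @annulus z r r eta (r%:C * w) eta0 r0 h1 h2 h3.
  rewrite cabs_scale//.
  have : r * (1 - eta / r) < r * cabs w by rewrite ltr_pM2l.
  have : r * cabs w < r * (1 + eta / r) by rewrite ltr_pM2l.
  rewrite mulrDr mulrBr mulr1 mulrCA mulfV ?gt_eqF// mulr1; lra.
split; last exact: b.
by apply: (@dif_scale_comp _ (fun u => f (upd z u) * (u / (u - z 0 0)))).
Qed.

Let F z := Fr (xget 0 [set r | valid z r]) z.

Let FE z r : valid z r -> F z = Fr r z.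
Proof.
move=> v; rewrite /F; case: xgetP => [s _ vs|/(_ r) []]; last exact: v.
exact: Fr_eq.
Qed.

(** The radius in [F] is chosen point by point, but one [r] is valid for all [y] near [z]. With this
    fixed contour [F] is locally a bounded limit of means that are holomorphic in [y]. *)
Let dF z : B z -> differentiable F z.
Proof.
move=> /valid_ex[r v]; have r0 := valid_gt0 v; case: (v) => h1 h2 h3.
pose c := (cabs (z 0 0) + r) / 2.
have cr : c < r by rewrite /c; lra.
have n1 : nbhs z [set y | cabs (y 0 0) < c].
  apply: open_nbhs_nbhs; split; last by rewrite /= /c; lra.
  exact: (open_sublevel c coord0_continuous).
have n2 : nbhs z [set y | - rest y < r ^+ 2 - rho ^+ 2].
  apply: open_nbhs_nbhs; split; last by rewrite /=; lra.
  apply: (@open_sublevel _ _ (fun y : V => - rest y)) => y.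
  by apply: (@continuousN _ R V rest); exact: rest_continuous.
have n3 : nbhs z [set y | rest y < 1 - r ^+ 2].
  apply: open_nbhs_nbhs; split; last by rewrite /=; lra.
  exact: (open_sublevel _ rest_continuous).
have [s s0 H] := (nbhs_nm z _).1 (filterI n1 (filterI n2 n3)).
have vy y : nm (y - z) < s -> valid y r /\ cabs (y 0 0) < c.
  by move=> /H[/= a1 [a2 a3]]; split=> //; split; lra.
have cpos : 0 < r - c by lra.
have UE y w : nm (y - z) < s -> cabs w = 1 -> (B `\` K) (upd y (r%:C * w)).
  move=> /vy[[b1 b2 b3] _] w1; apply: shell; rewrite enorm_upd cabs_scale// w1 mulr1//.
have ker y w : nm (y - z) < s -> cabs w = 1 -> r%:C * w - y 0 0 != 0 /\
    cabs (r%:C * w / (r%:C * w - y 0 0)) <= 1 + c / (r - c).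
  move=> /vy[_ yc] w1; have [|n0 kb] := @kernel_bound _ (r - c) (r%:C * w) (y 0 0) cpos.
    by rewrite cabs_scale// w1 mulr1; lra.
  split=> //; apply: le_trans kb _; rewrite lerD2l ler_pM2r ?invr_gt0//.
  exact: ltW.
apply: (@tends_differentiable _ V (fun N y => rmean N (fun w =>
  f (upd y (r%:C * w)) * (r%:C * w / (r%:C * w - y 0 0)))) F z s (1 + c / (r - c)) s0).
- move=> N y ys; apply: dif_rmean => w w1; apply: dif_mul.
    apply: (@dif_comp _ V V C (fun y => upd y (r%:C * w)) f); first exact: dif_upd.
    by apply: df; exact: UE.
  apply: dif_mul; first exact: dif_cst.
  apply: dif_inv; last by have [] := ker _ _ ys w1.
  by apply: dif_sub; [exact: dif_cst|exact: dif_coord].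
- move=> N y ys; apply: rmean_le => w w1; have [_ kb] := ker _ _ ys w1.
  rewrite cabsM; apply: le_trans kb; rewrite ler_piMl ?cabs_ge0//.
  by apply: f1; exact: UE.
- by move=> y /vy[vy' _]; rewrite (FE vy'); exact: Fr_tends.
Qed.

(** Here the whole disc bounded by the circle avoids [K], so Cauchy's formula applies to [f]
    itself. *)
Let F_outer z : B z -> rho ^+ 2 < rest z -> F z = f z.
Proof.
move=> Bz rz; have [r v] := valid_ex Bz; have r0 := valid_gt0 v.
have [eta [eta0 h1 h2 h3]] := margin v v.
rewrite (FE v) -{2}(updK z).
have zr : cabs (z 0 0) < r by case: v.
apply: (@cmean_cauchy _ (fun u => f (upd z u)) r eta 1 _ zr eta0) => u ur.
have D : (B `\` K) (upd z u).
  have u0 := cabs_ge0 u.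
  have s2 : cabs u ^+ 2 < (r + eta) ^+ 2.
    by rewrite ltr_pXn2r ?nnegrE ?cabs_ge0//; lra.
  by apply: shell; rewrite enorm_upd; have := sqr_ge0 (cabs u); lra.
by split; [apply: dif_line; exact: df|exact: f1].
Qed.

Hypothesis cD : connected (B `\` K).

Let F_eq z : (B `\` K) z -> F z = f z.
Proof.
case/andP: rho0 => r0 r1.
have oB : open B by exact: open_eball.
have oD : open (B `\` K) by rewrite setDE; apply: openI => //; exact: closed_openC.
pose x : R := (rho + 1) / 2.
(* A point of the shell lying on the second axis: its slice in the first variable misses [K], so
   [F_outer] holds around it. This is where the dimension has to be at least two. *)
pose p : V := (x%:C : C) *: delta_mx 0 (lift 0 0).
have p0 : p 0 0 = 0 by rewrite !mxE eqxx mulr0.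
have rp : rest p = x ^+ 2.
  rewrite /rest big_ord_recl big1 ?addr0 => [|j _].
    by rewrite !mxE !eqxx/= mulr1 cabs_real real_normK// num_real.
  by rewrite !mxE/= mulr0 cabs0 expr0n.
have np : enorm p ^+ 2 = x ^+ 2 by rewrite enorm_rest p0 cabs0 expr0n add0r.
have x0 : 0 <= x by rewrite /x; lra.
have x1 : x < 1 by rewrite /x; lra.
have rx : rho ^+ 2 < x ^+ 2 by rewrite ltr_pXn2r ?nnegrE// /x; lra.
have Dp : (B `\` K) p by apply: shell; rewrite np// expr_lt1.
move=> Dz; apply: (@diff_identity _ V F f (B `\` K) p oD cD Dp); last exact: Dz.
- move=> y [By _].
  exact: dF.
- exact: df.
have n1 : nbhs p B by apply: open_nbhs_nbhs; split=> //; case: Dp.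
have n2 : nbhs p [set y | - rest y < - rho ^+ 2].
  apply: open_nbhs_nbhs; split; last by rewrite /= rp; lra.
  apply: (@open_sublevel _ _ (fun y : V => - rest y)) => y.
  by apply: (@continuousN _ R V rest); exact: rest_continuous.
apply: filterS2 n1 n2 => y By /= ry; apply: F_outer => //; lra.
Qed.

(** Maximum principle on the complex line through [0] and [z]: on a circle of radius [s > rho] the
    extension coincides with [f]. *)
Let F_le1 z : B z -> cabs (F z) <= 1.
Proof.
case/andP: rho0 => r0 r1; rewrite unit_ballE => z1.
pose e : V := if z == 0 then e0 else unit_dir z.
have e1 : enorm e = 1.
  rewrite /e; case: eqVneq => [_|z0].
    apply/eqP; rewrite -(@eqrXn2 _ 2)// ?enorm_ge0// enorm_rest /rest big1.
      by rewrite !mxE !eqxx/= cabs1 expr1n addr0.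
    by move=> j _; rewrite !mxE/= cabs0 expr0n.
  by rewrite enormZ cabs_real ger0_norm ?invr_ge0 ?enorm_ge0// mulVf// enorm_eq0.
have zE : z = 0 + ((enorm z)%:C : C) *: e.
  rewrite add0r /e; case: eqVneq => [->|z0]; first by rewrite enorm0 scale0r.
  by rewrite /unit_dir scalerA -rmorphM/= mulfV ?enorm_eq0// scale1r.
have nt (t : C) : enorm (0 + t *: e) = cabs t by rewrite add0r enormZ e1 mulr1.
pose s := (Num.max rho (enorm z) + 1) / 2.
have m1 : Num.max rho (enorm z) < 1 by rewrite gt_max r1.
have m2 : rho <= Num.max rho (enorm z) by rewrite le_max lexx.
have m3 : enorm z <= Num.max rho (enorm z) by rewrite le_max lexx orbT.
have s0 : 0 < s by rewrite /s; lra.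
have dt (t : C) : cabs t <= s -> differentiable (fun t : C => F (0 + t *: e)) t.
  move=> ts; apply: dif_line; apply: dF.
  by rewrite unit_ballE nt; move: ts; rewrite /s; lra.
rewrite zE; apply: (@max_modulus _ (fun t : C => F (0 + t *: e)) s 1 s0).
- by move=> t /dt; exact: diff_cont.
- by move=> t /ltW/dt.
- move=> t ts.
  have D : (B `\` K) (0 + t *: e).
    by apply: shell; rewrite nt ts; [rewrite ltr_pXn2r ?nnegrE// ?ltW// /s|rewrite expr_lt1// ?ltW// /s]; lra.
  by rewrite F_eq//; exact: f1.
- by rewrite cabs_real ger0_norm ?enorm_ge0// /s; lra.
Qed.

Theorem hartogs : exists G : V -> C,
  [/\ forall z, B z -> differentiable G z, forall z, B z -> cabs (G z) <= 1
    & forall z, (B `\` K) z -> G z = f z].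
Proof. by exists F; split; [exact: dF|exact: F_le1|exact: F_eq]. Qed.

End Hartogs.

(** * The inverse function theorem *)

Section InverseFunction.
Variables (R : realType) (n : nat).
Local Notation C := (R[i]^o).
Local Notation V := (Cvec R n).
Implicit Types (x y u v h : V) (f g : V -> V).

Lemma dif_bigsum (U : normedModType R[i]) (I : Type) (r : seq I) (P : pred I)
    (F : I -> U -> C) (x : U) : (forall i, P i -> differentiable (F i) x) ->
  differentiable (fun y : U => \sum_(i <- r | P i) F i y) x.
Proof.
move=> dF; elim: r => [|i r IH].
  have -> : (fun y : U => \sum_(i <- [::] | P i) F i y) = (fun=> 0).
    by apply/funext => y; rewrite big_nil.
  exact: dif_cst.
have -> : (fun y : U => \sum_(i <- i :: r | P i) F i y) =
    (fun y : U => (if P i then F i y else 0) + \sum_(i <- r | P i) F i y).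
  by apply/funext => y; rewrite big_cons; case: ifP => _; rewrite ?add0r.
apply: dif_add; last exact: IH.
by case: (boolP (P i)) => [Pi|_]; [exact: dF|exact: dif_cst].
Qed.

Lemma dif_bigprod (U : normedModType R[i]) (I : Type) (r : seq I) (P : pred I)
    (F : I -> U -> C) (x : U) : (forall i, P i -> differentiable (F i) x) ->
  differentiable (fun y : U => \prod_(i <- r | P i) F i y) x.
Proof.
move=> dF; elim: r => [|i r IH].
  have -> : (fun y : U => \prod_(i <- [::] | P i) F i y) = (fun=> 1).
    by apply/funext => y; rewrite big_nil.
  exact: dif_cst.
have -> : (fun y : U => \prod_(i <- i :: r | P i) F i y) =
    (fun y : U => (if P i then F i y else 1) * \prod_(i <- r | P i) F i y).
  by apply/funext => y; rewrite big_cons; case: ifP => _; rewrite ?mul1r.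
apply: dif_mul; last exact: IH.
by case: (boolP (P i)) => [Pi|_]; [exact: dF|exact: dif_cst].
Qed.

Lemma linear_bound (U W : normedModType R[i]) (L : {linear U -> W}) :
  {for 0, continuous L} -> exists2 k : R, 0 <= k & forall h : U, nm (L h) <= k * nm h.
Proof.
move=> cL; have [d d0 H] := (cont_nm L 0).1 cL _ ltr01.
exists (2 / d); first by rewrite divr_ge0// ltW.
move=> h; have [->|h0] := eqVneq h 0; first by rewrite linear0 !nm0 mulr0.
have hp : 0 < nm h by rewrite nm_gt0.
pose t : R := d / (2 * nm h).
have t0 : 0 < t by rewrite divr_gt0// mulr_gt0.
have ct : cabs (t%:C : C) = t by rewrite cabs_real gtr0_norm.
have := H ((t%:C : C) *: h); rewrite (linear0 L) !subr0 linearZ/= !nmZ ct.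
have -> : t * nm h = d / 2 by rewrite /t; field; rewrite gt_eqF.
move=> /(_ ltac:(lra)) h1.
have -> : 2 / d * nm h = t^-1.
  by rewrite /t; field; rewrite !gt_eqF.
by rewrite -(ler_pM2l t0) mulfV ?gt_eqF// ltW.
Qed.

Lemma dif_near (U W : normedModType R[i]) (f g : U -> W) (x : U) :
  (\forall y \near x, f y = g y) -> differentiable f x -> differentiable g x.
Proof.
move=> /nbhs_nm[s s0 fg] df.
have [|k k0 kH] := @linear_bound _ _ ('d f x).
  by have : continuous ('d f x) by exact: diff_continuous.
suff [] : differentiable g x /\ 'd g x = 'd f x :> (U -> W) by [].
apply: (@eps_diff _ _ _ _ _ _ k) => // e e0.
have [d d0 H] := diff_eps df e0.
exists (Num.min s d); first by rewrite lt_min s0.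
move=> h; rewrite lt_min => /andP[hs hd].
rewrite -!fg ?subrr ?nm0//; first exact: H.
by rewrite addrC addKr.
Qed.

(** Vectors are rows, so the differential acts as [h *m A] and the chain rule multiplies from left
    to right; a matrix in place of ['d] gives access to rank and determinant. *)
Definition jac_at f x (A : 'M[C]_n) := forall e : R, 0 < e ->
  exists2 d : R, 0 < d &
    forall h, nm h < d -> nm (f (x + h) - f x - h *m A) <= e * nm h.

Definition jac f x : 'M[C]_n :=
  \matrix_(k, j) 'd (fun y => f y 0 j : C) x (delta_mx 0 k : V).

Lemma mul_jac f x h j : (h *m jac f x) 0 j = 'd (fun y => f y 0 j : C) x h.
Proof.
rewrite mxE [in RHS](row_sum_delta h) linear_sum/=; apply: eq_bigr => k _.
by rewrite linearZ/= mxE.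
Qed.

Lemma jacP f x : differentiable f x -> jac_at f x (jac f x).
Proof.
move=> df e e0.
have [d d0 H] : exists2 d : R, 0 < d & forall h j, nm h < d ->
    cabs (f (x + h) 0 j - f x 0 j - (h *m jac f x) 0 j) <= e * nm h.
  have Hj j : exists2 d : R, 0 < d & forall h, nm h < d ->
      cabs (f (x + h) 0 j - f x 0 j - (h *m jac f x) 0 j) <= e * nm h.
    have [d d0 H] := diff_eps (dif_col j df) e0.
    by exists d => // h /H; rewrite mul_jac.
  have [d d0 H] : exists2 d : R, 0 < d & forall j : 'I_n, (j \in enum 'I_n) ->
      forall h, nm h < d ->
      cabs (f (x + h) 0 j - f x 0 j - (h *m jac f x) 0 j) <= e * nm h.
    elim: (enum 'I_n) => [|j r [d1 d10 H1]]; first by exists 1.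
    have [d2 d20 H2] := Hj j; exists (Num.min d1 d2); first by rewrite lt_min d10.
    move=> k; rewrite inE => /orP[/eqP -> | kr] h; rewrite lt_min => /andP[h1 h2].
      exact: H2.
    exact: H1.
  by exists d => // h j hd; apply: H; rewrite // mem_enum.
exists d => // h hd; apply: nm_le; first by rewrite mulr_ge0 ?nm_ge0 ?(ltW e0).
by move=> j; have := H h j hd; rewrite !mxE.
Qed.

Lemma mul_bound (A : 'M[C]_n) : exists2 k : R, 0 < k & forall h, nm (h *m A) <= k * nm h.
Proof.
pose a := \sum_(p : 'I_n * 'I_n) cabs (A p.1 p.2).
have a0 : 0 <= a by rewrite sumr_ge0// => p _; exact: cabs_ge0.
have aA i j : cabs (A i j) <= a.
  by rewrite /a (bigD1 (i, j))//= lerDl sumr_ge0// => p _; exact: cabs_ge0.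
have sum_le (F : 'I_n -> C) : cabs (\sum_(i < n) F i) <= \sum_(i < n) cabs (F i).
  elim/big_ind2 : _ => [|x1 x2 y1 y2 h1 h2|//]; first by rewrite cabs0.
  by apply: le_trans (cabsD _ _) _; exact: lerD.
exists (n%:R * a + 1); first by rewrite ltr_wpDl// mulr_ge0.
move=> h; apply: nm_le; first by rewrite mulr_ge0 ?nm_ge0// addr_ge0// mulr_ge0.
move=> j; rewrite mxE; apply: le_trans (sum_le _) _.
apply: (@le_trans _ _ (\sum_(i < n) a * nm h)).
  apply: ler_sum => i _; rewrite cabsM mulrC ler_pM ?cabs_ge0//.
  exact: cabs_coord.
by rewrite sumr_const card_ord -[leLHS]mulr_natl mulrA ler_wpM2r ?nm_ge0// lerDl.
Qed.

Lemma jac_at_diff f x A : jac_at f x A -> differentiable f x.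
Proof.
have [k k0 kA] := mul_bound A; move=> H.
have L : linear (fun h : V => h *m A) by move=> c u v; rewrite mulmxDl scalemxAl.
pose Lin : {linear V -> V} := HB.pack (fun h : V => h *m A) (GRing.isLinear.Build _ _ _ _ (fun h : V => h *m A) L).
suff [] : differentiable f x /\ 'd f x = Lin :> (V -> V) by [].
by apply: (@eps_diff _ _ _ _ _ _ k).
Qed.

Lemma jac_unique f x A : jac_at f x A -> jac f x = A.
Proof.
move=> HA; have := jacP (jac_at_diff HA); move: (jac f x) => A' HA'.
suff H h : h *m A' = h *m A.
  by apply/row_matrixP => i; rewrite !rowE H.
apply/eqP; rewrite -subr_eq0 -nm_eq0 eq_le nm_ge0 andbT.
apply/ler_addgt0Pr => e e0; rewrite add0r.
have h1 : 0 < nm h + 1 by rewrite ltr_wpDl// nm_ge0.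
have e'0 : 0 < e / 2 / (nm h + 1) by rewrite !divr_gt0.
have [d1 d10 H1] := HA _ e'0; have [d2 d20 H2] := HA' _ e'0.
pose t := Num.min d1 d2 / (nm h + 1) / 2.
have m0 : 0 < Num.min d1 d2 by rewrite lt_min d10.
have t0 : 0 < t by rewrite !divr_gt0.
have ct : cabs (t%:C : C) = t by rewrite cabs_real gtr0_norm.
have th : t * (nm h + 1) = Num.min d1 d2 / 2 by rewrite /t; field; rewrite gt_eqF.
have : nm ((t%:C : C) *: h) < Num.min d1 d2.
  rewrite nmZ ct; apply: (@le_lt_trans _ _ (t * (nm h + 1))).
    by rewrite ler_pM2l// lerDl.
  by rewrite th; lra.
rewrite lt_min => /andP[/H1 b1 /H2 b2].
have : nm ((t%:C : C) *: (h *m A' - h *m A)) <= t * e.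
  have -> : (t%:C : C) *: (h *m A' - h *m A) =
    (f (x + (t%:C : C) *: h) - f x - ((t%:C : C) *: h) *m A) -
    (f (x + (t%:C : C) *: h) - f x - ((t%:C : C) *: h) *m A').
    by rewrite -!scalemxAl scalerBr; apply/rowP => j; rewrite !mxE; ring.
  apply: le_trans (nmB _ _) _; apply: le_trans (lerD b1 b2) _.
  rewrite nmZ ct -mulrDl.
  have -> : (e / 2 / (nm h + 1) + e / 2 / (nm h + 1)) * (t * nm h) =
     t * (e * (nm h / (nm h + 1))) by field; rewrite gt_eqF.
  by rewrite ler_pM2l// ger_pMr// ler_pdivrMr// mul1r lerDl.
by rewrite nmZ ct ler_pM2l.
Qed.

Lemma compact_nm_ball p (r : R) : compact [set z : V | nm (z - p) <= r].
Proof.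
have c1 : compact [set v : V | forall i, [set w : C | cabs w <= r + nm p] (v 0 i)].
  by apply: (@rV_compact C n (fun _ => [set w : C | cabs w <= r + nm p])) => i; exact: compact_disc.
have cl : closed [set z : V | nm (z - p) <= r].
  have -> : [set z : V | nm (z - p) <= r] = [set z | ((@nm R V) \o (fun z => z - p)) z <= r] by [].
  apply: closed_sublevel => x; apply: continuous_comp; last exact: nm_continuous.
  apply: diff_cont; apply: differentiableD; [exact: dif_id|exact: dif_cst].
apply: (subclosed_compact cl c1) => z /= zr i.
apply: le_trans (cabs_coord _ _) _.
by apply: le_trans (nm_leD _ (z - p)) _; rewrite subKr lerD2r.
Qed.

(* [f = id + G] with [G] a contraction: [nm (f - v)] is minimised on the closed
   ball at an interior point, and moving by [t (v - f y)] would decrease it. *)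
Lemma perturbed_id f u (d : R) : 0 < d ->
  (forall x y, nm (x - u) < 2 * d -> nm (y - u) < 2 * d ->
    nm ((f x - x) - (f y - y)) <= 2^-1 * nm (x - y)) ->
  (forall x y, nm (x - u) < 2 * d -> nm (y - u) < 2 * d -> nm (x - y) <= 2 * nm (f x - f y)) /\
  forall v, nm (v - f u) < d / 4 -> exists2 y, nm (y - u) < d & f y = v.
Proof.
move=> d0 H.
have inj x y : nm (x - u) < 2 * d -> nm (y - u) < 2 * d -> nm (x - y) <= 2 * nm (f x - f y).
  move=> xu yu; have := H x y xu yu.
  have -> : f x - x - (f y - y) = (f x - f y) - (x - y) by apply/rowP => j; rewrite !mxE; ring.
  by have := nm_leD (x - y) (f x - f y); rewrite [nm (x - y - _)]nmBC; lra.
split=> // v vu.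
have uu : nm (u - u) <= d by rewrite subrr nm0 ltW.
have w2 x : nm (x - u) <= d -> nm (x - u) < 2 * d by lra.
have lip x y : nm (x - u) < 2 * d -> nm (y - u) < 2 * d -> nm (f x - f y) <= 2 * nm (x - y).
  move=> xu yu; have := H x y xu yu; have := nm_leD (f x - f y) (x - y).
  have := nm_ge0 (x - y).
  have -> : f x - f y - (x - y) = f x - x - (f y - y).
    by apply/rowP => j; rewrite !mxE; ring.
  lra.
have cf x : nm (x - u) <= d -> {for x, continuous f}.
  move=> xu; apply/cont_nm => e e0; exists (Num.min (2 * d - nm (x - u)) (e / 2)).
    by rewrite lt_min divr_gt0// andbT; lra.
  move=> y; rewrite lt_min => /andP[y1 y2].
  have yu : nm (y - u) < 2 * d by apply: le_lt_trans (nm_tri _ x _) _; lra.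
  by have := lip y x yu (w2 _ xu); lra.
have [|||y /set_mem yd ymin] := @compact_EVT_min _ _ (fun y => nm (f y - v)) [set y : V | nm (y - u) <= d].
- by exists u.
- exact: compact_nm_ball.
- apply: continuous_in_subspaceT => x /set_mem xd.
  apply: (@continuous_comp V V R (fun y => f y - v) (@nm R V)); last exact: nm_continuous.
  by apply: (@continuousB _ V V f (fun=> v)); [exact: cf|exact: cst_continuous].
have yu : nm (y - u) < d.
  rewrite lt_neqAle yd andbT; apply/eqP => yE.
  have := ymin u (mem_set uu); have := inj y u (w2 _ yd) (w2 _ uu); rewrite yE.
  have := nm_tri (f y) v (f u); rewrite [nm (f u - v)]nmBC; lra.
exists y => //; apply/eqP; rewrite -subr_eq0 -nm_eq0; apply: contraT => ry.
have r0 : 0 < nm (f y - v) by rewrite lt_def ry nm_ge0.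
pose r := nm (f y - v); pose t := Num.min 1 ((d - nm (y - u)) / r) / 2.
have m0 : 0 < Num.min 1 ((d - nm (y - u)) / r) by rewrite lt_min ltr01 divr_gt0// subr_gt0.
have t0 : 0 < t by rewrite divr_gt0.
have t1 : t < 1.
  have : Num.min 1 ((d - nm (y - u)) / r) <= 1 by rewrite ge_min lexx.
  by rewrite /t; lra.
have t2 : t * r <= d - nm (y - u).
  have : Num.min 1 ((d - nm (y - u)) / r) <= (d - nm (y - u)) / r by rewrite ge_min lexx orbT.
  by rewrite ler_pdivlMr// /t; lra.
have ct : cabs (t%:C : C) = t by rewrite cabs_real gtr0_norm.
pose y' := y + (t%:C : C) *: (v - f y).
have yy : nm (y' - y) = t * r by rewrite /y' addrC addKr nmZ ct nmBC.
have y'd : nm (y' - u) <= d by apply: le_trans (nm_tri _ y _) _; lra.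
have := ymin y' (mem_set y'd); rewrite leNgt => /negP[].
have -> : f y' - v = ((1 - t)%:C : C) *: (f y - v) + ((f y' - y') - (f y - y)).
  by apply/rowP => j; rewrite /y' rmorphB !mxE; ring.
apply: le_lt_trans (nmD _ _) _; rewrite nmZ cabs_real ger0_norm; last by lra.
have := H y' y (w2 _ y'd) (w2 _ yd); rewrite yy -/r; nra.
Qed.

End InverseFunction.

Section InverseFunctionTheorem.
Variables (R : realType) (n : nat).
Local Notation C := (R[i]^o).
Local Notation V := (Cvec R n).
Implicit Types (x y u v h : V) (f g : V -> V).

(** One [K] serves for all base points near [u]: the remainder is bounded by [cauchy2], and the
    variation of the Jacobian by [cauchy1] applied to directional derivatives. *)
Lemma taylor2 f u : (\forall y \near u, differentiable f y) ->
  exists s K : R, [/\ 0 < s, 0 < K,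
    forall y, nm (y - u) < s -> differentiable f y,
    forall y h, nm (y - u) < s -> nm h < s ->
      nm (f (y + h) - f y - h *m jac f y) <= K * nm h ^+ 2
    & forall y h, nm (y - u) < s ->
      nm (h *m jac f y - h *m jac f u) <= K * nm (y - u) * nm h].
Proof.
move=> /nbhs_nm[s1 s10 df].
have dfu : differentiable f u by apply: df; rewrite subrr nm0.
have [M [s2 s20 fM]] := locally_bounded (diff_cont dfu).
pose s := Num.min s1 s2 / 2.
have s0 : 0 < s by rewrite divr_gt0// lt_min s10.
have ss1 : 2 * s <= s1 by rewrite /s mulrC mulfVK// ge_min lexx.
have ss2 : 2 * s <= s2 by rewrite /s mulrC mulfVK// ge_min lexx orbT.
have M0 : 0 <= M by apply: le_trans (nm_ge0 (f u)) (fM _ _); rewrite subrr nm0.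
have in2 y z : nm (y - u) < s -> nm (z - y) < s -> nm (z - u) < 2 * s.
  by move=> yu zy; have := nm_tri z y u; move: yu zy; move: (nm _) (nm _) (nm _) => a b c; lra.
have dj j y : nm (y - u) < 2 * s -> differentiable (fun y => f y 0 j : C) y.
  by move=> ys; apply: dif_col; apply: df; exact: lt_le_trans ss1.
have Mj j y : nm (y - u) < 2 * s -> cabs (f y 0 j) <= M.
  move=> ys; apply: le_trans (cabs_coord _ _) _; apply: fM.
  exact: lt_le_trans ss2.
pose K1 := 8 * M / s ^+ 2; pose K2 := 2 * (2 * M / s) / s.
have K10 : 0 <= K1 by rewrite divr_ge0 ?sqr_ge0// mulr_ge0.
have K20 : 0 <= K2.
  exact: divr_ge0 (mulr_ge0 _ (divr_ge0 (mulr_ge0 _ M0) (ltW s0))) (ltW s0).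
exists s, (K1 + K2 + 1); split; [exact: s0| | | |].
- by rewrite ltr_wpDl// addr_ge0.
- move=> y ys; apply: df; apply: lt_le_trans ss1; move: (nm _) ys => a; lra.
- move=> y h ys hs; apply: (@le_trans _ _ (K1 * nm h ^+ 2)); last first.
    by rewrite ler_wpM2r ?sqr_ge0//; lra.
  apply: nm_le; first by rewrite mulr_ge0// sqr_ge0.
  move=> j; have := @cauchy2 _ V (fun y => f y 0 j : C) y s M.
  have -> : (f (y + h) - f y - h *m jac f y) 0 j =
      f (y + h) 0 j - f y 0 j - 'd (fun y => f y 0 j : C) y h.
    by rewrite -mul_jac !mxE.
  apply; [| |exact: hs] => z zy.
    exact: (dj j z (in2 y z ys zy)).
  exact: (Mj j z (in2 y z ys zy)).
- move=> y h ys; apply: (@le_trans _ _ (K2 * nm (y - u) * nm h)); last first.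
    by rewrite ler_wpM2r ?nm_ge0// ler_wpM2r ?nm_ge0//; lra.
  apply: nm_le; first exact: mulr_ge0 (mulr_ge0 K20 (nm_ge0 _)) (nm_ge0 _).
  move=> j; have mxB (a b : V) : (a - b) 0 j = a 0 j - b 0 j by rewrite !mxE.
  have [D DE] : exists D : V -> C, D = fun y => 'd (fun y => f y 0 j : C) y h by eexists.
  have JD y' : (h *m jac f y') 0 j = D y' by rewrite DE; exact: mul_jac.
  have dD z : nm (z - u) < s -> differentiable D z.
    move=> zs; rewrite DE; apply: differentiable_diff; apply/nbhs_nm; exists s; first exact: s0.
    move=> z' z's; exact: (dj j z' (in2 z z' zs z's)).
  have bD z : nm (z - u) < s -> cabs (D z) <= 2 * M / s * nm h.
    move=> zs; rewrite DE; apply: cauchy_diff; first exact: s0.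
      move=> z' z's; exact: (dj j z' (in2 z z' zs z's)).
    move=> z' z's; exact: (Mj j z' (in2 z z' zs z's)).
  have C1 := cauchy1 dD bD ys; have uy : u + (y - u) = y by rewrite addrC subrK.
  rewrite uy in C1.
  move: (JD y) (JD u); move: (jac f y) (jac f u) => A B JA JB.
  rewrite mxB JA JB; apply: le_trans C1 _.
  by have -> : K2 * nm (y - u) * nm h = 2 * (2 * M / s * nm h) / s * nm (y - u) by rewrite /K2; ring.
Qed.

Lemma inverse_function f u : (\forall y \near u, differentiable f y) ->
  jac f u \in unitmx ->
  exists d c : R, [/\ 0 < d, 0 < c,
    forall x y, nm (x - u) < d -> nm (y - u) < d ->
      nm (x - y) <= c * nm (f x - f y)
    & forall e : R, 0 < e -> exists2 e' : R, 0 < e' &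
      forall v, nm (v - f u) < e' -> exists2 y, nm (y - u) < e & f y = v].
Proof.
move=> /taylor2[s [K [s0 K0 _ T1 T2]]] Lu.
have [k k0 kL] := mul_bound (invmx (jac f u)).
(* After normalising by [invmx (jac f u)], the Taylor error and the drift of the Jacobian are at
   most [K * (4 * d)] and [K * (2 * d)] times [nm h]. Since [16 * d * (k * K) <= 1], their total
   factor [6 * d * (k * K)] is below one half. *)
pose d := Num.min s (s / (16 * (k * (K * s)))) / 4.
have kK0 : 0 < 16 * (k * (K * s)) by rewrite !mulr_gt0.
have m0 : 0 < Num.min s (s / (16 * (k * (K * s)))) by rewrite lt_min s0 divr_gt0.
have d0 : 0 < d by rewrite divr_gt0.
have d1 : 4 * d <= s.
  have : Num.min s (s / (16 * (k * (K * s)))) <= s by rewrite ge_min lexx.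
  by rewrite /d; lra.
have d2 : 16 * d * (k * K) <= 1.
  have : Num.min s (s / (16 * (k * (K * s)))) <= s / (16 * (k * (K * s))) by rewrite ge_min lexx orbT.
  rewrite ler_pdivlMr// => h.
  have : s * (16 * (4 * d) * (k * K)) <= s * 1 by move: h; rewrite /d; lra.
  by rewrite ler_pM2l//; lra.
pose F y := f y *m invmx (jac f u).
have lip e x y : e <= d -> nm (x - u) < 2 * e -> nm (y - u) < 2 * e ->
    nm ((F x - x) - (F y - y)) <= 2^-1 * nm (x - y).
  move=> ed xu yu; pose h := x - y.
  have hn : nm h <= 4 * d.
    have := nm_tri x u y; rewrite [nm (u - y)]nmBC -/h; move: xu yu.
    by move: (nm _) (nm _) (nm _) => a b c; lra.
  have yus : nm (y - u) < s by move: yu; move: (nm _) => a; lra.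
  have hs : nm h < s by move: xu yu d1 ed hn (nm_tri x u y); rewrite [nm (u - y)]nmBC -/h; move: (nm _) (nm _) (nm _) => a b c; lra.
  have xE : x = y + h by rewrite /h addrC subrK.
  have -> : (F x - x) - (F y - y) = (f (y + h) - f y - h *m jac f y) *m invmx (jac f u) +
     (h *m jac f y - h *m jac f u) *m invmx (jac f u).
    rewrite -mulmxDl addrA subrK mulmxBl [h *m _ *m _]mulmxK// -xE mulmxBl /F /h.
    by apply/rowP => j; rewrite !mxE; ring.
  apply: le_trans (nmD _ _) _; apply: le_trans (lerD (kL _) (kL _)) _.
  have n0 := nm_ge0 h; have y2 : nm (y - u) <= 2 * d.
    by apply/ltW; apply: lt_le_trans yu _; rewrite ler_pM2l.
  rewrite -/h; have t1 := T1 y h yus hs; have t2 := T2 y h yus.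
  move: t1 t2; move: (jac f y) (jac f u) => A B.
  move: (f (y + h) - f y - h *m A) (h *m A - h *m B) n0 hn y2 => a' b'.
  move: (nm a') (nm b') (nm h) (nm (y - u)) => a b c c' n0 hn y2 t1 t2.
  have q1 : K * c ^+ 2 <= K * (4 * d) * c.
    by rewrite expr2 mulrA ler_wpM2r// ler_pM2l.
  have q2 : K * c' * c <= K * (2 * d) * c by rewrite ler_wpM2r// ler_pM2l.
  have q3 : k * a + k * b <= k * (K * (6 * d) * c) by rewrite -mulrDr ler_pM2l//; lra.
  have q4 : 16 * d * (k * K) * c <= 1 * c by rewrite ler_wpM2r.
  have q5 : 0 <= k * K * d * c by rewrite !mulr_ge0// ltW.
  lra.
have [inj _] := perturbed_id d0 (fun x y => @lip d x y (lexx d)).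
exists d, (2 * k); split=> //; first by rewrite mulr_gt0.
- move=> x y xu yu; apply: le_trans (inj x y _ _) _.
  + by move: xu; move: (nm _) => a; lra.
  + by move: yu; move: (nm _) => a; lra.
  + by rewrite -mulrA ler_pM2l// /F -mulmxBl.
move=> e e0; pose e1 := Num.min e d; have e10 : 0 < e1 by rewrite lt_min e0.
have e1d : e1 <= d by rewrite ge_min lexx orbT.
have e1e : e1 <= e by rewrite ge_min lexx.
have [_ sur] := perturbed_id e10 (fun x y => @lip e1 x y e1d).
exists (e1 / (4 * k)); first by rewrite divr_gt0// mulr_gt0.
move=> v vu; have [|y yu Fy] := sur (v *m invmx (jac f u)).
  rewrite /F -mulmxBl; apply: le_lt_trans (kL _) _.
  by move: vu; rewrite ltr_pdivlMr ?mulr_gt0//; move: (nm _) => a; lra.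
exists y; first exact: lt_le_trans e1e.
by rewrite -(mulmxKV Lu (f y)) -/(F y) Fy mulmxKV.
Qed.

(** Solve the expansion of [f] for the increment [h] of [g]; the Lipschitz bound turns an error
    small against [h] into one small against [q]. *)
Lemma inverse_jac f g x (A : 'M[C]_n) (c : R) : A \in unitmx -> jac_at f x A ->
  g (f x) = x -> (\forall v \near f x, f (g v) = v /\ nm (g v - x) <= c * nm (v - f x)) ->
  jac_at g (f x) (invmx A).
Proof.
move=> uA fA gfx /nbhs_nm[d d0 H] e e0.
have [k k0 kA] := mul_bound (invmx A).
have c1 : 0 < `|c| + 1 by rewrite ltr_wpDl.
have [|d1 d10 H1] := fA (e / (k * (`|c| + 1))); first by rewrite divr_gt0// mulr_gt0.
exists (Num.min d (d1 / (`|c| + 1))); first by rewrite lt_min d0 divr_gt0.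
move=> q; rewrite lt_min ltr_pdivlMr// => /andP[qd qd1].
have [|fg gc] := H (f x + q); first by rewrite addrC addKr.
rewrite [f x + q - f x]addrC addKr in gc.
pose h := g (f x + q) - x.
have hc : nm h <= (`|c| + 1) * nm q.
  by apply: le_trans gc _; rewrite ler_wpM2r ?nm_ge0// ler_wpDr// ler_norm.
have xh : x + h = g (f x + q) by rewrite /h addrC subrK.
have hd1 : nm h < d1 by apply: le_lt_trans hc _; rewrite mulrC.
have := H1 h hd1; rewrite xh fg.
have -> : f x + q - f x = q by rewrite addrC addKr.
move=> b.
have -> : g (f x + q) - g (f x) - q *m invmx A = - ((q - h *m A) *m invmx A).
  by rewrite gfx -/h mulmxBl mulmxK// opprB.
rewrite nmN; apply: le_trans (kA _) _.
apply: (@le_trans _ _ (k * (e / (k * (`|c| + 1)) * nm h))); first by rewrite ler_pM2l.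
have -> : e * nm q = k * (e / (k * (`|c| + 1)) * ((`|c| + 1) * nm q)).
  by field; rewrite !gt_eqF.
by rewrite ler_pM2l// ler_pM2l// divr_gt0// mulr_gt0.
Qed.

Definition jdet f x : C := \det (jac f x).

Lemma dif_jac f x i j : (\forall y \near x, differentiable f y) ->
  differentiable (fun y => jac f y i j : C) x.
Proof.
move=> df; have -> : (fun y => jac f y i j : C) =
    (fun y => 'd (fun y => f y 0 j : C) y (delta_mx 0 i : V)).
  by apply/funext => y; rewrite mxE.
by apply: differentiable_diff; apply: filterS df => y; exact: dif_col.
Qed.

Lemma dif_jdet f x : (\forall y \near x, differentiable f y) ->
  differentiable (jdet f) x.
Proof.
move=> df; apply: dif_bigsum => s _; apply: dif_mul; first exact: dif_cst.
by apply: dif_bigprod => i _; exact: dif_jac.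
Qed.

Lemma det_le (A : 'M[C]_n) (a : R) : (forall i j, cabs (A i j) <= a) ->
  cabs (\det A) <= n`!%:R * a ^+ n.
Proof.
move=> Aa; rewrite /determinant.
have sum_le (F : 'S_n -> C) : cabs (\sum_(s : 'S_n) F s) <= \sum_(s : 'S_n) cabs (F s).
  elim/big_ind2 : _ => [|x1 x2 y1 y2 h1 h2|//]; first by rewrite cabs0.
  by apply: le_trans (cabsD _ _) _; exact: lerD.
apply: le_trans (sum_le _) _.
apply: (@le_trans _ _ (\sum_(s : 'S_n) a ^+ n)).
  apply: ler_sum => s _; rewrite cabsM.
  have -> : cabs ((-1) ^+ s : C) = 1 by rewrite cabsX cabsN cabs1 expr1n.
  rewrite mul1r.
  have -> : a ^+ n = \prod_(i < n) a by rewrite prodr_const card_ord.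
  elim/big_ind2 : _ => [|x1 x2 y1 y2 h1 h2|i _]; last exact: Aa.
    by rewrite cabs1.
  rewrite cabsM ler_pM ?cabs_ge0//.
by rewrite sumr_const card_Sn -[leLHS]mulr_natl.
Qed.

End InverseFunctionTheorem.

(** * Osgood's theorem *)

Section Osgood.
Variables (R : realType) (n : nat).
Local Notation C := (R[i]^o).
Local Notation V := (Cvec R n).
Implicit Types (x y u v h : V) (f g : V -> V) (W : set V).

Lemma jac_at_lin f u (A P Q : 'M[C]_n) : jac_at f u A ->
  jac_at (fun y => f y *m P + y *m Q) u (A *m P + Q).
Proof.
move=> fA e e0; have [p p0 pP] := mul_bound P.
have [d d0 H] := fA _ (divr_gt0 e0 p0).
exists d => // h /H fh.
have -> : f (u + h) *m P + (u + h) *m Q - (f u *m P + u *m Q) - h *m (A *m P + Q) =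
    (f (u + h) - f u - h *m A) *m P.
  rewrite mulmxDr mulmxDl !mulmxBl mulmxA.
  move: (h *m A *m P) (f _ *m P) (f _ *m P) (h *m Q) (u *m Q) => ? ? ? ? ?.
  by apply/rowP => j; rewrite !mxE; ring.
apply: le_trans (pP _) _.
have -> : e * nm h = p * (e / p * nm h) by field; rewrite gt_eqF.
by rewrite ler_pM2l.
Qed.

Lemma jac_at_comp f g x (A B : 'M[C]_n) : jac_at g x A -> jac_at f (g x) B ->
  jac_at (fun y => f (g y)) x (A *m B).
Proof.
move=> gA fB e e0.
have [a a0 aA] := mul_bound A; have [b b0 bB] := mul_bound B.
have c0 : 0 < a + 1 by rewrite addr_gt0.
have [|d1 d10 H1] := fB (e / 2 / (a + 1)); first by rewrite !divr_gt0.
have e1 : 0 < Num.min 1 (e / 2 / b) by rewrite lt_min ltr01 !divr_gt0.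
have [d2 d20 H2] := gA _ e1.
exists (Num.min d2 (d1 / (a + 1))); first by rewrite lt_min d20 divr_gt0.
move=> h; rewrite lt_min => /andP[/H2 hA]; rewrite ltr_pdivlMr// => hd.
have [k kE] : exists k : V, k = g (x + h) - g x by eexists.
have gx : g x + k = g (x + h) by rewrite kE addrC subrK.
rewrite -kE in hA.
have n0 := nm_ge0 h.
have hk : nm (k - h *m A) <= nm h.
  by apply: le_trans hA _; rewrite ler_piMl// ge_min lexx.
have hk2 : nm (k - h *m A) <= e / 2 / b * nm h.
  by apply: le_trans hA _; rewrite ler_wpM2r// ge_min lexx orbT.
have kn : nm k <= (a + 1) * nm h.
  by apply: le_trans (nm_leD k (h *m A)) _; have := aA h; move: hk; move: (nm _) (nm _) (nm _) => t1 t2 t3; lra.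
have /H1 kB : nm k < d1 by apply: le_lt_trans kn _; rewrite mulrC.
rewrite gx in kB.
have -> : f (g (x + h)) - f (g x) - h *m (A *m B) =
    (f (g (x + h)) - f (g x) - k *m B) + (k - h *m A) *m B.
  rewrite mulmxBl mulmxA; move: (k *m B) (h *m A *m B) (f _) (f _) => a' b' c' d'.
  by apply/rowP => j; rewrite !mxE; ring.
apply: le_trans (nmD _ _) _; apply: (@le_trans _ _ (e / 2 / (a + 1) * ((a + 1) * nm h) + b * (e / 2 / b * nm h))).
  apply: lerD; first by apply: le_trans kB _; rewrite ler_pM2l// !divr_gt0.
  by apply: le_trans (bB _) _; rewrite ler_pM2l.
rewrite le_eqVlt; apply/orP; left; apply/eqP.
by field; rewrite !gt_eqF.
Qed.

(** Invertibility of the Jacobian is kept at every nearby preimage, so that the inverse can be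
    differentiated on a whole neighbourhood and not at one point. *)
Lemma local_inverse f u (d : R) : 0 < d -> (\forall y \near u, differentiable f y) ->
  jac f u \in unitmx -> exists (g : V -> V) (e : R), 0 < e /\
  forall v, nm (v - f u) < e -> [/\ nm (g v - u) < d, f (g v) = v,
    jac f (g v) \in unitmx & jac_at g v (invmx (jac f (g v)))].
Proof.
move=> d0 df uf; have cj := diff_cont (dif_jdet df).
have [s s0 sj] : exists2 s : R, 0 < s & forall y, nm (y - u) < s -> jac f y \in unitmx.
  have j0 : 0 < cabs (jdet f u) by rewrite cabs_gt0; move: uf; rewrite unitmxE unitfE.
  have [s s0 H] := (cont_nm (jdet f) u).1 cj _ j0; exists s; first exact: s0.
  move=> y /H.
  rewrite nmE unitmxE unitfE -cabs_gt0 -/(jdet f y).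
  move: (jdet f u) (jdet f y) => a b ab; have := cabs_leD a b.
  by rewrite cabsBC; move: ab; move: (cabs _) (cabs _) (cabs _) => *; lra.
have [d1 [c [d10 c0 inj sur]]] := inverse_function df uf.
have /nbhs_nm[s2 s20 df'] := df.
pose d' := Num.min (Num.min d s) (Num.min d1 s2).
have d'0 : 0 < d' by rewrite !lt_min d0 s0 d10 s20.
have [e e0 H] := sur _ d'0.
pose g v := xget u [set y | nm (y - u) < d' /\ f y = v].
have gP v : nm (v - f u) < e -> nm (g v - u) < d' /\ f (g v) = v.
  by move=> /H[y yd fy]; rewrite /g; case: xgetP => [y' _ //|/(_ y)[]].
exists g, e; split; first exact: e0.
move=> v ve; have [gd fg] := gP _ ve.
have := gd; rewrite !lt_min => /andP[/andP[gd1 gd2] /andP[gd3 gd4]].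
have ug := sj _ gd2.
split; [exact: gd1|exact: fg|exact: ug|].
have dfg := df' _ gd4.
rewrite -[X in jac_at _ X]fg; apply: (inverse_jac (c := c) ug (jacP dfg)).
  by rewrite fg.
apply/nbhs_nm; exists (e - nm (v - f u)); first by rewrite subr_gt0.
rewrite fg => w wv; have we : nm (w - f u) < e.
  by have := nm_tri w v (f u); move: wv; move: (nm _) (nm _) (nm _) => t1 t2 t3; lra.
have [gd' fg'] := gP _ we; split; first exact: fg'.
rewrite -[w in leRHS]fg' -[v in leRHS]fg; apply: inj; last exact: gd3.
by move: gd'; rewrite !lt_min => /andP[_ /andP[]].
Qed.

(** As [J] is invertible, [N *m pid_mx r] has rank [r], no less than that of [N]; hence the row
    space of [N] meets the kernel of the projection only in [0]. *)
Lemma rank_mul_pid (N J : 'M[C]_n) (k : 'rV[C]_n) r : (r <= n)%N ->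
  (mxrank N <= r)%N -> J \in unitmx -> J *m (pid_mx r : 'M[C]_n) = N *m (pid_mx r : 'M[C]_n) ->
  k *m N *m (pid_mx r : 'M[C]_n) = 0 -> k *m N = 0.
Proof.
move=> rn Nr uJ JN kN; have := mxrank_mul_ker N (pid_mx r : 'M[C]_n).
rewrite -JN eqmxMfull ?row_full_unit// rank_pid_mx// => E.
have /eqP : mxrank (N :&: kermx (pid_mx r : 'M[C]_n))%MS = 0%N.
  by apply/eqP; rewrite -leqn0 -(leq_add2l r) addn0 E.
rewrite mxrank_eq0 => /eqP N0; apply/eqP; rewrite -submx0 -N0 sub_capmx submxMl.
exact/sub_kermxP.
Qed.

(** Along the direction [e] the first-order terms vanish, so the increments are quadratic and
    [cst_of_quadratic] applies. *)
Lemma diff_zero_cst (F : V -> V) v e (s : R) : 0 < s ->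
  (forall y, nm (y - v) < s -> differentiable F y /\ e *m jac F y = 0) ->
  exists2 t : R, 0 < t & nm ((t%:C : C) *: e) < s /\ F (v + (t%:C : C) *: e) = F v.
Proof.
move=> s0 HF; have dF : differentiable F v by have [] := HF v; rewrite ?subrr ?nm0.
have [M [s1 s10 FM]] := locally_bounded (diff_cont dF).
pose s2 := Num.min s s1 / 2.
have m0 : 0 < Num.min s s1 by rewrite lt_min s0.
have s20 : 0 < s2 by rewrite divr_gt0.
have e1 : 0 < nm e + 1 by rewrite ltr_wpDl// nm_ge0.
have ms : Num.min s s1 <= s by rewrite ge_min lexx.
have ms1 : Num.min s s1 <= s1 by rewrite ge_min lexx orbT.
have s2E : 2 * s2 = Num.min s s1 by rewrite /s2; field.
have M0 : 0 <= M by apply: le_trans (nm_ge0 (F v)) (FM _ _); rewrite subrr nm0.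
pose t := s2 / (nm e + 1); have t0 : 0 < t by rewrite divr_gt0.
have tE : t * nm e < s2.
  by rewrite /t -mulrA gtr_pMr// mulrC ltr_pdivrMr// mul1r ltrDl.
have ne0 := nm_ge0 e.
have te (x : R) : 0 <= x -> x <= t -> nm ((x%:C : C) *: e) < s2.
  move=> x0 xt; rewrite nmZ cabs_real ger0_norm//.
  by apply: le_lt_trans tE; rewrite ler_wpM2r.
have s2s : s2 < s by lra.
exists t => //; split; first by apply: lt_trans s2s; apply: te; rewrite // ltW.
apply/rowP => j.
have FE : F v = F (v + (0%:C : C) *: e) by rewrite scale0r addr0.
rewrite [in RHS]FE; apply/esym.
apply: (@cst_of_quadratic _ (fun x : R => F (v + (x%:C : C) *: e) 0 j) 0 t
   (8 * M / s2 ^+ 2 * nm e ^+ 2)).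
- exact: ltW.
- by rewrite mulr_ge0 ?sqr_ge0// divr_ge0 ?sqr_ge0// mulr_ge0.
move=> a b a0 ab bt; rewrite cabsBC.
have at_ : a <= t by exact: le_trans bt.
have b0 : 0 <= b by exact: le_trans ab.
pose y := v + (a%:C : C) *: e; pose h := ((b - a)%:C : C) *: e.
have yh : v + (b%:C : C) *: e = y + h.
  rewrite /y /h rmorphB scalerBl; move: (_ *: e) (_ *: e) => p q.
  by apply/rowP => j'; rewrite !mxE; ring.
have hs : nm h < s2 by apply: te; lra.
have yv : nm (y - v) < s2 by rewrite /y addrC addKr; exact: te.
have zs z : nm (z - y) < s2 -> nm (z - v) < Num.min s s1.
  by move=> zy; rewrite -s2E; have := nm_tri z y v; move: zy yv; move: (nm _) (nm _) (nm _) => t1 t2 t3; lra.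
have zs1 z : nm (z - y) < s2 -> nm (z - v) < s1 by move=> /zs h'; exact: lt_le_trans ms1.
have zss z : nm (z - y) < s2 -> nm (z - v) < s by move=> /zs h'; exact: lt_le_trans ms.
have [|_ y0] := HF y; first by exact: lt_trans s2s.
have L0 : 'd (fun z => F z 0 j : C) y h = 0.
  by rewrite -mul_jac /h -scalemxAl y0 scaler0 mxE.
have C2 := @cauchy2 _ V (fun z => F z 0 j : C) y s2 M _ _ h hs.
rewrite L0 subr0 -yh in C2; apply: le_trans (C2 _ _) _.
- by move=> z zy; apply: dif_col; have [] := HF z (zss z zy).
- by move=> z zy; apply: le_trans (cabs_coord _ _) _; exact: FM (zs1 z zy).
rewrite /h nmZ cabs_real ger0_norm; last by rewrite subr_ge0.
rewrite le_eqVlt; apply/orP; left; apply/eqP.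
by move: (8 * M / s2 ^+ 2) (nm e) => p q; ring.
Qed.

(* At a point of maximal rank [r < n] some line is contracted by [f] in
   suitable coordinates, as in the constant rank theorem. *)
Lemma injective_jac f W u : open W -> W u -> (forall y, W y -> differentiable f y) ->
  (forall x y, W x -> W y -> f x = f y -> x = y) ->
  exists2 x, W x & jac f x \in unitmx.
Proof.
move=> oW Wu df inj.
have [||r /asboolP[u1 W1 r1] rmax] := @ex_maxnP (fun r => `[< exists2 x, W x & mxrank (jac f x) = r >]) n.
- by exists (mxrank (jac f u)); apply/asboolP; exists u.
- by move=> r /asboolP[x _ <-]; exact: rank_leq_row.
have rn : (r <= n)%N by rewrite -r1 rank_leq_row.
have [rE|rn'] := eqVneq r n.
  by exists u1 => //; rewrite -row_free_unit /row_free r1 rE.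
have {rn'}rn' : (r < n)%N by rewrite ltn_neqAle rn' rn.
pose A := jac f u1; pose pr : 'M[C]_n := pid_mx r.
(* [Phi] takes [r] components of [f], in coordinates adapted to [A], and completes them by linear
   functions; its Jacobian at [u1] is [col_ebase A]. As ranks do not exceed [r], these components
   control the whole differential of [f] ([rank_mul_pid]), so the basis vector [e] which [pid_mx r]
   kills is killed by the differential of [f] after the inverse of [Phi]. *)
pose P := invmx (row_ebase A) *m pr; pose Q := col_ebase A *m (copid_mx r : 'M[C]_n).
pose Phi y := f y *m P + y *m Q.
have jPhi y : W y -> jac_at Phi y (jac f y *m P + Q) by move=> /df /jacP; exact: jac_at_lin.
have jE y : W y -> jac Phi y = jac f y *m P + Q by move=> /jPhi /jac_unique.
have prpr : pr *m pr = pr by exact: pid_mx_id.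
have Qpr : Q *m pr = 0 by rewrite /Q -mulmxA mul_copid_mx_pid// mulmx0.
have uL : jac Phi u1 \in unitmx.
  rewrite jE// -/A -{1}(mulmx_ebase A) r1 /P !mulmxA mulmxK ?row_ebase_unit//.
  by rewrite -mulmxA prpr /Q -mulmxDr /copid_mx addrC subrK mulmx1 col_ebase_unit.
have dPhi : \forall y \near u1, differentiable Phi y.
  have : nbhs u1 W by exact: open_nbhs_nbhs.
  by apply: filterS => y /jPhi /jac_at_diff.
have /nbhs_nm[d d0 dW] : nbhs u1 W by exact: open_nbhs_nbhs.
have [g [s [s0 Hg]]] := local_inverse d0 dPhi uL.
pose e : 'rV[C]_n := delta_mx 0 (Ordinal rn').
have epr : e *m pr = 0.
  by rewrite -rowE; apply/rowP => j; rewrite !mxE /= ltnn andbF.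
have e0 : e != 0.
  apply/eqP => /rowP /(_ (Ordinal rn')); rewrite !mxE !eqxx /= => /eqP.
  by rewrite oner_eq0.
have HF y : nm (y - Phi u1) < s ->
    differentiable (fun z => f (g z)) y /\ e *m jac (fun z => f (g z)) y = 0.
  move=> ys; have [/dW Wg _ ug jg] := Hg y ys.
  have jF := jac_at_comp jg (jacP (df _ Wg)).
  split; first exact: jac_at_diff jF.
  rewrite (jac_unique jF) mulmxA.
  pose k := e *m invmx (jac Phi (g y)); rewrite -/k.
  have kJ : k *m jac Phi (g y) = e by rewrite /k mulmxKV.
  pose N := jac f (g y) *m invmx (row_ebase A).
  have JE : jac Phi (g y) *m pr = N *m pr.
    by rewrite jE// mulmxDl Qpr addr0 /P mulmxA -mulmxA prpr.
  have NE : jac f (g y) = N *m row_ebase A by rewrite /N mulmxKV ?row_ebase_unit.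
  rewrite [X in k *m X]NE mulmxA (@rank_mul_pid N (jac Phi (g y)) k r) ?mul0mx//.
    rewrite /N mxrankMfree ?row_free_unit ?unitmx_inv ?row_ebase_unit//.
    by apply: rmax; apply/asboolP; exists (g y).
  by rewrite -mulmxA -JE mulmxA kJ.
have [t t0 [ts Ft]] := diff_zero_cst s0 HF.
have [|/dW W2 E2 _ _] := Hg (Phi u1 + (t%:C : C) *: e); first by rewrite addrC addKr.
have [|/dW W3 E3 _ _] := Hg (Phi u1); first by rewrite subrr nm0.
have := inj _ _ W2 W3 Ft => gE; move: E2; rewrite gE E3 => /eqP.
rewrite -subr_eq0 opprD addNKr oppr_eq0 scaler_eq0 (negbTE e0) orbF -cabs_eq0 cabs_real.
by rewrite normr_eq0 gt_eqF.
Qed.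

End Osgood.

(** * Nonvanishing of the Jacobian of an injective map *)

Section OsgoodTheorem.
Variables (R : realType) (n : nat).
Local Notation C := (R[i]^o).
Local Notation V := (Cvec R n).
Implicit Types (u v : V) (f g : V -> V) (W : set V).

(** A factor holomorphic only where [h] does not vanish is admissible as long as it is bounded
    there: the product tends to [0] at the zeros of [h]. *)
Lemma rado_mul (U : normedModType R[i]) (p h : U -> C) (x : U) (M s : R) :
  rado h x -> (h x != 0 -> differentiable p x) -> 0 < s ->
  (forall y, nm (y - x) < s -> h y != 0 -> cabs (p y) <= M) ->
  rado (fun y => p y * h y) x.
Proof.
move=> [ch dh] dp s0 pM; have [h0|h0] := eqVneq (h x) 0; last first.
  by apply: rado_diff; apply: dif_mul; [exact: dp|exact: dh].
split; last by rewrite h0 mulr0 eqxx.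
apply/cont_nm => e e0; have e1 : 0 < e / (`|M| + 1) by rewrite divr_gt0// ltr_wpDl.
have [d d0 H] := (cont_nm h x).1 ch _ e1.
exists (Num.min d s); first by rewrite lt_min d0.
move=> y; rewrite lt_min h0 mulr0 subr0 => /andP[yd ys].
have [->|hy] := eqVneq (h y) 0; first by rewrite mulr0 nm0.
have := H y yd; rewrite h0 subr0 !nmE cabsM ltr_pdivlMr ?ltr_wpDl// => hy'.
apply: le_lt_trans hy'; rewrite mulrC ler_wpM2l ?cabs_ge0//.
by apply: le_trans (pM y ys hy) _; apply: le_trans (ler_norm M) _; rewrite lerDl.
Qed.

Lemma diff_le (p : V -> C) v (e : V) (A d : R) : differentiable p v -> 0 < d ->
  (forall t : C, t != 0 -> cabs t < d -> cabs (p (v + t *: e) - p v) <= A * cabs t) ->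
  cabs ('d p v e) <= A.
Proof.
move=> dp d0 H; apply/ler_addgt0Pr => e' e'0.
have e1 : 0 < nm e + 1 by rewrite ltr_wpDl// nm_ge0.
have [d1 d10 H1] := diff_eps dp (divr_gt0 e'0 e1).
pose t := Num.min d (d1 / (nm e + 1)) / 2.
have m0 : 0 < Num.min d (d1 / (nm e + 1)) by rewrite lt_min d0 divr_gt0.
have t0 : 0 < t by rewrite divr_gt0.
have tm : t < Num.min d (d1 / (nm e + 1)) by rewrite /t; lra.
move: tm; rewrite lt_min ltr_pdivlMr// => /andP[td td1].
have ct : cabs (t%:C : C) = t by rewrite cabs_real gtr0_norm.
have tn : t%:C != 0 :> C by rewrite -cabs_gt0 ct.
have := H t%:C tn; rewrite ct => /(_ td) h1.
have tE : nm ((t%:C : C) *: e) = t * nm e by rewrite nmZ ct.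
have := H1 ((t%:C : C) *: e); rewrite tE => h2.
have {}h2 := h2 (le_lt_trans (ler_wpM2l (ltW t0) (ltac:(lra) : nm e <= nm e + 1)) td1).
have L : 'd p v ((t%:C : C) *: e) = t%:C * 'd p v e by rewrite linearZ.
rewrite L in h2; move: ('d p v e) (p _ - p _) h1 h2 => D P h1 h2.
rewrite -(ler_pM2l t0) -[X in X * cabs D]ct -cabsM.
apply: le_trans (cabs_leD (t%:C * D) P) _; rewrite cabsBC.
have h3 : e' / (nm e + 1) * (t * nm e) <= t * e'.
  have -> : e' / (nm e + 1) * (t * nm e) = t * (e' * (nm e / (nm e + 1))).
    by field; rewrite gt_eqF.
  by rewrite ler_pM2l// ger_pMr// ler_pdivrMr// mul1r lerDl.
move: h1 h2 h3; rewrite nmE; move: (cabs P) (cabs _) (e' / _ * _) => *; lra.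
Qed.

Lemma compact_away (U U' : normedModType R[i]) (T : set U) (p : U -> U') (q : U') :
  compact T -> (forall x, T x -> {for x, continuous p}) ->
  (forall x, T x -> p x != q) ->
  exists2 e : R, 0 < e & forall x, T x -> e <= nm (p x - q).
Proof.
move=> cT cp pq; have [T0|/set0P Tn] := eqVneq T set0.
  by exists 1 => // x; rewrite T0.
have [|x /set_mem Tx xmin] := @compact_EVT_min _ _ (fun x => nm (p x - q)) T Tn cT.
  apply: continuous_in_subspaceT => x /set_mem Tx.
  apply: (@continuous_comp U U' R (fun y => p y - q) (@nm R U')); last exact: nm_continuous.
  by apply: (@continuousB _ U' U p (fun=> q)); [exact: cp|exact: cst_continuous].
exists (nm (p x - q)); first by rewrite nm_gt0 subr_eq0 pq.
by move=> y Ty; apply: xmin; exact/mem_set.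
Qed.

Section Fixed.
Variables (f g : V -> V) (W : set V) (u0 : V) (s : R).
Hypothesis oW : open W.
Hypothesis df : forall u, W u -> differentiable f u.
Hypothesis gf : forall u, W u -> g (f u) = u.
Hypothesis s0 : 0 < s.
Hypothesis sW : forall u, nm (u - u0) <= s -> W u.

Let K : set V := [set u : V | nm (u - u0) <= s].
(** The Jacobian of [f] transported to the image and extended by [0]. It vanishes exactly where the
    inverse function theorem gives no information about [g], which is what makes Rado's class the
    right one. *)
Let h v : C := if `[< exists2 u, K u & f u = v >] then jdet f (g v) else 0.

Lemma ext_f u : K u -> h (f u) = jdet f u.
Proof.
move=> Ku; rewrite /h asboolT ?gf//; first exact: sW.
by exists u.
Qed.

Lemma ext_neq0 v : h v != 0 -> exists2 u, K u & f u = v.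
Proof. by rewrite /h; case: asboolP => //; rewrite eqxx. Qed.

Lemma near_W u : W u -> \forall y \near u, differentiable f y.
Proof.
move=> Wu; have : nbhs u W by exact: open_nbhs_nbhs.
by apply: filterS => y; exact: df.
Qed.

Lemma inverse_local u (e : R) : W u -> jac f u \in unitmx -> 0 < e ->
  (\forall v \near f u, exists2 y, nm (y - u) < e & f y = v) /\
  jac_at g (f u) (invmx (jac f u)).
Proof.
move=> Wu uf e0; have /nbhs_nm[d d0 dW] : nbhs u W by exact: open_nbhs_nbhs.
have [m0 md me] : [/\ 0 < Num.min e d, Num.min e d <= d & Num.min e d <= e].
  by rewrite lt_min e0 d0 !ge_min !lexx orbT.
have [p [c [c0 Hp]]] := local_inverse m0 (near_W Wu) uf.
have pE v : nm (v - f u) < c -> p v = g v.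
  move=> vc; have [pd fp _ _] := Hp v vc.
  by rewrite -[in RHS]fp gf//; apply: dW; exact: lt_le_trans md.
split.
  apply/nbhs_nm; exists c; first exact: c0.
  move=> v /Hp[pd fp _ _]; exists (p v); last exact: fp.
  exact: lt_le_trans me.
have fu : nm (f u - f u) < c by rewrite subrr nm0.
have pu : p (f u) = u by rewrite (pE _ fu) (gf Wu).
have [_ _ _] := Hp (f u) fu; rewrite pu => jp e' e'0.
have [d' d'0 H] := jp e' e'0; exists (Num.min d' c); first by rewrite lt_min d'0.
move=> k; rewrite lt_min => /andP[/H kd kc]; move: kd.
by rewrite (pE _ fu) pE// addrC addKr.
Qed.

(** Off the compact image of [K] the function is locally [0]. At the image of a regular point the
    inverse function theorem makes it holomorphic. At the image of a critical point only continuity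
    is asked: by compactness, values near [v] come from points near its preimage, where the Jacobian
    is small. *)
Lemma rado_ext v : (forall u, nm (u - u0) = s -> f u != v) -> rado h v.
Proof.
move=> vS; have cK : compact K by exact: compact_nm_ball.
have cf u : K u -> {for u, continuous f}.
  by move=> /sW /df; exact: diff_cont.
have [[u Ku uv]|nv] := pselect (exists2 u, K u & f u = v); last first.
  have [u Ku|e e0 He] := @compact_away _ _ K f v cK cf.
    by apply/eqP => uv; apply: nv; exists u.
  apply: rado_diff; apply: (@dif_near _ _ _ (fun=> 0)); last exact: dif_cst.
  apply/nbhs_nm; exists e; first exact: e0.
  move=> y yv; apply/eqP; rewrite eq_sym; apply: contraTT yv => /ext_neq0[u Ku <-].
  by rewrite -leNgt; exact: He.
have us : nm (u - u0) < s.
  by rewrite lt_neqAle Ku andbT; apply/eqP => /vS; rewrite uv eqxx.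
have Wu := sW Ku; have dj : differentiable (jdet f) u by apply: dif_jdet; exact: near_W.
have [j0|j0] := eqVneq (jdet f u) 0; last first.
  have uf : jac f u \in unitmx by rewrite unitmxE unitfE.
  have e0 : 0 < s - nm (u - u0) by rewrite subr_gt0.
  have [fn jg] := inverse_local Wu uf e0.
  rewrite -uv; apply: rado_diff; apply: (@dif_near _ _ _ (fun y => jdet f (g y))).
    apply: filterS fn => y [y' y'u <-].
    have Ky' : K y'.
      by apply: (le_trans (nm_tri _ u _)); move: y'u; move: (nm _) (nm _) => *; lra.
    by rewrite (ext_f Ky') (gf (sW Ky')).
  apply: (@dif_comp _ V V C g (jdet f)); first exact: jac_at_diff jg.
  by rewrite (gf Wu).
have h0 : h v = 0 by rewrite -uv (ext_f Ku).
split; last by move=> /eqP /(_ h0) [].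
apply/cont_nm => e e0; have [d d0 Hd] := (cont_nm (jdet f) u).1 (diff_cont dj) e e0.
have cT : compact (K `&` [set y | d <= nm (y - u)]).
  apply: compact_closedI; first exact: cK.
  have -> : [set y : V | d <= nm (y - u)] = ~` [set y | nm (y - u) < d].
    by apply/seteqP; split=> y /=; rewrite leNgt => /negP.
  by apply: open_closedC; exact: open_nm_ball.
have [y [/cf]//|y [Ky /= dy]|e' e'0 He'] := @compact_away _ _ _ f v cT.
  apply/eqP => yv; move: dy; rewrite -(gf (sW Ky)) yv -uv gf// subrr nm0 leNgt.
  by rewrite d0.
exists e'; first exact: e'0.
move=> y yv; rewrite h0 subr0.
have [->|/ext_neq0[y' Ky' y'y]] := eqVneq (h y) 0; first by rewrite nm0.
rewrite -y'y (ext_f Ky'); have := Hd y'; rewrite j0 subr0; apply.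
rewrite ltNge; apply/negP => dy'; move: yv; rewrite -y'y ltNge.
by rewrite He'.
Qed.

Variable d : R.
Hypothesis d0 : 0 < d.
Hypothesis dS : forall u, nm (u - u0) = s -> d <= nm (f u - f u0).

(* For [q] the difference quotient of [g] at [f u] in the direction [e], the
   maximum principle for [t * q t ^+ m * h (f u + t *: e)] bounds [q] by its
   values on the circle as [m] grows. *)
Lemma inverse_entry u k j : K u -> nm (f u - f u0) < d / 2 -> jac f u \in unitmx ->
  cabs (invmx (jac f u) k j) <= 2 * s / (d / 4).
Proof.
move=> Ku fu uf; have Wu := sW Ku.
pose v := f u; pose e : V := delta_mx 0 k; pose tau := d / 4.
have tau0 : 0 < tau by rewrite divr_gt0.
have e1 : nm e <= 1.
  apply: nm_le; first exact: ler01.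
  by move=> i; rewrite mxE; case: (_ && _); rewrite ?cabs1 ?cabs0 ?ler01.
have [_ jg] := inverse_local Wu uf s0.
have vn (t : C) : cabs t <= tau -> nm (v + t *: e - f u0) < d.
  move=> tt; rewrite addrAC; apply: le_lt_trans (nmD _ _) _; rewrite nmZ.
  have : cabs t * nm e <= tau * 1 by rewrite ler_pM ?cabs_ge0 ?nm_ge0.
  have fv : nm (v - f u0) < d / 2 by exact: fu.
  have aux (a b c : R) : 0 < c -> a < c / 2 -> b <= c / 4 * 1 -> a + b < c by lra.
  exact: aux d0 fv.
have rh (t : C) : cabs t <= tau -> rado h (v + t *: e).
  move=> /vn tv; apply: rado_ext => y /dS; apply: contraTneq => ->.
  by rewrite -ltNge.
have jac_g y : K y -> jdet f y != 0 -> differentiable g (f y).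
  move=> Ky jy; have uy : jac f y \in unitmx by rewrite unitmxE unitfE.
  by have [_ /jac_at_diff] := inverse_local (sW Ky) uy s0.
have [H H0 HK] : exists2 H : R, 0 <= H & forall y, cabs (h y) <= H.
  have [|||y /set_mem Ky ymax] := @compact_EVT_max _ _ (fun y => cabs (jdet f y)) K.
  - by exists u.
  - exact: compact_nm_ball.
  - apply: continuous_in_subspaceT => y /set_mem Ky.
    apply: (@continuous_comp V C R (jdet f) (@cabs R)); last exact: cabs_continuous.
    by apply: diff_cont; apply: dif_jdet; apply: near_W; exact: sW.
  exists (cabs (jdet f y)); first exact: cabs_ge0.
  move=> z; have [->|/ext_neq0[z' Kz' <-]] := eqVneq (h z) 0; first by rewrite cabs0 cabs_ge0.
  by rewrite (ext_f Kz'); apply: ymax; exact/mem_set.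
pose p (t : C) : C := g (v + t *: e) 0 j.
have v0 : v + (0 : C) *: e = v by rewrite scale0r addr0.
have dp (t : C) : h (v + t *: e) != 0 -> differentiable p t.
  move=> ht; have [y Ky yE] := ext_neq0 ht.
  apply: (@dif_line _ V C (fun z => g z 0 j)); apply: dif_col.
  rewrite -yE; apply: (jac_g _ Ky); by rewrite -(ext_f Ky) yE.
have hv : h v != 0 by rewrite (ext_f Ku); move: uf; rewrite unitmxE unitfE.
have p2 (t : C) : h (v + t *: e) != 0 -> cabs (p t - p 0) <= 2 * s.
  move=> ht; have [y Ky yE] := ext_neq0 ht.
  rewrite /p v0 -yE /v !gf//; last exact: sW.
  have -> : y 0 j - u 0 j = (y - u) 0 j by rewrite !mxE.
  apply: le_trans (cabs_coord _ _) _; apply: le_trans (nm_tri _ u0 _) _.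
  rewrite [nm (u0 - u)]nmBC; move: Ku Ky; rewrite /K/=.
  by move: (nm _) (nm _) => *; lra.
have [|c cP] := @quot_bounded _ p [set t | h (v + t *: e) != 0] (2 * s) _ p2.
  by apply: dp; rewrite v0.
have A0 : 0 <= 2 * s / tau by exact: divr_ge0 (mulr_ge0 (ler0n _ 2) (ltW s0)) (ltW tau0).
have key (t : C) : cabs t <= tau -> t != 0 -> h (v + t *: e) != 0 ->
    cabs ((p t - p 0) / t) <= 2 * s / tau.
  move=> tt t0 ht; apply: (@root_le _ _ _ (cabs t * cabs (h (v + t *: e))) (tau * H)).
  - exact: cabs_ge0.
  - exact: A0.
  - by rewrite mulr_gt0// cabs_gt0.
  move=> m; pose psi (w : C) : C := (w * ((p w - p 0) / w) ^+ m) * h (v + w *: e).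
  have cpsi w : h (v + w *: e) != 0 -> cabs (w * ((p w - p 0) / w) ^+ m) <= cabs w * c ^+ m.
    move=> hw; rewrite cabsM cabsX ler_wpM2l ?cabs_ge0// lerXn2r ?nnegrE ?cabs_ge0//.
      exact: le_trans (cabs_ge0 _) (cP _ hw).
    exact: cP.
  have c0 : 0 <= c by apply: le_trans (cabs_ge0 _) (cP t ht).
  have -> : cabs t * cabs (h (v + t *: e)) * cabs ((p t - p 0) / t) ^+ m = cabs (psi t).
    by rewrite /psi !cabsM [cabs (_ ^+ m)]cabsX cabsM mulrAC.
  have rpsi w : cabs w <= tau -> w != 0 -> rado psi w.
    move=> wt w0; have rw := rado_line (rh w wt).
    refine (@rado_mul C (fun w => w * ((p w - p 0) / w) ^+ m) _ w ((cabs w + 1) * c ^+ m) 1 rw _ ltr01 _).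
    - move=> hw; apply: dif_mul; first exact: dif_id.
      apply: dif_exp; apply: dif_mul; last by apply: dif_inv; [exact: dif_id|exact: w0].
      by apply: dif_sub; [exact: dp|exact: dif_cst].
    - move=> y yw hy; apply: le_trans (cpsi y hy) _; rewrite ler_wpM2r ?exprn_ge0//.
      apply: le_trans (cabs_leD y w) _; rewrite lerD2l; exact: ltW.
  apply: (@max_modulus _ psi tau _ tau0 _ _ _ t tt) => [w wt|w wt|w wt].
  - have [->|w0] := eqVneq w 0; last by have [] := rpsi w wt w0.
    apply/cont_nm => e' e'0.
    have E0 : 0 < c ^+ m * H + 1 by rewrite ltr_wpDl// mulr_ge0// exprn_ge0.
    exists (e' / (c ^+ m * H + 1)); first by rewrite divr_gt0.
    move=> y; rewrite !subr0 {2}/psi !mul0r subr0 !nmE ltr_pdivlMr// => ye.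
    have [h0|hy] := eqVneq (h (v + y *: e)) 0; first by rewrite /psi h0 mulr0 cabs0.
    apply: le_lt_trans ye; rewrite cabsM.
    apply: (@le_trans _ _ (cabs y * c ^+ m * H)).
      by rewrite ler_pM ?cabs_ge0// cpsi.
    by rewrite -mulrA ler_wpM2l ?cabs_ge0// lerDl.
  - move=> pw; have w0 : w != 0 by apply: contra_neq pw => ->; rewrite /psi !mul0r.
    by have [_] := rpsi w (ltW wt) w0; apply.
  - have [h0|hw] := eqVneq (h (v + w *: e)) 0.
      by rewrite /psi h0 mulr0 cabs0; exact: mulr_ge0 (mulr_ge0 (ltW tau0) H0) (exprn_ge0 _ A0).
    rewrite /psi !cabsM wt -[leLHS]mulrA -[leRHS]mulrA ler_pM2l// mulrC ler_pM ?cabs_ge0//.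
    rewrite cabsX; apply: lerXn2r; [exact: cabs_ge0|exact: A0|].
    by rewrite cabsM cabsV wt ler_pM2r ?invr_gt0// p2.
have dg := jac_at_diff jg.
have JE : invmx (jac f u) k j = 'd (fun y => g y 0 j : C) v e.
  by rewrite -(jac_unique jg) mxE.
have [d' d'0 hd] : exists2 d' : R, 0 < d' & forall t : C, cabs t < d' -> h (v + t *: e) != 0.
  have := rado_line (rh 0 _); rewrite cabs0 => /(_ (ltW tau0))[ch _].
  have hv0 : 0 < cabs (h v) by rewrite cabs_gt0.
  have [d' d'0 Hd'] := (cont_nm (fun t : C => h (v + t *: e)) 0).1 ch _ hv0.
  exists d'; first exact: d'0.
  move=> t td; have := Hd' t; rewrite subr0 => /(_ td); rewrite v0 !nmE cabsBC => ht.
  have aux (a b : C) : cabs (a - b) < cabs a -> b != 0.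
    by move=> ab; apply: contraTneq ab => ->; rewrite subr0 ltxx.
  exact: aux ht.
rewrite JE; apply: (@diff_le _ _ _ _ (Num.min d' tau)).
- exact: dif_col dg.
- by rewrite lt_min d'0.
move=> t t0; rewrite lt_min => /andP[/hd ht /ltW tt].
have := key t tt t0 ht; rewrite cabsM cabsV ler_pdivrMr ?cabs_gt0//.
by rewrite /p v0.
Qed.

End Fixed.

(** Regular points exist arbitrarily close to [u] by [injective_jac]. There [inverse_entry] bounds
    the inverse Jacobian matrix, hence the determinant of [f] is at least [1 / (c - 1)] in modulus.
    If it vanished at [u], it would be below [1 / c] nearby. *)
Lemma osgood_jac f g W u : open W -> (forall y, W y -> differentiable f y) ->
  (forall y, W y -> g (f y) = y) -> W u -> jac f u \in unitmx.
Proof.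
move=> oW df gf Wu.
have /nbhs_nm[s2 s20 sW] : nbhs u W by exact: open_nbhs_nbhs.
pose s := s2 / 2; have s0 : 0 < s by rewrite divr_gt0.
have {}sW y : nm (y - u) <= s -> W y by move=> ys; apply: sW; rewrite /s in ys *; lra.
have cS := compact_sphere (@compact_nm_ball _ _ u s).
have [y /= ys|y /= ys|d d0 dS] := @compact_away _ _ _ f (f u) cS.
- by apply: diff_cont; apply: df; apply: sW; rewrite ys.
- apply/eqP => fy; have := gf y (sW y _); rewrite fy gf// ys lexx => /(_ isT) yu.
  by move: ys; rewrite -yu subrr nm0 => s00; move: s0; rewrite -s00 ltxx.
pose A := 2 * s / (d / 4).
have A0 : 0 <= A.
  exact: divr_ge0 (mulr_ge0 (ler0n _ 2) (ltW s0)) (divr_ge0 (ltW d0) (ler0n _ 4)).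
pose c := n`!%:R * A ^+ n + 1 : R.
have c0 : 0 < c.
  exact: ltr_wpDl (mulr_ge0 (ler0n _ _) (exprn_ge0 _ A0)) ltr01.
rewrite unitmxE unitfE; apply/eqP => j0.
have nW := near_W oW df Wu.
have [d1 d10 H1] := (cont_nm f u).1 (diff_cont (df u Wu)) _ (divr_gt0 d0 (ltr0n _ 2)).
have ci : 0 < c^-1 by rewrite invr_gt0.
have [d2 d20 H2] := (cont_nm (jdet f) u).1 (diff_cont (dif_jdet nW)) _ ci.
pose m := Num.min s (Num.min d1 d2).
have m0 : 0 < m by rewrite !lt_min s0 d10.
have oM : open [set y : V | nm (y - u) < m] by exact: open_nm_ball.
have MW y : nm (y - u) < m -> W y.
  by rewrite lt_min => /andP[/ltW /sW].
have [| | |y /= ym uy] := @injective_jac _ _ f _ u oM.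
- by rewrite /= subrr nm0.
- by move=> y /MW /df.
- by move=> x y /MW Wx /MW Wy fxy; rewrite -(gf x Wx) fxy gf.
move: ym; rewrite !lt_min => /andP[/ltW ys /andP[/H1 y1 /H2 y2]].
have ent k j := @inverse_entry f g W u s oW df gf s0 sW d d0 dS y k j ys y1 uy.
have := det_le ent; rewrite det_inv cabsV => Dinv.
move: y2; rewrite [X in _ - X]j0 subr0 nmE => y2.
move: uy; rewrite unitmxE unitfE -cabs_gt0 => D0.
have : 1 <= cabs (\det (jac f y)) * (c - 1).
  by rewrite -ler_pdivrMl// mulr1 /c addrK.
move: y2; rewrite /jdet; move: (cabs _) D0 => D D0; rewrite -[_^-1]mul1r ltr_pdivlMr//.
by rewrite mulrBr; lra.
Qed.

Theorem osgood f g W u : open W -> (forall y, W y -> differentiable f y) ->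
  (forall y, W y -> g (f y) = y) -> W u ->
  nbhs (f u) (f @` W) /\ differentiable g (f u).
Proof.
move=> oW df gf Wu; have uf := osgood_jac oW df gf Wu.
have /nbhs_nm[e e0 eW] : nbhs u W by exact: open_nbhs_nbhs.
have [fn /jac_at_diff] := inverse_local oW df gf Wu uf e0; split=> //.
by apply: filterS fn => v [y /eW Wy yv]; exists y.
Qed.

End OsgoodTheorem.

(** * The ball minus a compact set *)

#[local] Opaque moebius enorm dot jac cabs.

Section BallIdentity.
Variables (R : realType) (n : nat).
Local Notation C := (R[i]^o).
Local Notation V := (Cvec R n).
Implicit Types (u v : V).

Lemma unit_dirK u : ((enorm u)%:C : C) *: unit_dir u = u.
Proof.
have [->|u0] := eqVneq u 0; first by rewrite /unit_dir !scaler0.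
by rewrite /unit_dir scalerA -rmorphM/= mulfV ?scale1r// enorm_eq0.
Qed.

(** Restricting to the complex line through [0] and [u] makes connectedness of the ball
    unnecessary. *)
Lemma eball_identity (f g : V -> C) (r : R) : 0 < r ->
  (forall u, enorm u < r -> differentiable f u) ->
  (forall u, enorm u < r -> differentiable g u) ->
  (\forall u \near (0 : V), f u = g u) -> forall u, enorm u < r -> f u = g u.
Proof.
move=> r0 df dg /nbhs_enorm[d d0 fg] u ur.
pose e := unit_dir u; have e1 : enorm e <= 1 by exact: enorm_unit_dir.
pose x := (enorm u + r) / 2; have ux : enorm u < x by rewrite /x; lra.
have xr : x < r by rewrite /x; lra.
have x0 : 0 < x by apply: le_lt_trans ux; exact: enorm_ge0.
have te (t : C) : enorm (0 + t *: e) <= cabs t.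
  by rewrite add0r enormZ ler_piMr// cabs_ge0.
apply/eqP; rewrite -subr_eq0; apply/eqP.
have := @rado_zero_disc _ (fun t : C => f (0 + t *: e) - g (0 + t *: e)) x d x0 d0.
move=> /(_ _ _ ((enorm u)%:C : C)); rewrite add0r unit_dirK; apply.
- move=> t tx; apply: rado_diff; apply: dif_sub; apply: dif_line.
    by apply: df; apply: le_lt_trans (te t) _; exact: le_lt_trans xr.
  by apply: dg; apply: le_lt_trans (te t) _; exact: le_lt_trans xr.
- move=> t td; rewrite fg ?subrr// subr0; exact: le_lt_trans (te t) td.
- by rewrite cabs_real ger0_norm// enorm_ge0.
Qed.

End BallIdentity.

(** * Squeezing function and Fridman invariant of a ball with a hole *)

Section HoleInBall.
Variables (R : realType) (m : nat).
Local Notation C := (R[i]^o).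
Local Notation V := (Cvec R m.+2).
Local Notation B := (unit_ball R m.+2).
Implicit Types (u v w : V).
Variables (D : set V) (z : V).
Local Notation K := (closure D).
Hypothesis cK : compact K.
Hypothesis KB : K `<=` B.
Hypothesis D0 : D !=set0.
Local Notation X := (B `\` K).
Hypothesis cX : connected X.
Hypothesis Xz : X z.

Let Bz : B z. Proof. by case: Xz. Qed.
Let mb := moebius z.

Lemma open_hole : open X.
Proof.
by rewrite setDE; apply: openI; [exact: open_eball|exact/closed_openC/closed_closure].
Qed.

Lemma moebius_continuous w : B w -> {for w, continuous (fun w => enorm (mb w))}.
Proof.
move=> Bw; apply: (@continuous_comp V V R mb (@enorm R _)); last exact: enorm_continuous.
exact: diff_cont (moebius_diff Bz Bw).
Qed.

(** A nearest point is not interior to [D]: multiplying [mb w0] by [1 - t] for small [t] and mapping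
    back would give a point of [D] closer to [z]. *)
Lemma nearest : exists w0, [/\ boundary D w0, 0 < enorm (mb w0), enorm (mb w0) < 1
  & forall w, K w -> enorm (mb w0) <= enorm (mb w)].
Proof.
have Kn : K !=set0 by case: D0 => x Dx; exists x; exact: subset_closure.
have [|w0 /set_mem Kw wmin] := @compact_EVT_min _ _ (fun w => enorm (mb w)) K Kn cK.
  apply: continuous_in_subspaceT => w /set_mem /KB; exact: moebius_continuous.
have {}wmin w : K w -> enorm (mb w0) <= enorm (mb w).
  by move=> Kw'; apply: wmin; exact/mem_set.
have Bw := KB Kw.
have mw1 : enorm (mb w0) < 1 by rewrite -unit_ballE; exact: moebius_ball.
have mw0 : 0 < enorm (mb w0).
  rewrite enorm_gt0; apply/eqP => w00; case: Xz => _; apply.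
  by rewrite -(moebius0 z) -w00 (moebiusK Bz Bw).
exists w0; split=> [|//|//|//].
split; first exact: Kw.
move=> Dw; pose u := mb w0; have Bu : B u by rewrite unit_ballE.
have wE : mb u = w0 by exact: moebiusK.
have := diff_cont (moebius_diff Bz Bu); rewrite -/mb => cm.
have /nbhs_enorm[s s0 sD] : nbhs u (mb @^-1` D).
  by apply: cm; rewrite wE.
pose t := Num.min 1 s / 2.
have m0 : 0 < Num.min 1 s by rewrite lt_min ltr01.
have t0 : 0 < t by rewrite divr_gt0.
have [t1 ts] : t < 1 /\ t < s.
  have : t < Num.min 1 s by rewrite /t; lra.
  by rewrite lt_min => /andP.
pose v := ((1 - t)%:C : C) *: u.
have vu : enorm (v - u) < s.
  have -> : v - u = - ((t%:C : C) *: u).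
    by rewrite /v rmorphB scalerBl scale1r addrAC subrr add0r.
  rewrite enormN enormZ cabs_real gtr0_norm//; apply: le_lt_trans ts.
  by rewrite ler_piMr// ltW.
have vn : enorm v < enorm u.
  rewrite /v enormZ cabs_real ger0_norm; last by lra.
  by rewrite gtr_pMl//; lra.
have Bv : B v by rewrite unit_ballE; exact: lt_trans vn mw1.
have Dv : D (mb v) by exact: (sD v vu).
have := wmin (mb v) (subset_closure Dv).
have E : mb (mb v) = v := moebiusK Bz Bv.
by rewrite E leNgt => /negP; apply; exact: vn.
Qed.

Lemma hole_extension (f : V -> C) : (forall w, X w -> differentiable f w) ->
  (forall w, X w -> cabs (f w) <= 1) -> exists F : V -> C,
  [/\ forall w, B w -> differentiable F w, forall w, B w -> cabs (F w) <= 1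
    & forall w, X w -> F w = f w].
Proof.
have Kn : K !=set0 by case: D0 => x Dx; exists x; exact: subset_closure.
have [|p /set_mem Kp pmax] := @compact_EVT_max _ _ (@enorm R _) K Kn cK.
  by apply: continuous_in_subspaceT => w _; exact: enorm_continuous.
have p1 : 0 <= enorm p < 1 by rewrite enorm_ge0 -unit_ballE; exact: KB.
move=> df f1; apply: (@hartogs R m K (enorm p) (@closed_closure _ D) p1 _ f df f1 cX).
by move=> w Kw; apply: pmax; exact/mem_set.
Qed.

Lemma caratheodory_ballE w : B w -> caratheodory B z w = artanh (enorm (mb w)).
Proof.
move=> Bw; apply: caratheodoryE => // f [df f1]; exists f; split=> // u Bu.
by apply/ltW/f1; exists u.
Qed.

Lemma caratheodory_holeE w : X w -> caratheodory X z w = artanh (enorm (mb w)).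
Proof.
move=> Xw; apply: caratheodoryE; [by move=> u []|exact: Xz|exact: Xw|].
move=> f [df f1]; have [|F [dF F1 FE]] := hole_extension df.
  by move=> u Xu; apply/ltW/f1; exists u.
by exists F.
Qed.

Lemma caratheodory_distE w0 : boundary D w0 ->
  (forall w, K w -> enorm (mb w0) <= enorm (mb w)) ->
  caratheodory_dist (boundary D) z = enorm (mb w0).
Proof.
move=> bw wmin.
have tE w : K w -> tanh (caratheodory B z w) = enorm (mb w).
  move=> /KB Bw; rewrite caratheodory_ballE// artanhK// enorm_ge0 -unit_ballE.
  exact: moebius_ball.
have min0 : minimums [set tanh (caratheodory B z w) | w in boundary D] (enorm (mb w0)).
  split; first by exists w0 => //; apply: tE; case: bw.
  by move=> _ [w [Kw _] <-]; rewrite (tE w Kw); exact: wmin.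
apply: xget_subset1 => // x y [Sx lx] [Sy ly]; apply/le_anti/andP; split.
  exact: lx.
exact: ly.
Qed.

Variable w0 : V.
Hypothesis Kw0 : K w0.
Hypothesis w0_gt0 : 0 < enorm (mb w0).
Hypothesis w0_lt1 : enorm (mb w0) < 1.
Hypothesis w0_min : forall w, K w -> enorm (mb w0) <= enorm (mb w).
Local Notation d := (enorm (mb w0)).

Lemma in_hole u : enorm u < d -> X (mb u).
Proof.
move=> ud; have Bu : B u by rewrite unit_ballE; exact: lt_trans ud w0_lt1.
split; first exact: moebius_ball.
by move=> /w0_min; rewrite /mb moebiusK// leNgt ud.
Qed.

Lemma squeezing_lower : exists f : V -> V,
  [/\ hol X B f, set_inj X f, f z = 0 & eball 0 d `<=` f @` X].
Proof.
exists mb; split.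
- split=> [w [Bw _]|_ [w [Bw _] <-]]; first exact: moebius_diff.
  exact: moebius_ball.
- move=> x y /set_mem[Bx _] /set_mem[By _] xy.
  by rewrite -(moebiusK Bz Bx) -/mb xy /mb moebiusK.
- exact: moebiusa.
- move=> u; rewrite /eball/= subr0 => ud.
  exists (mb u); first exact: in_hole.
  by rewrite /mb moebiusK// unit_ballE; exact: lt_trans ud w0_lt1.
Qed.

(** Extending coordinate by coordinate bounds each coordinate by [1], not the Euclidean norm. For
    the latter, the scalar function [dot (f w) e] in the direction [e] of [F u] is extended as well;
    it agrees with the component of [F] along [e] by the identity theorem. *)
Lemma map_extension (f : V -> V) : hol X B f -> exists F : V -> V,
  [/\ forall u, B u -> differentiable F u, forall u, B u -> enorm (F u) <= 1
    & forall u, X u -> F u = f u].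
Proof.
move=> [df fB]; have f1 u : X u -> enorm (f u) < 1.
  by move=> Xu; rewrite -unit_ballE; apply: fB; exists u.
have ext j : exists G : V -> C,
    [/\ forall w, B w -> differentiable G w, forall w, B w -> cabs (G w) <= 1
      & forall w, X w -> G w = f w 0 j].
  apply: hole_extension.
    by move=> w Xw; apply: dif_col; exact: df.
  move=> w Xw; apply: le_trans (cabs_coord _ _) _; apply: le_trans (nm_le_enorm _) _.
  exact/ltW/f1.
have [G GP] := choice ext.
pose F u : V := \row_j G j u.
have FG j : (fun u => F u 0 j : C) = G j by apply/funext => u; rewrite mxE.
have dF u : B u -> differentiable F u.
  by move=> Bu; apply: dif_row => j; rewrite FG; have [H _ _] := GP j; exact: H.
have FE u : X u -> F u = f u.
  by move=> Xu; apply/rowP => j; rewrite mxE; have [_ _ ->] := GP j.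
exists F; split; [exact: dF| |exact: FE].
move=> u Bu; pose e := unit_dir (F u).
have ddot (g : V -> V) w : differentiable g w -> differentiable (fun w => dot (g w) e : C) w.
  by move=> dg; apply: (@dif_comp _ V V C g (fun v => dot v e) w dg); exact: dif_dot.
have [| |H [dH H1 HE]] := @hole_extension (fun w => dot (f w) e).
- by move=> w Xw; apply: ddot; exact: df.
- by move=> w Xw; apply: le_trans (cabs_dot_dir _ _) _; exact/ltW/f1.
have Bm w : enorm w < 1 -> B (mb w).
  by move=> w1; apply: moebius_ball => //; rewrite unit_ballE.
have dm (g : V -> C) w : (forall w, B w -> differentiable g w) -> enorm w < 1 ->
    differentiable (fun w => g (mb w)) w.
  move=> dg w1; apply: (@dif_comp _ V V C mb g); last exact/dg/Bm.
  by apply: moebius_diff => //; rewrite unit_ballE.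
have E := @eball_identity _ _ (fun w => dot (F (mb w)) e) (fun w => H (mb w)) 1 ltr01.
have u1 : enorm (mb u) < 1 by rewrite -unit_ballE; exact: moebius_ball.
have {}E := E _ _ _ (mb u) u1; rewrite /mb moebiusK// in E.
have -> : enorm (F u) = cabs (dot (F u) e).
  by rewrite dot_unit_dir cabs_real ger0_norm// enorm_ge0.
rewrite E; first exact: H1.
- by move=> w w1; apply: (dm (fun v => dot (F v) e)) => // v Bv; apply: ddot; exact: dF.
- by move=> w w1; exact: (dm H).
- apply/nbhs_enorm; exists d; first exact: w0_gt0.
  by move=> w; rewrite subr0 => /in_hole Xw; rewrite -/mb HE// FE.
Qed.

Lemma squeezing_upper (f : V -> V) (r : R) : 0 < r ->
  hol X B f -> set_inj X f -> f z = 0 -> eball 0 r `<=` f @` X -> r <= d.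
Proof.
move=> r0 fh finj fz fr; rewrite leNgt; apply/negP => dr.
have [F [dF F1 FE]] := map_extension fh; have [df _] := fh.
pose g v := xget z [set x | X x /\ f x = v].
have gf x : X x -> g (f x) = x.
  move=> Xx; rewrite /g; case: xgetP => [y _ [Xy fy]|/(_ x)[]//].
  by apply: finj; rewrite ?inE.
have os x (Xx : X x) := osgood open_hole df gf Xx.
(* Capping at [1] keeps the variable inside the ball, where [mb] is defined, and preserves
   [d < r']. *)
pose r' := Num.min r 1.
have dr' : d < r' by rewrite lt_min dr.
have r'0 : 0 < r' by rewrite lt_min r0 ltr01.
have r'1 u : enorm u < r' -> B u by rewrite lt_min unit_ballE => /andP[].
have fX v : enorm v < r' -> exists2 x, X x & f x = v.
  by rewrite lt_min => /andP[vr _]; apply: fr; rewrite /eball/= subr0.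
pose Phi u := F (mb u).
have Phi_le u : B u -> enorm (Phi u) <= enorm u.
  move: u; apply: schwarz_ball_map => [v Bv|v Bv|].
  - apply: (@dif_comp _ V V V mb F); first exact: moebius_diff.
    by apply: dF; exact: moebius_ball.
  - by apply: F1; exact: moebius_ball.
  - by rewrite /Phi /mb moebius0 FE.
have dPhi u : B u -> differentiable Phi u.
  move=> Bu; apply: (@dif_comp _ V V V mb F); first exact: moebius_diff.
  by apply: dF; exact: moebius_ball.
(* The left side is holomorphic because [Phi] does not increase norms and so stays in the image of
   [f], where [osgood] applies to [g]. Both sides agree for [enorm u < d], since [mb u] then lies in
   [X]. *)
have gPhi u : enorm u < r' -> g (Phi u) = mb u.
  move=> ur; apply/rowP => j.
  apply: (@eball_identity _ _ (fun u => g (Phi u) 0 j) (fun u => mb u 0 j) r' r'0 _ _ _ u ur).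
  - move=> v vr; apply: dif_col; apply: (@dif_comp _ V V V Phi g); first exact/dPhi/r'1.
    have [|x Xx <-] := fX (Phi v); first exact: le_lt_trans (Phi_le _ (r'1 _ vr)) vr.
    by have [] := os x Xx.
  - by move=> v /r'1 Bv; apply: dif_col; exact: moebius_diff.
  - apply/nbhs_enorm; exists d; first exact: w0_gt0.
    by move=> v; rewrite subr0 => /in_hole Xv; rewrite /Phi FE// gf.
have := gPhi _ dr'; rewrite /mb moebiusK -/mb; [|exact: Bz|exact: KB].
have [|x Xx fx] := fX (Phi (mb w0)); first exact: le_lt_trans (Phi_le _ (r'1 _ dr')) dr'.
by rewrite -fx gf// => xw; case: Xx => _; rewrite xw.
Qed.

Theorem squeezing_hole : squeezing X z = d.
Proof.
apply: sup_max; first by split; [exact: w0_gt0|exact: squeezing_lower].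
by move=> r [r0 [f [fh finj fz fr]]]; exact: squeezing_upper fr.
Qed.

Lemma fridman_lower : exists f : V -> V,
  [/\ hol B X f, set_inj B f & caratheodory_ball X z (artanh d) `<=` f @` B].
Proof.
have dB u : B u -> enorm ((d%:C : C) *: u) < d.
  rewrite unit_ballE => u1; rewrite enormZ cabs_real ger0_norm; last exact: ltW.
  by rewrite gtr_pMr.
have Bd u : B u -> B ((d%:C : C) *: u).
  by move=> /dB ud; rewrite unit_ballE; exact: lt_trans ud w0_lt1.
have dn : d%:C != 0 :> C by rewrite -cabs_gt0 cabs_real gtr0_norm.
exists (fun u => mb ((d%:C : C) *: u)); split.
- split=> [u Bu|_ [u Bu <-]]; last exact/in_hole/dB.
  apply: (@dif_comp _ V V V (fun u => (d%:C : C) *: u) mb).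
    by apply: differentiableZ; exact: dif_id.
  exact: (moebius_diff Bz (Bd _ Bu)).
- move=> x y /set_mem Bx /set_mem By /(congr1 mb).
  have E u : B u -> mb (mb ((d%:C : C) *: u)) = (d%:C : C) *: u.
    by move=> Bu; exact: (moebiusK Bz (Bd _ Bu)).
  move=> xy; have {xy} := etrans (esym (E _ Bx)) (etrans xy (E _ By)).
  move=> /(congr1 (fun v : V => (d%:C : C)^-1 *: v)).
  by rewrite !scalerA (mulVf dn) !scale1r.
- move=> w [Xw]; have [Bw _] := Xw; rewrite caratheodory_holeE// => wr.
  have wd : enorm (mb w) < d.
    have mw1 : enorm (mb w) < 1 by rewrite -unit_ballE; exact: (moebius_ball Bz Bw).
    rewrite ltNge; apply/negP => dw; move: wr; rewrite ltNge => /negP; apply.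
    exact: artanh_le (ltW w0_gt0) dw mw1.
  exists ((d%:C : C)^-1 *: mb w).
    rewrite unit_ballE enormZ cabsV cabs_real gtr0_norm//.
    by rewrite ltr_pdivrMl// mulr1.
  by rewrite scalerA mulfV// scale1r /mb moebiusK.
Qed.

(* If [f] realises a larger radius, its inverse is defined on [K]'s complement
   near [w0] and tends to the sphere at [K]. *)
Lemma fridman_inverse (f : V -> V) (r : R) : d < tanh r -> hol B X f -> set_inj B f ->
  caratheodory_ball X z r `<=` f @` B ->
  exists (N : set V) (g : V -> V), [/\ open N, N w0,
    forall w, N w -> ~ K w -> differentiable g w /\ enorm (g w) < 1,
    forall w w', N w -> ~ K w -> N w' -> ~ K w' -> g w = g w' -> w = w'
    & forall k (eta : R), K k -> eta < 1 -> exists2 e : R, 0 < e &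
      forall w, nm (w - k) < e -> N w -> ~ K w -> eta < enorm (g w)].
Proof.
move=> dr [df fX] finj fr.
have oB : open B by exact: open_eball.
pose g v := xget (0 : V) [set u | B u /\ f u = v].
have gf u : B u -> g (f u) = u.
  move=> Bu; rewrite /g; case: xgetP => [y _ [By fy]|/(_ u)[]//].
  by apply: finj; rewrite ?inE.
pose N : set V := B `&` [set w | enorm (mb w) < tanh r].
have NE w : N w -> ~ K w -> exists2 u, B u & f u = w.
  move=> [Bw /= wr] nK; have Xw : X w by split.
  apply: fr; split; first exact: Xw.
  rewrite (caratheodory_holeE Xw).
  rewrite ltNge; apply/negP => /tanh_le; rewrite artanhK; first by rewrite leNgt wr.
  by rewrite enorm_ge0 -unit_ballE; exact: moebius_ball.
exists N, g; split.
- rewrite openE => w [Bw /= wr]; apply: filterI; first exact: open_nbhs_nbhs.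
  have : nbhs (enorm (mb w)) [set x | x < tanh r].
    by apply: open_nbhs_nbhs; split; [exact: open_lt|exact: wr].
  by move=> /(moebius_continuous Bw).
- exact: (conj (KB Kw0) dr).
- move=> w Nw nK; have [u Bu <-] := NE w Nw nK; split.
    by have [] := osgood oB df gf Bu.
  by rewrite (gf u Bu) -unit_ballE.
- move=> w w' Nw nK Nw' nK'; have [u Bu <-] := NE w Nw nK.
  by have [u' Bu' <-] := NE w' Nw' nK'; rewrite (gf u Bu) (gf u' Bu') => ->.
(* The compact set [T] is mapped into [X], so its image keeps a positive distance from [k]; a point
   closer to [k] has its preimage outside [T]. *)
move=> k eta Kk eta1; pose T : set V := [set u | enorm (u - 0) <= eta].
have TB u : T u -> B u by rewrite unit_ballE /T/= subr0 => /le_lt_trans; apply.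
have [||u Tu|e e0 He] := @compact_away _ V V T f k.
- exact: compact_eball.
- by move=> u /TB /df /diff_cont.
- by apply/eqP => fk; have [_] : X (f u) by [apply: fX; exists u => //; exact: TB]; rewrite fk.
exists e; first exact: e0.
move=> w we Nw nK; have [u Bu fu] := NE w Nw nK; rewrite -fu (gf u Bu) ltNge.
apply/negP => ue; have := He u; rewrite /T/= subr0 => /(_ ue).
by rewrite fu leNgt we.
Qed.

(** The boundary geometry of [D] is isolated in the hypothesis that no map as in [fridman_inverse]
    exists around [w0]. *)
Theorem fridman_hole : (forall (N : set V) (g : V -> V), open N -> N w0 ->
    (forall w, N w -> ~ K w -> differentiable g w /\ enorm (g w) < 1) ->
    (forall w w', N w -> ~ K w -> N w' -> ~ K w' -> g w = g w' -> w = w') ->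
    (forall k (eta : R), K k -> eta < 1 -> exists2 e : R, 0 < e &
      forall w, nm (w - k) < e -> N w -> ~ K w -> eta < enorm (g w)) -> False) ->
  fridman X z = d.
Proof.
move=> noN; have d01 : 0 < d < 1 by rewrite w0_gt0 w0_lt1.
apply: sup_max.
  exists (artanh d); last by rewrite artanhK// ltW.
  by split; [exact: artanh_gt0|exact: fridman_lower].
move=> _ [r [r0 [f [fh finj fr]]] <-]; rewrite leNgt; apply/negP => dr.
have [N [g [oN Nw H1 H2 H3]]] := fridman_inverse dr fh finj fr.
exact: noN H1 H2 H3.
Qed.

End HoleInBall.

(** * Schwarz-Pick and exterior points *)

Section SchwarzPick.
Variable R : realType.
Local Notation C := (R[i]^o).

(** The radius [2] puts [t = 1] halfway to the boundary, so Schwarz's lemma yields a factor one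
    half. This absorbs the term [s0 * cabs (s 1 - s0)] produced by the denominator. *)
Lemma schwarz_pick (s : C -> C) (s0 : R) : 0 <= s0 -> s0 < 1 ->
  (forall t, cabs t < 2 -> differentiable s t) ->
  (forall t, cabs t < 2 -> cabs (s t) < 1) -> s 0 = s0%:C ->
  cabs (s 1 - s0%:C) <= 1 - s0 ^+ 2.
Proof.
move=> s00 s01 ds s1 sE.
have den t : cabs t < 2 -> 1 - s0%:C * s t != 0.
  move=> /s1 st; rewrite subr_eq0; apply/eqP => h.
  have : cabs (s0%:C * s t : C) < 1.
    by rewrite cabsM cabs_real ger0_norm//; have := cabs_ge0 (s t); nra.
  by rewrite -h cabs1 ltxx.
have s0lt : s0 ^+ 2 < 1 by rewrite expr_lt1.
pose p t : C := (s t - s0%:C) / (1 - s0%:C * s t).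
have t1 : cabs (1 : C) < 2 by rewrite cabs1; lra.
have : cabs (p 1) * 2 <= 1 * cabs (1 : C).
  apply: (@schwarz _ p 2 1 (ltr0n _ 2)) => [t t2|t t2||//].
  - apply: dif_mul; first by apply: dif_sub; [exact: ds|exact: dif_cst].
    apply: dif_inv; last exact: den.
    apply: dif_sub; first exact: dif_cst.
    by apply: dif_mul; [exact: dif_cst|exact: ds].
  - have d0 : 0 < cabs (1 - s0%:C * s t) by rewrite cabs_gt0; exact: den.
    rewrite /p cabsM cabsV ler_pdivrMr// mul1r.
    rewrite -(ler_pXn2r (n := 2)) ?nnegrE ?cabs_ge0//.
    have st : cabs (s t) ^+ 2 <= 1.
      by rewrite expr_le1 ?cabs_ge0//; exact/ltW/s1.
    move: st; rewrite !cabs_sqr; case: (s t) => x y /= st.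
    rewrite !(mul0r, subr0, addr0, add0r, oppr0, mulr0).
    have : 0 <= (1 - s0 ^+ 2) * (1 - (x ^+ 2 + y ^+ 2)) by rewrite mulr_ge0; lra.
    by lra.
  - by rewrite /p sE subrr mul0r.
have d1 : 0 < cabs (1 - s0%:C * s 1) by rewrite cabs_gt0 den.
rewrite /p cabsM cabsV cabs1 mulr1 -[cabs _ / _ * 2]mulrAC ler_pdivrMr// mul1r.
have -> : 1 - s0%:C * s 1 = (1 - s0 ^+ 2)%:C - s0%:C * (s 1 - s0%:C).
  by rewrite rmorphB rmorphXn/=; ring.
have := cabsB ((1 - s0 ^+ 2)%:C) (s0%:C * (s 1 - s0%:C)).
rewrite cabsM !cabs_real (ger0_norm s00) ger0_norm; last by lra.
by have := cabs_ge0 (s 1 - s0%:C); nra.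
Qed.

(** The scalar estimate is applied to the component of [p] along [p 0]. When [p 0] is near the
    sphere this component of [p 1] nearly exhausts the available norm, which leaves little room for
    the others. *)
Lemma schwarz_pick_ball n (p : C -> Cvec R n) :
  (forall t, cabs t < 2 -> differentiable p t) ->
  (forall t, cabs t < 2 -> enorm (p t) < 1) ->
  enorm (p 1 - p 0) ^+ 2 <= 3 * (1 - enorm (p 0) ^+ 2).
Proof.
move=> dp p1; pose e := unit_dir (p 0); pose s0 := enorm (p 0).
have c0 : cabs (0 : C) < 2 by rewrite cabs0.
have c1 : cabs (1 : C) < 2 by rewrite cabs1; lra.
have s00 : 0 <= s0 by exact: enorm_ge0.
have s01 : s0 < 1 by exact: p1.
have /= S := @schwarz_pick (fun t => dot (p t) e) s0 s00 s01.
have {}S : cabs (dot (p 1) e - s0%:C) <= 1 - s0 ^+ 2.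
  apply: S => [t t2|t t2|].
  - by apply: (@dif_comp _ C (Cvec R n) C p (fun v => dot v e) t (dp t t2)); exact: dif_dot.
  - by apply: le_lt_trans (cabs_dot_dir _ _) _; exact: p1.
  - exact: dot_unit_dir.
have E : dot (p 1) (p 0) = s0%:C * dot (p 1) e.
  by rewrite -[p 0 in LHS]unit_dirK dotZr conjc_real.
have p11 : enorm (p 1) ^+ 2 <= 1 by rewrite expr_le1 ?enorm_ge0//; exact/ltW/p1.
have := le_trans (Re_le_cabs _) S.
rewrite enorm_sqrB E -/s0; case: (dot (p 1) e) => x y /=; rewrite ler_norml => /andP[h _].
rewrite !(mul0r, subr0).
have : s0 * (s0 - (1 - s0 ^+ 2)) <= s0 * x by rewrite ler_wpM2l//; lra.
have : 0 <= (1 - s0 ^+ 2) * (1 - s0) by rewrite mulr_ge0 ?subr_ge0 ?expr_le1 ?(ltW s01).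
by move: p11; move: (enorm (p 1) ^+ 2) => w; lra.
Qed.

End SchwarzPick.

(** * Exterior points near a smooth boundary point *)

Section Exterior.
Variables (R : realType) (n : nat).
Local Notation V := (Cvec R n).
Local Notation W := ('rV[R]_n * 'rV[R]_n)%type.

Lemma closure_nm (A : set V) x :
  closure A x <-> forall e : R, 0 < e -> exists2 y, A y & nm (y - x) < e.
Proof.
split=> [Ax e e0|H B /nbhs_nm[e e0 eB]].
  have [y [Ay yx]] := Ax [set y | nm (y - x) < e] ((nbhs_nm _ _).2 (ex_intro2 _ _ e e0 (fun y h => h))).
  by exists y.
by have [y Ay yx] := H e e0; exists y; split=> //; exact: eB.
Qed.

Let real_coord (w : V) : W := (\row_j Re (w 0 j), \row_j Im (w 0 j)).

Let real_coordK w : of_real_coord (real_coord w) = w.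
Proof. by apply/rowP => j; rewrite !mxE; case: (w 0 j). Qed.

Let of_real_coordD (p v : W) (h : R) :
  of_real_coord (p + h *: v) = of_real_coord p + (h%:C : R[i]^o) *: of_real_coord v.
Proof.
apply/rowP => j; rewrite !mxE /=; apply/eqP; rewrite eq_complex /=.
by rewrite !mul0r subr0 addr0 !eqxx.
Qed.

(** As [q] is outside the open set [D], [rho q >= 0]. A short move in a real direction along which
    the differential is positive makes [rho] strictly positive, and by continuity [D] then misses a
    whole neighbourhood of the new point. *)
Lemma C1_exterior (D : set V) q (e : R) : open D -> boundary D q ->
  C1_smooth_near D q -> 0 < e -> exists2 x, nm (x - q) < e & ~ closure D x.
Proof.
move=> oD [_ iq] [U [rho [oU Uq C1 d0 DU]]] e0.
have q0 : 0 <= rho q.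
  rewrite leNgt; apply/negP => rq; apply: iq; apply: open_nbhs_nbhs; split=> //.
  have : (D `&` U) q by rewrite DU.
  by case.
pose p := real_coord q; pose phi := rho \o of_real_coord (R := R) (n := n).
have Up : U (of_real_coord p) by rewrite real_coordK.
have [v v0] : exists v, 0 < 'd phi p v.
  have [v v0] := d0 p Up; have [h|h] := ltP 0 ('d phi p v); first by exists v.
  exists (- v); rewrite linearN oppr_gt0 lt_neqAle h andbT; exact: v0.
have [dphi _] := C1 p Up.
have dv : derivable phi p v by exact: diff_derivable.
have := dv; rewrite /derivable => /cvg_ex[l lE].
have lv : l = 'd phi p v by rewrite -deriveE//; apply/esym; exact: cvg_lim.
have /nbhs_nm[s s0 sU] : nbhs q U by exact: open_nbhs_nbhs.
have := @cvgr_gt _ _ _ _ _ _ lE 0; rewrite lv => /(_ _ v0).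
rewrite near_withinE => /nbhs_ballP[c /= c0 cE].
pose b := nm (of_real_coord v); have b1 : 0 < b + 1 by rewrite ltr_wpDl// nm_ge0.
pose m := Num.min c (Num.min (s / (b + 1)) (e / (b + 1))).
have m0 : 0 < m by rewrite !lt_min c0 !divr_gt0.
pose h := m / 2; have h0 : 0 < h by rewrite divr_gt0.
have : h < m by rewrite /h; lra.
rewrite !lt_min !ltr_pdivlMr// => /andP[hc /andP[hs he]].
pose q' := p + h *: v; pose x := of_real_coord q'.
have xq : nm (x - q) <= h * (b + 1).
  rewrite /x /q' of_real_coordD real_coordK addrC addKr nmZ cabs_real gtr0_norm//.
  by apply: (ler_wpM2l (ltW h0)); rewrite -/b lerDl.
have Ux : U x by apply: sU; exact: le_lt_trans xq hs.
exists x; first exact: le_lt_trans xq he.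
have phx : 0 < phi q'.
  have := cE h; rewrite -ball_normE /= sub0r normrN gtr0_norm// => /(_ hc).
  rewrite gt_eqF// => /(_ isT); rewrite pmulr_rgt0 ?invr_gt0// subr_gt0 => ph.
  have pq : phi p = rho q by rewrite /phi /= real_coordK.
  by rewrite /q' addrC; apply: le_lt_trans ph; rewrite pq.
have [dq _] := C1 q' Ux.
have : nbhs (phi q') [set x | 0 < x].
  by apply: open_nbhs_nbhs; split; [exact: open_gt|exact: phx].
move=> /(differentiable_continuous dq) /nbhs_ballP[c' /= c'0 c'E].
have /nbhs_nm[s' s'0 s'U] : nbhs x U by exact: open_nbhs_nbhs.
move=> /closure_nm /(_ (Num.min c' s')) []; first by rewrite lt_min c'0.
move=> w Dw; rewrite lt_min => /andP[wc /s'U Uw].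
have : (D `&` U) w by [].
rewrite DU => -[_]; apply/negP; rewrite -leNgt ltW//.
have cc j : cabs (w 0 j - x 0 j) < c'.
  apply: le_lt_trans wc; have -> : w 0 j - x 0 j = (w - x) 0 j by rewrite !mxE.
  exact: cabs_coord.
have := c'E (real_coord w); rewrite /phi /= real_coordK; apply.
split=> /=; (split; first exact: c'0); move=> i j;
  rewrite (ord1 i) -ball_normE /= distrC; apply: le_lt_trans (cc j).
  by have := Re_le_cabs (w 0 j - x 0 j); rewrite !mxE /=; case: (w 0 j).
by have := Im_le_cabs (w 0 j - x 0 j); rewrite !mxE /=; case: (w 0 j).
Qed.

End Exterior.

(** * Faces of a product *)

Lemma sqr_lt (R : realType) (u v : R) : 0 <= u -> 0 < v -> u ^+ 2 < v ^+ 2 -> u < v.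
Proof. by move=> u0 v0; rewrite ltr_pXn2r// nnegrE ltW. Qed.

Section Face.
Variables (R : realType) (p q n : nat).
Local Notation C := (R[i]^o).
Local Notation V1 := (Cvec R p).
Local Notation V2 := (Cvec R q.+1).
Local Notation V := (Cvec R n).
Variables (D1 : set V1) (D2 : set V2) (K N : set V) (g : V -> V) (j : V1 -> V2 -> V).
Variables (a : V1) (b : V2).
Hypothesis oD1 : open D1.
Hypothesis sD1 : dense_C1_boundary D1.
Hypothesis aD1 : boundary D1 a.
Hypothesis oD2 : open D2.
Hypothesis bD2 : closure D2 b.
Hypothesis dj1 : forall x y, differentiable (fun x => j x y) x.
Hypothesis dj2 : forall x y, differentiable (j x) y.
Hypothesis j_inj : forall x y y', j x y = j x y' -> y = y'.
Hypothesis jK : forall x y, closure D1 x -> D2 y -> K (j x y).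
Hypothesis jNK : forall x y, ~ closure D1 x -> ~ K (j x y).
Variable s : R.
Hypothesis s0 : 0 < s.
Hypothesis jN : forall x y, nm (x - a) < s -> nm (y - b) < s -> N (j x y).
Hypothesis dg : forall w, N w -> ~ K w -> differentiable g w /\ enorm (g w) < 1.
Hypothesis g_inj : forall w w', N w -> ~ K w -> N w' -> ~ K w' -> g w = g w' -> w = w'.
Hypothesis g_lim : forall k (eta : R), K k -> eta < 1 -> exists2 e : R, 0 < e &
  forall w, nm (w - k) < e -> N w -> ~ K w -> eta < enorm (g w).

(** For [x] in [closure D1] and [y] in [D2] the point [j x y] lies in [K], where [g] is not
    controlled; the value [0] is the limit from outside. Pairing with [e] makes the difference
    scalar. *)
Let h (y y' : V2) (e : V) (x : V1) : C :=
  if `[< closure D1 x >] then 0 else dot (g (j x y) - g (j x y')) e.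

Lemma face_small x y y' (eta e : R) : closure D1 x -> D2 y -> nm (x - a) < s ->
  (forall t : C, cabs t < 2 -> nm (y + t *: (y' - y) - b) < s) -> 0 < e ->
  exists2 d : R, 0 < d & forall x', nm (x' - x) < d -> ~ closure D1 x' ->
    enorm (g (j x' y) - g (j x' y')) < e.
Proof.
move=> Kx Dy xs ys e0.
(* If [g (j x' y)] has norm above [1 - th], then [schwarz_pick_ball] bounds the squared difference
   by less than [6 * th], hence by [e ^+ 2]. *)
pose th := Num.min (1 / 2) (e ^+ 2 / 6).
have th0 : 0 < th by rewrite lt_min !divr_gt0// exprn_gt0.
have th1 : th <= 1 / 2 by rewrite ge_min lexx.
have th2 : th * 6 <= e ^+ 2 by rewrite -ler_pdivlMr// ge_min lexx orbT.
have [|d d0 Hd] := g_lim (eta := 1 - th) (jK Kx Dy); first by lra.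
have [d1 d10 Hd1] := (cont_nm (fun x => j x y) x).1 (diff_cont (dj1 x y)) d d0.
have s1 : 0 < s - nm (x - a) by rewrite subr_gt0.
exists (Num.min d1 (s - nm (x - a))); first by rewrite lt_min d10.
move=> x'; rewrite lt_min => /andP[/Hd1 x1 x2] nx'.
have x's : nm (x' - a) < s.
  by apply: le_lt_trans (nm_tri _ x _) _; move: x2; move: (nm _) (nm _) => *; lra.
pose ga (t : C) : V := g (j x' (y + t *: (y' - y))).
have gaP (t : C) : cabs t < 2 -> differentiable g (j x' (y + t *: (y' - y))) /\ enorm (ga t) < 1.
  move=> t2; exact: (dg (jN x's (ys t t2)) (@jNK _ _ nx')).
have ga0 : ga 0 = g (j x' y) by rewrite /ga scale0r addr0.
have ga1 : ga 1 = g (j x' y') by rewrite /ga scale1r addrC subrK.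
have c0 : cabs (0 : C) < 2 by rewrite cabs0.
have g0 : 1 - th < enorm (g (j x' y)).
  have yb : nm (y - b) < s by have := ys 0 c0; rewrite scale0r addr0.
  exact: (Hd _ x1 (jN x's yb) (@jNK _ _ nx')).
have := @schwarz_pick_ball _ _ ga _ _; rewrite ga0 ga1 enormBC => H.
have {}H : enorm (g (j x' y) - g (j x' y')) ^+ 2 <= 3 * (1 - enorm (g (j x' y)) ^+ 2).
  apply: H => t /gaP[dgt g1]; last exact: g1.
  apply: (@dif_comp _ C V V (fun t : C => j x' (y + t *: (y' - y))) g); last exact: dgt.
  apply: (@dif_comp _ C V2 V (fun t : C => y + t *: (y' - y)) (j x')); last exact: dj2.
  exact: diff_affine.
move: H (enorm_ge0 (g (j x' y) - g (j x' y'))) g0.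
move: (enorm (g (j x' y) - g (j x' y'))) (enorm (g (j x' y))) => u v H u0 v0.
apply: (sqr_lt u0 e0); apply: le_lt_trans H _.
by move: v0 th0 th1 th2; move: (e ^+ 2) => w; nra.
Qed.

Lemma face_rado x y y' e : D2 y -> nm (x - a) < s ->
  (forall t : C, cabs t < 2 -> nm (y + t *: (y' - y) - b) < s) -> rado (h y y' e) x.
Proof.
move=> Dy xs ys; have c1 : cabs (1 : C) < 2 by rewrite cabs1; lra.
have c0 : cabs (0 : C) < 2 by rewrite cabs0.
have yb : nm (y - b) < s by have := ys 0 c0; rewrite scale0r addr0.
have y'b : nm (y' - b) < s by have := ys 1 c1; rewrite scale1r [y + _]addrC subrK.
have [Kx|nKx] := pselect (closure D1 x); last first.
  apply: rado_diff; apply: (@dif_near _ _ _ (fun x => dot (g (j x y) - g (j x y')) e)).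
    have : nbhs x (~` closure D1).
      by apply: open_nbhs_nbhs; split; [exact/closed_openC/closed_closure|exact: nKx].
    by apply: filterS => x' /= nx'; rewrite /h asboolF.
  apply: (@dif_comp _ V1 V C (fun x => g (j x y) - g (j x y')) (fun v => dot v e)); last exact: dif_dot.
  have d z : nm (z - b) < s -> differentiable (fun x => g (j x z)) x.
    move=> zb; apply: (@dif_comp _ V1 V V (fun x => j x z) g); first exact: dj1.
    by have [] := dg (jN xs zb) (@jNK _ _ nKx).
  by apply: differentiableB; exact: d.
have hx : h y y' e x = 0 by rewrite /h asboolT.
split; last by move=> /eqP /(_ hx) [].
apply/cont_nm => c c0'; have E0 : 0 < enorm e + 1 by rewrite ltr_wpDl// enorm_ge0.
have [d d0 Hd] := @face_small x y y' 0 (c / (enorm e + 1)) Kx Dy xs ys (divr_gt0 c0' E0).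
exists d; first exact: d0.
move=> x' x'd; rewrite hx subr0 nmE /h.
case: asboolP => [_|nx']; first by rewrite cabs0.
apply: le_lt_trans (cauchy_schwarz _ _) _.
have := Hd x' x'd nx'; rewrite (ltr_pdivlMr _ _ E0) => H; apply: le_lt_trans H.
by apply: ler_wpM2l; [exact: enorm_ge0|rewrite lerDl; exact: ler01].
Qed.

(** Keeping the pairing [j] abstract lets the same argument serve for boundary points of either
    factor, with the two variables exchanged. *)
Lemma face_contradiction : False.
Proof.
have s2 : 0 < s / 2 by rewrite divr_gt0.
have [y Dy yb] := (closure_nm _ _).1 bD2 _ s2.
have /nbhs_nm[d d0 dD] : nbhs y D2 by exact: open_nbhs_nbhs.
(* The bound [tau < s / 4] keeps the disc of radius [2] on the line from [y] to [y'] within [s] of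
   [b], as Schwarz-Pick requires. *)
pose tau := Num.min d (s / 4) / 2.
have m0 : 0 < Num.min d (s / 4) by rewrite lt_min d0 divr_gt0.
have tau0 : 0 < tau by rewrite divr_gt0.
have tm : tau < Num.min d (s / 4) by rewrite /tau; lra.
move: tm; rewrite lt_min => /andP[td ts].
pose v : V2 := (tau%:C : C) *: delta_mx 0 0.
have vn : nm v <= tau.
  rewrite nmZ cabs_real gtr0_norm// -[leRHS]mulr1 ler_pM2l//.
  apply: nm_le => [|i]; first exact: ler01.
  by rewrite mxE; case: (_ && _); rewrite ?cabs1 ?cabs0 ?ler01.
pose y' := y + v.
have yv : y' - y = v by rewrite /y' addrC addKr.
have ys (t : C) : cabs t < 2 -> nm (y + t *: (y' - y) - b) < s.
  move=> t2; rewrite yv addrAC; apply: le_lt_trans (nmD _ _) _; rewrite nmZ.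
  have : cabs t * nm v <= 2 * tau by rewrite ler_pM ?cabs_ge0 ?nm_ge0// ltW.
  by move: yb ts; move: (nm (y - b)) (cabs t * nm v) => A B; lra.
have [a' [a'D a'a a'C]] := sD1 aD1 s2.
have {}a'a : nm (a' - a) < s / 2 by apply: le_lt_trans (nm_le_enorm _) _.
(* Since [3 * r + s / 2 < s], [rado_zero_ball] can be used around the smooth point [a']. The ball of
   radius [r] about [a'] meets both [D1], where [h] vanishes, and the exterior of [D1]. *)
pose r := s / 8; have r0 : 0 < r by rewrite divr_gt0.
have in_s x : nm (x - a') < 3 * r -> nm (x - a) < s.
  move=> xa'; apply: le_lt_trans (nm_tri _ a' _) _; move: xa' a'a; rewrite /r.
  by move: (nm _) (nm _) => *; lra.
have [x xa' nx] := C1_exterior oD1 a'D a'C r0.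
have [c Dc ca'] := (closure_nm _ _).1 a'D.1 _ r0.
have /nbhs_nm[d' d'0 d'D] : nbhs c D1 by exact: open_nbhs_nbhs.
(* With the direction equal to the difference at the exterior point [x], the value of [h] at [x] is
   the squared norm of [e]. *)
pose e := g (j x y) - g (j x y').
have hx : h y y' e x = 0.
  apply: (@rado_zero_ball _ _ (h y y' e) a' c r d' d'0 _ ca' _ x xa').
    by move=> z /in_s za; exact: face_rado.
  by move=> z /d'D Dz; rewrite /h asboolT//; exact: subset_closure.
have c1 : cabs (1 : C) < 2 by rewrite cabs1; lra.
have c0 : cabs (0 : C) < 2 by rewrite cabs0.
have y0b : nm (y - b) < s by have := ys 0 c0; rewrite scale0r addr0.
have y'b : nm (y' - b) < s by have := ys 1 c1; rewrite scale1r [y + _]addrC subrK.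
have xs : nm (x - a) < s by apply: in_s; lra.
move: hx; rewrite /h asboolF// -/e => ee.
have /eqP : e = 0.
  apply/eqP; rewrite -enorm_eq0 -sqrf_eq0; have := dotxx e; rewrite ee.
  by move=> /eqP; rewrite eq_complex /= => /andP[/eqP <-].
rewrite subr_eq0 => /eqP gE.
have := g_inj (jN xs y0b) (@jNK _ _ nx) (jN xs y'b) (@jNK _ _ nx) gE => /j_inj yy.
have : v = 0 by rewrite -yv -yy subrr.
move=> /rowP /(_ 0); rewrite !mxE !eqxx mulr1 => /eqP.
by rewrite -cabs_eq0 cabs_real normr_eq0 gt_eqF.
Qed.

End Face.

(** * Products in the ball *)

Section Geometry.
Variable R : realType.
Local Notation C := (R[i]^o).

Lemma thin_contradiction n (K N : set (Cvec R n)) (g : Cvec R n -> Cvec R n) w0 i :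
  open N -> N w0 -> K w0 -> (forall w, K w -> w 0 i = 0) ->
  (forall w, N w -> ~ K w -> differentiable g w /\ enorm (g w) < 1) ->
  (forall k (eta : R), K k -> eta < 1 -> exists2 e : R, 0 < e &
    forall w, nm (w - k) < e -> N w -> ~ K w -> eta < enorm (g w)) -> False.
Proof.
move=> oN Nw Kw Ki dg glim.
have /nbhs_nm[s s0 sN] : nbhs w0 N by exact: open_nbhs_nbhs.
pose e : Cvec R n := delta_mx 0 i.
have e1 : nm e <= 1.
  apply: nm_le => [|k]; first exact: ler01.
  by rewrite mxE; case: (_ && _); rewrite ?cabs1 ?cabs0 ?ler01.
pose L (t : C) := w0 + t *: e.
have Ln t : nm (L t - w0) <= cabs t.
  by rewrite /L addrC addKr nmZ ler_piMr ?cabs_ge0.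
have LK t : 0 < cabs t -> ~ K (L t).
  move=> t0 /Ki; rewrite !mxE (Ki _ Kw) !eqxx mulr1 add0r => t00.
  by move: t0; rewrite t00 cabs0 ltxx.
pose r := s / 2; have r0 : 0 < r by rewrite divr_gt0.
have rs : r < s by rewrite /r; lra.
have LN t : cabs t <= r -> N (L t).
  by move=> tr; apply: sN; apply: le_lt_trans (Ln t) _; exact: le_lt_trans rs.
pose ga t := g (L t).
have dga t : 0 < cabs t <= r -> differentiable ga t /\ enorm (ga t) < 1.
  move=> /andP[t0 tr]; have [dgt g1] := dg _ (LN t tr) (LK t t0).
  by split; [exact: dif_line dgt|exact: g1].
have cS : compact [set t : C | cabs t = r].
  have dE (P : R -> Prop) : [set t : C | P (nm (t - 0))] = [set t | P (cabs t)].
    by apply/funext => t; rewrite /mkset subr0 nmE.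
  rewrite -(dE (fun x => x = r)); apply: compact_sphere.
  by rewrite (dE (fun x => x <= r)); exact: compact_disc.
have [| |p /set_mem /= pr pmax] := @compact_EVT_max _ _ (fun t => enorm (ga t)) _ _ cS.
- by exists (r%:C : C); rewrite /= cabs_real gtr0_norm.
- apply: continuous_in_subspaceT => t /set_mem /= tr.
  have [|dt _] := dga t; first by rewrite tr r0 lexx.
  apply: (@continuous_comp C (Cvec R n) R ga (@enorm R n)); last exact: enorm_continuous.
  exact: diff_cont dt.
have [|_ p1] := dga p; first by rewrite pr r0 lexx.
have le t : 0 < cabs t <= r -> enorm (ga t) <= enorm (ga p).
  move=> tr; pose v := unit_dir (ga t).
  have -> : enorm (ga t) = cabs (dot (ga t) v).
    by rewrite dot_unit_dir cabs_real ger0_norm// enorm_ge0.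
  apply: (@max_modulus_punctured _ (fun t => dot (ga t) v) r (enorm (ga p)) 1 r0 _ _ _ t tr).
  - move=> u /dga[du _].
    by apply: (@dif_comp _ C (Cvec R n) C ga (fun w => dot w v) u du); exact: dif_dot.
  - by move=> u /dga[_ u1]; apply: le_trans (cabs_dot_dir _ _) _; exact: ltW.
  - by move=> u ur; apply: le_trans (cabs_dot_dir _ _) _; apply: pmax; exact/mem_set.
(* The maximum of the norm on the circle is below [1], so it is an admissible [eta] at the centre
   [w0]; there it contradicts [le]. *)
have [c c0 Hc] := glim w0 _ Kw p1.
pose t := Num.min r c / 2; have m0 : 0 < Num.min r c by rewrite lt_min r0.
have t0 : 0 < t by rewrite divr_gt0.
have : t < Num.min r c by rewrite /t; lra.
rewrite lt_min => /andP[tr tc].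
have ct : cabs (t%:C : C) = t by rewrite cabs_real gtr0_norm.
have := le t%:C; rewrite ct t0 (ltW tr) => /(_ isT); apply/negP; rewrite -ltNge.
apply: Hc; [by apply: le_lt_trans (Ln _) _; rewrite ct| |].
  by apply: LN; rewrite ct ltW.
by apply: LK; rewrite ct.
Qed.

Section Unpad.
Variables (k n : nat).
Hypothesis kn : (k <= n)%N.

Definition unpad (w : Cvec R n) : Cvec R k := \row_i w 0 (widen_ord kn i).

Lemma unpadK (v : Cvec R k) : unpad (pad n v) = v.
Proof.
apply/rowP => i; rewrite !mxE.
by rewrite (_ : insub _ = Some i)//; exact: (valK i).
Qed.

Lemma padK (w : Cvec R n) : (n <= k)%N -> pad n (unpad w) = w.
Proof.
move=> nk; apply/rowP => i; rewrite !mxE; case: insubP => [u _ ui|] /=.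
  by rewrite mxE; congr (w 0 _); apply/val_inj; rewrite /= -ui.
by rewrite (leq_trans (ltn_ord i) nk).
Qed.

Lemma nm_unpad (w w' : Cvec R n) : nm (unpad w - unpad w') <= nm (w - w').
Proof.
apply: nm_le => [|i]; first exact: nm_ge0.
rewrite !mxE; apply: le_trans (cabs_coord _ (widen_ord kn i)).
by rewrite !mxE.
Qed.

End Unpad.

Lemma nm_pad k n (v v' : Cvec R k) : nm (pad n v - pad n v') <= nm (v - v').
Proof.
apply: nm_le => [|i]; first exact: nm_ge0.
rewrite !mxE; case: insubP => [u _ _|_] /=; last by rewrite subrr cabs0 nm_ge0.
by apply: le_trans (cabs_coord _ u); rewrite !mxE.
Qed.

Lemma nm_row_mx k l (x x' : Cvec R k) (y y' : Cvec R l) :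
  nm (row_mx x y - row_mx x' y') <= nm (x - x') + nm (y - y').
Proof.
rewrite opp_row_mx add_row_mx.
apply: nm_le => [|i]; first by rewrite addr_ge0 ?nm_ge0.
rewrite mxE; case: (fintype.split i) => a; apply: le_trans (cabs_coord _ a) _.
  by rewrite lerDl nm_ge0.
by rewrite lerDr nm_ge0.
Qed.

Lemma nm_lsubmx k l (w w' : Cvec R (k + l)) : nm (lsubmx w - lsubmx w') <= nm (w - w').
Proof.
apply: nm_le => [|i]; first exact: nm_ge0.
by rewrite !mxE; apply: le_trans (cabs_coord _ (lshift l i)); rewrite !mxE.
Qed.

Lemma nm_rsubmx k l (w w' : Cvec R (k + l)) : nm (rsubmx w - rsubmx w') <= nm (w - w').
Proof.
apply: nm_le => [|i]; first exact: nm_ge0.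
by rewrite !mxE; apply: le_trans (cabs_coord _ (rshift k i)); rewrite !mxE.
Qed.

Lemma dif_pad_l k l n (x : Cvec R k) (y : Cvec R l) :
  differentiable (fun x => pad n (row_mx x y)) x.
Proof.
apply: dif_row => i; pose o : option 'I_(k + l) := insub (val i).
have -> : (fun x => pad n (row_mx x y) 0 i : C) = if o is Some u then
    match fintype.split u with inl a => fun x => x 0 a | inr b => fun=> y 0 b end else fun=> 0.
  by apply/funext => z; rewrite mxE -/o; case: o => [u|] //=; rewrite mxE; case: (fintype.split u).
by case: o => [u|]; [case: (fintype.split u) => a; [exact: dif_coord|exact: dif_cst]|exact: dif_cst].
Qed.

Lemma dif_pad_r k l n (x : Cvec R k) (y : Cvec R l) :
  differentiable (fun y => pad n (row_mx x y)) y.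
Proof.
apply: dif_row => i; pose o : option 'I_(k + l) := insub (val i).
have -> : (fun y => pad n (row_mx x y) 0 i : C) = if o is Some u then
    match fintype.split u with inl a => fun=> x 0 a | inr b => fun y => y 0 b end else fun=> 0.
  by apply/funext => z; rewrite mxE -/o; case: o => [u|] //=; rewrite mxE; case: (fintype.split u).
by case: o => [u|]; [case: (fintype.split u) => a; [exact: dif_cst|exact: dif_coord]|exact: dif_cst].
Qed.

End Geometry.

(** * Boundary points of a product *)

Section Product.
Variables (R : realType) (n1 n2 n : nat).
Local Notation C := (R[i]^o).
Variables (D1 : set (Cvec R n1.+1)) (D2 : set (Cvec R n2.+1)).
Hypothesis oD1 : open D1.
Hypothesis oD2 : open D2.
Hypothesis sD1 : dense_C1_boundary D1.
Hypothesis sD2 : dense_C1_boundary D2.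
Hypothesis n12 : (n1.+1 + n2.+1 <= n)%N.
Local Notation D := (prod_in n D1 D2).
Local Notation K := (closure D).

Let j (x : Cvec R n1.+1) (y : Cvec R n2.+1) : Cvec R n := pad n (row_mx x y).
Let p1 (w : Cvec R n) : Cvec R n1.+1 := lsubmx (unpad n12 w).
Let p2 (w : Cvec R n) : Cvec R n2.+1 := rsubmx (unpad n12 w).

Let p1j x y : p1 (j x y) = x.
Proof. by rewrite /p1 unpadK row_mxKl. Qed.

Let p2j x y : p2 (j x y) = y.
Proof. by rewrite /p2 unpadK row_mxKr. Qed.

Let nm_j x x' y y' : nm (j x y - j x' y') <= nm (x - x') + nm (y - y').
Proof. exact: le_trans (nm_pad _ _ _) (nm_row_mx _ _ _ _). Qed.

Let nm_p1 w w' : nm (p1 w - p1 w') <= nm (w - w').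
Proof. exact: le_trans (nm_lsubmx _ _) (nm_unpad _ _ _). Qed.

Let nm_p2 w w' : nm (p2 w - p2 w') <= nm (w - w').
Proof. exact: le_trans (nm_rsubmx _ _) (nm_unpad _ _ _). Qed.

Let Kp w : K w -> closure D1 (p1 w) /\ closure D2 (p2 w).
Proof.
move=> Kw; split; apply/closure_nm => e e0;
  have [_ [x Dx [y Dy <-]] xw] := (closure_nm _ _).1 Kw e e0.
  by exists x => //; rewrite -(p1j x y); exact: le_lt_trans (nm_p1 _ _) xw.
by exists y => //; rewrite -(p2j x y); exact: le_lt_trans (nm_p2 _ _) xw.
Qed.

Let jK x y : closure D1 x -> closure D2 y -> K (j x y).
Proof.
move=> Kx Ky; apply/closure_nm => e e0; have e2 : 0 < e / 2 by rewrite divr_gt0.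
have [x' Dx xx] := (closure_nm _ _).1 Kx _ e2.
have [y' Dy yy] := (closure_nm _ _).1 Ky _ e2.
exists (j x' y'); first by exists x' => //; exists y'.
by apply: le_lt_trans (nm_j _ _ _ _) _; move: xx yy; move: (nm _) (nm _) => *; lra.
Qed.

Lemma no_inverse w0 (N : set (Cvec R n)) (g : Cvec R n -> Cvec R n) : boundary D w0 ->
  open N -> N w0 ->
  (forall w, N w -> ~ K w -> differentiable g w /\ enorm (g w) < 1) ->
  (forall w w', N w -> ~ K w -> N w' -> ~ K w' -> g w = g w' -> w = w') ->
  (forall k (eta : R), K k -> eta < 1 -> exists2 e : R, 0 < e &
    forall w, nm (w - k) < e -> N w -> ~ K w -> eta < enorm (g w)) -> False.
Proof.
move=> [Kw iw] oN Nw dg ginj glim.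
have [nE|] := leqP n (n1.+1 + n2.+1); last first.
  (* This is the first index beyond both factors, where [pad] writes [0]; the coordinate therefore
     vanishes on [K]. *)
  move=> lt; pose i : 'I_n := Ordinal lt.
  apply: (@thin_contradiction _ _ K N g w0 i oN Nw Kw _ dg glim) => w Kw'.
  apply/eqP; rewrite -cabs_eq0 eq_le cabs_ge0 andbT.
  apply/ler_addgt0Pr => e e0; rewrite add0r.
  have [_ [x Dx [y Dy <-]] xw] := (closure_nm _ _).1 Kw' e e0.
  apply: ltW; apply: le_lt_trans xw; rewrite nmBC.
  apply: le_trans (cabs_coord _ i); rewrite !mxE insubF ?subr0//=.
  by rewrite ltnn.
have wE w : w = j (p1 w) (p2 w) by rewrite /j /p1 /p2 hsubmxK padK.
have [Ka Kb] := Kp Kw.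
have /nbhs_nm[s s0 sN] : nbhs w0 N by exact: open_nbhs_nbhs.
have s2 : 0 < s / 2 by rewrite divr_gt0.
have jN x y : nm (x - p1 w0) < s / 2 -> nm (y - p2 w0) < s / 2 -> N (j x y).
  move=> xs ys; apply: sN; rewrite [w0]wE; apply: le_lt_trans (nm_j _ _ _ _) _.
  by move: xs ys; move: (nm _) (nm _) => *; lra.
(* Since [w0] is not interior to [D], one of its projections lies outside the corresponding open
   factor, hence on the boundary of that factor. *)
have [Da|nDa] := pselect (D1 (p1 w0)); last first.
  have ba : boundary D1 (p1 w0) by split=> // /interior_subset.
  apply: (@face_contradiction _ _ _ _ D1 D2 K N g j (p1 w0) (p2 w0) oD1 sD1 ba oD2 Kb
    _ _ _ _ _ (s / 2) s2 jN dg ginj glim).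
  - by move=> x y; exact: dif_pad_l.
  - by move=> x y; exact: dif_pad_r.
  - by move=> x y y' /(congr1 p2); rewrite !p2j.
  - by move=> x y Kx Dy; exact: (jK Kx (subset_closure Dy)).
  - by move=> x y nx /Kp[]; rewrite p1j.
have [Db|nDb] := pselect (D2 (p2 w0)); last first.
  have bb : boundary D2 (p2 w0) by split=> // /interior_subset.
  apply: (@face_contradiction _ _ _ _ D2 D1 K N g (fun y x => j x y) (p2 w0) (p1 w0) oD2 sD2 bb
    oD1 Ka _ _ _ _ _ (s / 2) s2 _ dg ginj glim).
  - by move=> x y; exact: dif_pad_r.
  - by move=> x y; exact: dif_pad_l.
  - by move=> x y y' /(congr1 p1); rewrite !p1j.
  - by move=> x y Kx Dy; exact: (jK (subset_closure Dy) Kx).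
  - by move=> x y nx /Kp[_]; rewrite p2j.
  - by move=> x y xs ys; exact: jN.
apply: iw; have /nbhs_nm[d d0 dD] : nbhs (p1 w0) D1 by exact: open_nbhs_nbhs.
have /nbhs_nm[c c0 cD] : nbhs (p2 w0) D2 by exact: open_nbhs_nbhs.
apply/nbhs_nm; exists (Num.min d c); first by rewrite lt_min d0.
move=> w; rewrite lt_min => /andP[wd wc]; rewrite [w]wE.
exists (p1 w); first by apply: dD; exact: le_lt_trans (nm_p1 _ _) wd.
by exists (p2 w) => //; apply: cD; exact: le_lt_trans (nm_p2 _ _) wc.
Qed.

End Product.

Theorem theorem2p11 (R : realType) (n1 n2 n : nat)
    (D1 : set (Cvec R n1)) (D2 : set (Cvec R n2))
    (n1_ge1 : (1 <= n1)%N) (n2_ge1 : (1 <= n2)%N)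
    (D1_domain : is_domain D1) (D2_domain : is_domain D2)
    (D1_bd : dense_C1_boundary D1) (D2_bd : dense_C1_boundary D2)
    (n_ge : (n1 + n2 <= n)%N) :
  let D := prod_in n D1 D2 in
  let D' := unit_ball R n `\` closure D in
  relatively_compact_in D (unit_ball R n) ->
  connected D' ->
  forall z : Cvec R n, D' z ->
    squeezing D' z = fridman D' z /\
    fridman D' z = caratheodory_dist (boundary D) z.
Proof.
move=> D D' [cK KB] cD' z Dz.
destruct n1 as [|n1]; first by [].
destruct n2 as [|n2]; first by [].
destruct n as [|[|m]]; [by []|by exfalso; move: n_ge; rewrite addSn addnS|].
have [D1n oD1 _] := D1_domain; have [D2n oD2 _] := D2_domain.
have D0 : D !=set0.
  by have [[x Dx] [y Dy]] := (D1n, D2n); exists (pad m.+2 (row_mx x y)); exists x => //; exists y.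
have [w0 [bw w00 w01 wmin]] := nearest cK KB D0 Dz.
have [Kw _] := bw.
have -> : squeezing D' z = enorm (moebius z w0) by exact: squeezing_hole.
have -> : fridman D' z = enorm (moebius z w0).
  apply: fridman_hole => // N g.
  exact: no_inverse bw.
by split=> //; rewrite (caratheodory_distE KB Dz bw).
Qed.
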